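(* Let $(L_i,A_i,B_i,V_i)$, $1\le i\le m$, be componentwise regular finite-component data. Put $$L=\prod_iL_i,\qquad A=\prod_iA_i,\qquad B_0=\prod_iB_i,\qquad V=\bigoplus_iV_i.$$ Then the finite-component datum $(L,A,B_0,V)$ is componentwise regular.
   Context: All groups are complex algebraic; for distributions, complex varieties are regarded as real Nash manifolds, and $\mathcal S^*(X)$ is the space of Schwartz distributions on $X$. For a reductive group $L$ acting linearly on $V$: $Q_L(V)=V/V^L$ (identified with its canonical $L$-stable model), $\pi:Q_L(V)\to Q_L(V)/\!/L$ the categorical quotient, $\Gamma_L(V)=\pi^{-1}(\pi(0))$, $R_L(V)=Q_L(V)\setminus\Gamma_L(V)$. Finite-component datum. Let $\widetilde G=Z\times G_{\mathrm{ss}}$ with $Z$ a complex torus and $G_{\mathrm{ss}}$ simply connected semisimple, let $\widetilde\theta$ be an algebraic involution of $\widetilde G$, $\widetilde H=\widetilde G^{\widetilde\theta}$, $\mathfrak p$ the $(-1)$-eigenspace of $d\widetilde\theta$, and $V=Q_{\widetilde H}(\mathfrak p)$. Put $L=\operatorname{Ad}(\widetilde H)|_V$, which is a connected reductive group with $V^L=0$. Let $$\widetilde A_{\widetilde\theta}=\{g\in\widetilde G:g^{-1}\widetilde\theta(g)\in Z(\widetilde G)\},\qquad J=\operatorname{Ad}(\widetilde A_{\widetilde\theta})|_V,\qquad A=J/L.$$ Then $J$ is a reductive algebraic group with identity component $L$, and $A$ is a finite abelian group. $B_0\le A$ denotes the image of $\widetilde H$ in $A$ (the trivial subgroup for such a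 pair). The quadruple $(L,A,B_0,V)$ is the finite-component datum. For a direct product of pairs the group $J$ is the product of the groups $J_i$, acting factorwise on $V=\bigoplus_iV_i$. For a character $\lambda\in\widehat A$ and a $J$-stable open $X\subset Q_L(V)$, $$\mathcal S^*(X)^{L,\lambda}=\{T\in\mathcal S^*(X)^L: j_*T=\lambda(jL)T\ \text{for every }j\in J\}.$$ The datum is componentwise regular if for every nontrivial $\lambda\in\widehat A$ with $\lambda|_{B_0}=1$, $$\mathcal S^*(R_L(V))^{L,\lambda}=0\ \Longrightarrow\ \mathcal S^*(Q_L(V))^{L,\lambda}=0.$$ *)

(* Defs.v *)
From HB Require Import structures.
From mathcomp Require Import all_boot all_order all_algebra.
From mathcomp Require Import all_classical all_reals all_analysis.
From mathcomp Require Import complex.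
From mathcomp Require mpoly.

Set Implicit Arguments.
Unset Strict Implicit.
Unset Printing Implicit Defensive.

Import Order.TTheory GRing.Theory Num.Theory numFieldNormedType.Exports.
Local Open Scope classical_set_scope.
Local Open Scope ring_scope.
Local Open Scope complex_scope.

Section AlgebraicGroups.
Variable R : realType.
Local Notation C := R[i].

(* A regular function on GL_N is a polynomial in the entries of g and of g^-1
   (equivalently, in the entries of g and 1/det g). *)
Definition regfun (N : nat) := mpoly.mpoly (N * N + N * N) C.

Definition reg_eval N (f : regfun N) (g : 'M[C]_N) : C :=
  mpoly.meval (fun k => row_mx (mxvec g) (mxvec (invmx g)) 0 k) f.

(* Differential of f at the identity in the direction X; the differential of
   g |-> g^-1 at the identity is X |-> - X. *)
Definition reg_diff1 N (f : regfun N) (X : 'M[C]_N) : C :=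
  \sum_(k < N * N + N * N)
     reg_eval (mpoly.mderiv k f) 1%:M * row_mx (mxvec X) (mxvec (- X)) 0 k.

Definition zclosed N (S : set 'M[C]_N) : Prop :=
  exists F : set (regfun N),
    S = [set g | g \in unitmx /\ forall f, F f -> reg_eval f g = 0].

Definition zconnected N (S : set 'M[C]_N) : Prop :=
  forall S1 S2 : set 'M[C]_N, zclosed S1 -> zclosed S2 ->
    S `<=` S1 `|` S2 -> S `&` S1 `&` S2 = set0 -> S `<=` S1 \/ S `<=` S2.

Definition mxgroup N (G : set 'M[C]_N) : Prop :=
  [/\ G `<=` [set g | g \in unitmx], G 1%:M,
      forall g h, G g -> G h -> G (g *m h)
    & forall g, G g -> G (invmx g)].

Definition alg_group N (G : set 'M[C]_N) : Prop := mxgroup G /\ zclosed G.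

Definition mxcenter N (G : set 'M[C]_N) : set 'M[C]_N :=
  [set z | G z /\ forall g, G g -> z *m g = g *m z].

Definition regmap (N N' : nat) := 'I_N' -> 'I_N' -> regfun N.

Definition regmap_eval N N' (F : regmap N N') (g : 'M[C]_N) : 'M[C]_N' :=
  \matrix_(i, j) reg_eval (F i j) g.

Definition regmap_diff1 N N' (F : regmap N N') (X : 'M[C]_N) : 'M[C]_N' :=
  \matrix_(i, j) reg_diff1 (F i j) X.

Definition alg_hom N N' (G : set 'M[C]_N) (G' : set 'M[C]_N')
    (F : regmap N N') : Prop :=
  (forall g, G g -> G' (regmap_eval F g)) /\
  (forall g h, G g -> G h ->
     regmap_eval F (g *m h) = regmap_eval F g *m regmap_eval F h).

Definition alg_isom N N' (G : set 'M[C]_N) (G' : set 'M[C]_N') : Prop :=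
  exists (F : regmap N N') (F' : regmap N' N),
    [/\ alg_hom G G' F, alg_hom G' G F',
        forall g, G g -> regmap_eval F' (regmap_eval F g) = g
      & forall g, G' g -> regmap_eval F (regmap_eval F' g) = g].

Definition diag_group (r : nat) : set 'M[C]_r :=
  [set diag_mx d | d in [set d : 'rV[C]_r | forall k, d 0 k != 0]].

Definition torus N (Z : set 'M[C]_N) : Prop :=
  alg_group Z /\ exists r, alg_isom (@diag_group r) Z.

Definition commutator_subgroup N (G : set 'M[C]_N) : set 'M[C]_N :=
  [set x | forall K, mxgroup K ->
     (forall g h, G g -> G h -> K (invmx g *m invmx h *m g *m h)) -> K x].

Definition solvable_group N (G : set 'M[C]_N) : Prop :=
  exists k, iter k (@commutator_subgroup N) G `<=` [set 1%:M].

(* The radical of G is trivial. *)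
Definition semisimple N (G : set 'M[C]_N) : Prop :=
  [/\ alg_group G, zconnected G
    & forall K : set 'M[C]_N, alg_group K -> K `<=` G -> zconnected K ->
        (forall g k, G g -> K k -> K (g *m k *m invmx g)) ->
        solvable_group K -> K `<=` [set 1%:M]].

(* R[i] carries no topology in the library; 'M[R[i]]_N receives that of its
   matrices of real and imaginary parts. *)
Definition re_im_mx m n (g : 'M[C]_(m, n)) : 'M[R]_(m, n + n) :=
  row_mx (map_mx (@complex.Re R) g) (map_mx (@complex.Im R) g).

Local Notation I01 := (`[0, 1]%classic : set R).

Definition path_in N (G : set 'M[C]_N) (a b : 'M[C]_N) (c : R -> 'M[C]_N) :=
  [/\ {within I01, continuous (fun t => re_im_mx (c t))},
      forall t, I01 t -> G (c t), c 0 = a & c 1 = b].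

Definition simply_connected N (G : set 'M[C]_N) : Prop :=
  (forall a b, G a -> G b -> exists c, path_in G a b c) /\
  (forall a c, path_in G a a c ->
     exists h : R * R -> 'M[C]_N,
       [/\ {within I01 `*` I01, continuous (fun st => re_im_mx (h st))},
           forall s, I01 s -> path_in G a a (fun t => h (s, t)),
           forall t, I01 t -> h (0, t) = c t
         & forall t, I01 t -> h (1, t) = a]).

(* The tangent space at the identity, with Ad g acting by conjugation. *)
Definition Lie N (G : set 'M[C]_N) : set 'M[C]_N :=
  [set X | forall f : regfun N,
     (forall g, G g -> reg_eval f g = 0) -> reg_diff1 f X = 0].

End AlgebraicGroups.

(* The product Z x G_ss is taken as an internal direct product; since bijective
   homomorphisms of complex algebraic groups are isomorphisms, this is the
   same as the product of algebraic groups. *)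
Record involutive_pair (R : realType) := InvolutivePair {
  pair_dim : nat;
  pair_grp : set 'M[R[i]]_pair_dim;
  pair_tor : set 'M[R[i]]_pair_dim;
  pair_ss : set 'M[R[i]]_pair_dim;
  pair_inv : regmap R pair_dim pair_dim;
  pair_grp_alg : alg_group pair_grp;
  pair_tor_torus : torus pair_tor;
  pair_ss_semisimple : semisimple pair_ss;
  pair_ss_sc : simply_connected pair_ss;
  pair_comm : forall z s, pair_tor z -> pair_ss s -> z *m s = s *m z;
  pair_disj : pair_tor `&` pair_ss = [set 1%:M];
  pair_prod : pair_grp = [set z *m s | z in pair_tor & s in pair_ss];
  pair_inv_hom : alg_hom pair_grp pair_grp pair_inv;
  pair_inv_invol : forall g, pair_grp g ->
    regmap_eval pair_inv (regmap_eval pair_inv g) = g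
}.

Arguments pair_grp {R} i _.
Arguments pair_tor {R} i _.
Arguments pair_ss {R} i _.
Arguments pair_inv {R} i _ _.

(* V is 'cV[C]_fc_dim; fc_A is A = J / L and fc_B its subgroup B_0, both as
   sets of cosets of L, so that J is the union of fc_A. *)
Record fc_datum (R : realType) := FcDatum {
  fc_dim : nat;
  fc_L : set 'M[R[i]]_fc_dim;
  fc_A : set (set 'M[R[i]]_fc_dim);
  fc_B : set (set 'M[R[i]]_fc_dim)
}.

Arguments fc_L {R} f _.
Arguments fc_A {R} f _.
Arguments fc_B {R} f _.

Section Data.
Variable R : realType.
Local Notation C := R[i].

Definition pair_fix (P : involutive_pair R) : set 'M[C]_(pair_dim P) :=
  [set g | pair_grp P g /\ regmap_eval (pair_inv P) g = g].

Definition pair_minus (P : involutive_pair R) : set 'M[C]_(pair_dim P) :=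
  [set X | Lie (pair_grp P) X /\ regmap_diff1 (pair_inv P) X = - X].

Definition pair_A (P : involutive_pair R) : set 'M[C]_(pair_dim P) :=
  [set g | pair_grp P g /\
     mxcenter (pair_grp P) (invmx g *m regmap_eval (pair_inv P) g)].

Arguments pair_fix : clear implicits.
Arguments pair_minus : clear implicits.
Arguments pair_A : clear implicits.

Definition Ad N (g X : 'M[C]_N) : 'M[C]_N := g *m X *m invmx g.

(* io identifies 'cV[C]_n with the H-stable complement, in the (-1)-eigenspace
   p, of the space of H-invariants: the canonical model of Q_H(p) = p / p^H. *)
Definition canonical_model (P : involutive_pair R) n
    (io : {linear 'cV[C]_n -> 'M[C]_(pair_dim P)}) : Prop :=
  let pH := [set X | pair_minus P X /\ forall h, pair_fix P h -> Ad h X = X] in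
  [/\ injective io,
      forall v, pair_minus P (io v),
      forall h v, pair_fix P h -> exists w, io w = Ad h (io v),
      forall v, pH (io v) -> v = 0
    & forall X, pair_minus P X -> exists X0 v, pH X0 /\ X = X0 + io v].

(* Ad(S)|_V, as matrices acting on column vectors. *)
Definition Ad_image N n (io : {linear 'cV[C]_n -> 'M[C]_N})
    (S : set 'M[C]_N) : set 'M[C]_n :=
  [set M | exists2 g, S g & forall v, io (M *m v) = Ad g (io v)].

Definition mxcoset n (L : set 'M[C]_n) (M : 'M[C]_n) : set 'M[C]_n :=
  [set M *m l | l in L].

Definition is_finite_component (D : fc_datum R) : Prop :=
  exists (P : involutive_pair R)
         (io : {linear 'cV[C]_(fc_dim D) -> 'M[C]_(pair_dim P)}),
    [/\ canonical_model io,
        fc_L D = Ad_image io (pair_fix P),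
        fc_A D = [set mxcoset (fc_L D) M | M in Ad_image io (pair_A P)]
      & fc_B D = [set mxcoset (fc_L D) M | M in Ad_image io (pair_fix P)]].

Definition mxset_prod m (n : 'I_m -> nat) (S : forall i, set 'M[C]_(n i)) :
    set 'M[C]_(\sum_i n i) :=
  [set \mxdiag_i g i | g in [set g : forall i, 'M[C]_(n i) |
                               forall i, S i (g i)]].

Definition prod_fc m (D : 'I_m -> fc_datum R) : fc_datum R :=
  @FcDatum R (\sum_i fc_dim (D i))
    (mxset_prod (fun i => fc_L (D i)))
    [set mxset_prod K | K in [set K : forall i, set 'M[C]_(fc_dim (D i)) |
                                forall i, fc_A (D i) (K i)]]
    [set mxset_prod K | K in [set K : forall i, set 'M[C]_(fc_dim (D i)) |
                                forall i, fc_B (D i) (K i)]].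

End Data.

Section Schwartz.
Variable R : realType.
Local Notation C := R[i].

Inductive semialgebraic d : set 'rV[R]_d -> Prop :=
| semialg_pos (p : mpoly.mpoly d R) :
    semialgebraic [set x | 0 < mpoly.meval (fun k => x 0 k) p]
| semialg_compl S : semialgebraic S -> semialgebraic (~` S)
| semialg_inter S T :
    semialgebraic S -> semialgebraic T -> semialgebraic (S `&` T).

Definition partial d (k : 'I_d) (f : 'rV[R]_d -> R) : 'rV[R]_d -> R :=
  'D_(delta_mx 0 k) f.

Definition partials d (s : seq 'I_d) (f : 'rV[R]_d -> R) : 'rV[R]_d -> R :=
  foldr (@partial d) f s.

(* Functions on an open set U are represented by total functions, whose values
   off U play no role. *)
Definition smooth_on d (U : set 'rV[R]_d) (f : 'rV[R]_d -> R) : Prop :=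
  forall (s : seq 'I_d) x, U x ->
    {for x, continuous (partials s f)} /\
    (forall k, derivable (partials s f) x (delta_mx 0 k)).

Definition nash_on d (U : set 'rV[R]_d) (g : 'rV[R]_d -> R) : Prop :=
  smooth_on U g /\
  semialgebraic
    [set z : 'rV[R]_(d + 1) | U (lsubmx z) /\ rsubmx z 0 0 = g (lsubmx z)].

Definition csmooth_on d (U : set 'rV[R]_d) (f : 'rV[R]_d -> C) : Prop :=
  smooth_on U (fun x => complex.Re (f x)) /\
  smooth_on U (fun x => complex.Im (f x)).

Definition cpartial d (k : 'I_d) (f : 'rV[R]_d -> C) (x : 'rV[R]_d) : C :=
  partial k (fun y => complex.Re (f y)) x +i*
  partial k (fun y => complex.Im (f y)) x.

(* The algebra of Nash differential operators on U, generated by the Nash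
   functions and the coordinate derivations. *)
Inductive nash_diffop d (U : set 'rV[R]_d) :
    (('rV[R]_d -> C) -> ('rV[R]_d -> C)) -> Prop :=
| nash_mult g : nash_on U g -> nash_diffop U (fun f x => (g x)%:C * f x)
| nash_partial k : nash_diffop U (cpartial k)
| nash_add D1 D2 : nash_diffop U D1 -> nash_diffop U D2 ->
    nash_diffop U (fun f x => D1 f x + D2 f x)
| nash_comp D1 D2 : nash_diffop U D1 -> nash_diffop U D2 ->
    nash_diffop U (fun f => D1 (D2 f)).

Definition schwartz_on d (U : set 'rV[R]_d) (f : 'rV[R]_d -> C) : Prop :=
  csmooth_on U f /\
  forall D, nash_diffop U D ->
    exists M : R, forall x, U x -> `|D f x| <= M%:C.

Definition cvec n (x : 'rV[R]_(n + n)) : 'cV[C]_n :=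
  \col_k (x 0 (lshift n k) +i* x 0 (rshift n k)).

Definition schwartz n (X : set 'cV[C]_n) (f : 'cV[C]_n -> C) : Prop :=
  schwartz_on (@cvec n @^-1` X) (f \o @cvec n).

(* A Schwartz distribution is a linear functional on the Schwartz space of X
   that is continuous at 0 for the topology defined by the seminorms
   sup_X |D f|, D a Nash differential operator.  Only the values of T on
   Schwartz functions matter; linearity and continuity force T f to depend
   only on the restriction of f to X. *)
Definition schwartz_distribution n (X : set 'cV[C]_n)
    (T : ('cV[C]_n -> C) -> C) : Prop :=
  (forall (a : C) f g, schwartz X f -> schwartz X g ->
     T (fun v => a * f v + g v) = a * T f + T g) /\
  (forall e : R, 0 < e ->
     exists (r : nat)
            (D : 'I_r -> ('rV[R]_(n + n) -> C) -> ('rV[R]_(n + n) -> C))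
            (delta : R),
       [/\ 0 < delta,
           forall i, nash_diffop (@cvec n @^-1` X) (D i)
         & forall f, schwartz X f ->
             (forall i x, X (cvec x) -> `|D i (f \o @cvec n) x| < delta%:C) ->
             `|T f| < e%:C]).

Definition pushforward n (j : 'M[C]_n) (T : ('cV[C]_n -> C) -> C) :
    ('cV[C]_n -> C) -> C :=
  fun f => T (fun v => f (j *m v)).

End Schwartz.

Section Regularity.
Variable R : realType.
Local Notation C := R[i].

Definition peval n (f : mpoly.mpoly n C) (v : 'cV[C]_n) : C :=
  mpoly.meval (fun k => v k 0) f.

Definition invariant_poly n (L : set 'M[C]_n) (f : mpoly.mpoly n C) : Prop :=
  forall l v, L l -> peval f (l *m v) = peval f v.

(* Gamma_L(V) = pi^-1(pi(0)): V // L is the spectrum of the ring of invariants,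
   so two points of V have the same image in it iff all invariants agree on
   them. *)
Definition zero_fiber n (L : set 'M[C]_n) : set 'cV[C]_n :=
  [set v | forall f, invariant_poly L f -> peval f v = peval f 0].

(* R_L(V) for V^L = 0, in which case Q_L(V) = V. *)
Definition R_part n (L : set 'M[C]_n) : set 'cV[C]_n := ~` zero_fiber L.

Definition mulset n (K K' : set 'M[C]_n) : set 'M[C]_n :=
  [set a *m b | a in K & b in K'].

(* Characters of a group A of cosets, with product of cosets as group law. *)
Definition is_character n (A : set (set 'M[C]_n)) (lam : set 'M[C]_n -> C) :=
  (forall K, A K -> lam K != 0) /\
  (forall K K', A K -> A K' -> lam (mulset K K') = lam K * lam K').

Definition eqv_distribution (D : fc_datum R) (lam : set 'M[C]_(fc_dim D) -> C)
    (X : set 'cV[C]_(fc_dim D)) (T : ('cV[C]_(fc_dim D) -> C) -> C) : Prop :=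
  [/\ schwartz_distribution X T,
      forall l f, fc_L D l -> schwartz X f -> pushforward l T f = T f
    & forall K j f, fc_A D K -> K j -> schwartz X f ->
        pushforward j T f = lam K * T f].

Definition no_eqv_distribution (D : fc_datum R)
    (lam : set 'M[C]_(fc_dim D) -> C) (X : set 'cV[C]_(fc_dim D)) : Prop :=
  forall T, eqv_distribution lam X T -> forall f, schwartz X f -> T f = 0.

Definition componentwise_regular (D : fc_datum R) : Prop :=
  forall lam : set 'M[C]_(fc_dim D) -> C,
    is_character (fc_A D) lam ->
    (exists2 K, fc_A D K & lam K != 1) ->
    (forall K, fc_B D K -> lam K = 1) ->
    no_eqv_distribution lam (R_part (fc_L D)) ->
    no_eqv_distribution lam setT.

End Regularity.

(* Main.v *)
Require Import Defs.
From mathcomp Require Import all_boot all_order all_algebra.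
From mathcomp Require Import all_classical all_reals all_analysis.
From mathcomp Require Import complex ring lra zify.
From mathcomp Require mpoly ordered_qelim qe_rcf.
Import(canonicals) mpoly.
Import ordered_qelim.

Set Implicit Arguments.
Unset Strict Implicit.
Unset Printing Implicit Defensive.

Import Order.TTheory GRing.Theory Num.Theory numFieldNormedType.Exports.
Local Open Scope classical_set_scope.
Local Open Scope ring_scope.

(** Let T be a nonzero distribution on V that transforms under J by a nontrivial
    character lam; the aim is a nonzero one on R_L(V).

    For each datum J / L has exponent 2. Indeed if theta g = g c with c central,
    then g theta g = g^2 c is fixed by theta, and c acts trivially on the Lie
    algebra, so the square of Ad g lies in L. Hence characters take the values 1
    and -1, and distributions may be replaced by real functionals on real test
    functions, since Nash operators have real coefficients. By the same fact J acts
    on the L-invariant polynomials by commuting involutions.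

    The character lam is the product of its restrictions lam_i to the factors, and
    some lam_i is nontrivial. Products g(x) f(z) of test functions of the variable x
    in V_i and the other variables z are dense (tensor_dense, slice_nonzero), so for
    suitable f the slice T_f : g |-> T(g f) is nonzero. It is a distribution on V_i
    with character lam_i (slice_eqv). Regularity of the i-th datum yields a nonzero
    distribution S on R_i = R_(L_i)(V_i) with character lam_i.

    It remains to go back from S to the product. Choose g with T(g f) != 0 and send
    a test function F on R_L(V) to the value of S on the function
    x |-> T(z |-> g(z_i) F(x, z')), where z' is z off V_i. For this to make sense F
    is first multiplied by a cutoff. The zero fiber in V_i is the common zero set of
    finitely many L_i-invariant polynomials that J_i multiplies by signs
    (eigen_invariant, zeros_finite), so R_i is the set where a J_i-invariant real
    polynomial q = sum of |p_k|^2 is positive, and a smooth step in q is a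
    J_i-invariant cutoff. The set where c <= q in V_i, times the other summands,
    lies in R_L(V) (q_ge_U). The composite is a distribution on R_L(V)
    (rdist_extension) with character lam (extension_eqv). On the product of h in
    the Schwartz space of R_i, cut off, and f, it takes the value T(g f) S(h)
    (extension_tensor), and h can be chosen with S(h) != 0 because cutoffs
    approximate h in the Schwartz space of R_i (cut_nonzero).

    The analytic input is that Nash functions have polynomial growth with all their
    derivatives where c <= q (nash_growth, from quantifier elimination over the
    reals). So a smooth function on V_i supported where c <= q is Schwartz on R_i if
    and only if it is rapidly decreasing, and all estimates become estimates of
    weighted sums of partial derivatives (jet, wt). *)

(** * Differential calculus and jets *)

Section Calculus.
Variable R : realType.

Lemma line_derive d (f : 'rV[R]_d -> R) (x v : 'rV[R]_d) (t : R) :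
  derivable f (x + t *: v) v ->
  is_derive t 1 (fun s => f (x + s *: v)) ('D_v f (x + t *: v)).
Proof.
move=> df.
have E : (fun h : R => h^-1 *: ((fun s => f (x + s *: v)) (h *: 1 + t) - f (x + t *: v)))
   = (fun h : R => h^-1 *: (f (h *: v + (x + t *: v)) - f (x + t *: v))).
  by apply/funext => h; congr (_ *: (f _ - _)); rewrite scalerDl [h *: 1]mulr1 addrCA.
split; first by move: df; rewrite /derivable /= E.
by rewrite /derive /= E.
Qed.

Lemma mvt_line d (f : 'rV[R]_d -> R) (x v : 'rV[R]_d) (t : R) :
  (forall s, derivable f (x + s *: v) v) ->
  exists2 s, 0 <= s <= 1 & f (x + t *: v) - f x = t * 'D_v f (x + (s * t) *: v).
Proof.
move=> df; pose g s := f (x + (s * t) *: v).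
have dg (s : R) : is_derive s 1 g (t * 'D_v f (x + (s * t) *: v)).
  have H := @is_derive1_comp _ (fun s => f (x + s *: v)) (fun s => s * t) s _ _
     (line_derive (df (s * t))) _.
  have H1 : is_derive s 1 (fun s : R => s * t) t.
    by apply: is_derive_eq; rewrite scaler0 add0r [LHS]mulr1.
  move: (H _ H1); rewrite /g /comp => {}H.
  by apply: is_derive_eq; rewrite mulrC.
have [|c c01] := @MVT_segment R g (fun s => t * 'D_v f (x + (s * t) *: v)) 0 1 ler01 (fun s _ => dg s).
  by apply: derivable_within_continuous => s _; case: (dg s).
rewrite /g mul1r mul0r scale0r addr0 subr0 mulr1 => E.
by exists c => //; move: c01; rewrite in_itv.
Qed.

Section Smooth.
Variable d : nat.
Local Notation V := 'rV[R]_d.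
Implicit Types (U : set V) (f g : V -> R) (x : V).

Lemma partials_rcons s k f : partials (rcons s k) f = partials s (partial k f).
Proof. by rewrite /partials foldr_rcons. Qed.

Lemma smooth_cont U f x : smooth_on U f -> U x -> {for x, continuous f}.
Proof. by move=> sf Ux; case: (sf [::] x Ux). Qed.

Lemma smooth_der U f x k : smooth_on U f -> U x -> derivable f x (delta_mx 0 k).
Proof. by move=> sf Ux; case: (sf [::] x Ux). Qed.

Lemma smooth_partial U f k : smooth_on U f -> smooth_on U (partial k f).
Proof. by move=> sf s x Ux; rewrite -partials_rcons; exact: sf. Qed.

Lemma partial_eq_on U f g k : open U -> (forall x, U x -> f x = g x) ->
  forall x, U x -> partial k f x = partial k g x.
Proof.
move=> oU fg x Ux; apply: near_eq_derive.
by apply: filterS (open_nbhs_nbhs (conj oU Ux)) => y /fg.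
Qed.

Lemma partials_eq_on U f g s : open U -> (forall x, U x -> f x = g x) ->
  forall x, U x -> partials s f x = partials s g x.
Proof. by move=> oU fg; elim: s => //= k s IH; exact: partial_eq_on. Qed.

Lemma near_eq_for_continuous f g x : (\forall y \near x, f y = g y) ->
  {for x, continuous f} -> {for x, continuous g}.
Proof.
move=> N cf; rewrite /prop_for /continuous_at -(nbhs_singleton N).
apply: cvg_trans cf.
have H := @near_eq_cvg V R (nbhs x) (nbhs_filter x) f g N.
exact: H.
Qed.

Lemma contD f g x : {for x, continuous f} -> {for x, continuous g} ->
  {for x, continuous (fun y => f y + g y)}.
Proof. by move=> cf cg; exact: (@cvgD _ _ _ (nbhs x) (nbhs_filter x)). Qed.

Lemma contM f g x : {for x, continuous f} -> {for x, continuous g} ->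
  {for x, continuous (fun y => f y * g y)}.
Proof. by move=> cf cg; exact: (@cvgM _ _ (nbhs x) (nbhs_filter x)). Qed.

Lemma smooth_eq_on U f g : open U -> (forall x, U x -> f x = g x) ->
  smooth_on U f -> smooth_on U g.
Proof.
move=> oU fg sf s x Ux; have [cf df] := sf s x Ux.
have E y : U y -> partials s f y = partials s g y by exact: partials_eq_on.
have N : \forall y \near x, partials s f y = partials s g y.
  by apply: filterS (open_nbhs_nbhs (conj oU Ux)) => y /E.
split; last by move=> k; exact: near_eq_derivable N (df k).
exact: near_eq_for_continuous N cf.
Qed.

(** Smoothness by coinduction: a class stable under partial derivatives replaces
    the induction on the multi-index. *)
Lemma smooth_coind U (G : set (V -> R)) : open U ->
  (forall f, G f -> forall x, U x -> {for x, continuous f}) ->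
  (forall f, G f -> forall x k, U x -> derivable f x (delta_mx 0 k)) ->
  (forall f k, G f -> exists2 g, G g & forall x, U x -> partial k f x = g x) ->
  forall f, G f -> smooth_on U f.
Proof.
move=> oU Gc Gd Gp f Gf s.
have [g Gg Eg] : exists2 g, G g & forall x, U x -> g x = partials s f x.
  elim: s => [|k s IH]; first by exists f.
  have [g Gg Eg] := IH.
  have [h Gh Eh] := Gp g k Gg; exists h; first exact: Gh.
  move=> x Ux /=.
  by rewrite -Eh //; exact: (partial_eq_on k oU Eg Ux).
move=> x Ux; have N : \forall y \near x, g y = partials s f y.
  by apply: filterS (open_nbhs_nbhs (conj oU Ux)) => y /Eg.
split; last by move=> k; exact: near_eq_derivable N (Gd g Gg x k Ux).
exact: near_eq_for_continuous N (Gc g Gg x Ux).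
Qed.

(** The Leibniz rule leads out of most classes of functions, but not out of the
    algebra that they generate. *)
Inductive sumprod (B : set (V -> R)) : (V -> R) -> Prop :=
| sp_base f : B f -> sumprod B f
| sp_add f g : sumprod B f -> sumprod B g -> sumprod B (fun x => f x + g x)
| sp_mul f g : sumprod B f -> sumprod B g -> sumprod B (fun x => f x * g x).

Lemma partialD f g k x : derivable f x (delta_mx 0 k) -> derivable g x (delta_mx 0 k) ->
  partial k (fun x => f x + g x) x = partial k f x + partial k g x.
Proof. exact: deriveD. Qed.

Lemma partialM f g k x : derivable f x (delta_mx 0 k) -> derivable g x (delta_mx 0 k) ->
  partial k (fun x => f x * g x) x = f x * partial k g x + partial k f x * g x.
Proof. move=> df dg; transitivity (f x *: partial k g x + g x *: partial k f x).
  exact: (deriveM df dg).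
by congr (_ + _); exact: mulrC. Qed.

Lemma sumprod_smooth U (B : set (V -> R)) : open U ->
  (forall f, B f -> forall x, U x -> {for x, continuous f}) ->
  (forall f, B f -> forall x k, U x -> derivable f x (delta_mx 0 k)) ->
  (forall f k, B f -> exists2 g, sumprod B g & forall x, U x -> partial k f x = g x) ->
  forall f, sumprod B f -> smooth_on U f.
Proof.
move=> oU Bc Bd Bp.
have Gd f : sumprod B f -> forall x k, U x -> derivable f x (delta_mx 0 k).
  by elim=> {}f; [exact: Bd| move=> g _ df _ dg x k Ux; apply: derivableD; auto
                 | move=> g _ df _ dg x k Ux; apply: derivableM; auto].
apply: smooth_coind => //.
  move=> f; elim=> {}f; [exact: Bc| move=> g _ cf _ cg x Ux; exact: contD (cf x Ux) (cg x Ux)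
                 |move=> g _ cf _ cg x Ux; exact: contM (cf x Ux) (cg x Ux)].
move=> f k; elim=> {f} [f /Bp//|f g sf [f' Gf' Ef'] sg [g' Gg' Eg']|
   f g sf [f' Gf' Ef'] sg [g' Gg' Eg']].
  exists (fun x => f' x + g' x); first exact: sp_add.
  by move=> x Ux; rewrite partialD ?Ef' ?Eg' //; exact: Gd.
exists (fun x => f x * g' x + f' x * g x); first by apply: sp_add; apply: sp_mul.
by move=> x Ux; rewrite partialM ?Ef' ?Eg' //; exact: Gd.
Qed.

Lemma smoothDM U f g : open U -> smooth_on U f -> smooth_on U g ->
  smooth_on U (fun x => f x + g x) /\ smooth_on U (fun x => f x * g x).
Proof.
move=> oU sf sg.
have H : forall f, sumprod (smooth_on U) f -> smooth_on U f.
  apply: sumprod_smooth => //.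
  - by move=> h sh x Ux; exact: smooth_cont sh Ux.
  - by move=> h sh x k Ux; exact: smooth_der sh Ux.
  - by move=> h k sh; exists (partial k h) => //; apply: sp_base; exact: smooth_partial.
by split; apply: H; [apply: sp_add|apply: sp_mul]; apply: sp_base.
Qed.

Lemma smoothD U f g : open U -> smooth_on U f -> smooth_on U g ->
  smooth_on U (fun x => f x + g x).
Proof. by move=> oU sf sg; case: (smoothDM oU sf sg). Qed.

Lemma smoothM U f g : open U -> smooth_on U f -> smooth_on U g ->
  smooth_on U (fun x => f x * g x).
Proof. by move=> oU sf sg; case: (smoothDM oU sf sg). Qed.

Lemma partial_cst (c : R) k : partial k (fun _ : V => c) = fun=> 0.
Proof. by apply/funext => x; exact: derive_cst. Qed.

Lemma smooth_cst U (c : R) : open U -> smooth_on U (fun=> c).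
Proof.
move=> oU; apply: (@smooth_coind U [set f | exists c, f = fun=> c]) => //.
- by move=> f [e ->] x Ux; exact: cst_continuous.
- by move=> f [e ->] x k Ux; exact: derivable_cst.
- by move=> f k [e ->]; exists (fun=> 0); [exists 0|rewrite partial_cst].
- by exists c.
Qed.

Lemma smoothZ U c f : open U -> smooth_on U f -> smooth_on U (fun x => c * f x).
Proof. by move=> oU sf; exact: (smoothM oU (smooth_cst c oU) sf). Qed.

Lemma smoothB U f g : open U -> smooth_on U f -> smooth_on U g ->
  smooth_on U (fun x => f x - g x).
Proof.
move=> oU sf sg; have sN := smoothZ (-1) oU sg.
apply: (smooth_eq_on oU _ (smoothD oU sf sN)) => x _; by rewrite mulN1r.
Qed.

Lemma partialZ c f k x : derivable f x (delta_mx 0 k) ->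
  partial k (fun x => c * f x) x = c * partial k f x.
Proof. by move=> df; rewrite (partialM (derivable_cst _ _ _) df) partial_cst mul0r addr0. Qed.

Lemma smooth_sub U W f : (forall x, U x -> W x) -> smooth_on W f -> smooth_on U f.
Proof. by move=> UW sf s x /UW; exact: sf. Qed.

(** The derivative along a word s is counted 'C(n, size s) times. With these
    weights the sum is submultiplicative, which a maximum or an unweighted sum is
    not. *)
Fixpoint jet n f x : R :=
  if n is n'.+1 then jet n' f x + \sum_k jet n' (partial k f) x else `|f x|.

Lemma jet_ge0 n f x : 0 <= jet n f x.
Proof. by elim: n f => //= n IH f; rewrite addr_ge0 // sumr_ge0. Qed.

Lemma jetS n f x : jet n f x <= jet n.+1 f x.
Proof. by rewrite /= lerDl sumr_ge0 // => k _; exact: jet_ge0. Qed.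

Lemma jet_mono n m f x : (n <= m)%N -> jet n f x <= jet m f x.
Proof.
move=> nm; rewrite -(subnKC nm); elim: (m - n)%N => [|i IH]; first by rewrite addn0.
by rewrite addnS (le_trans IH) // jetS.
Qed.

Lemma jet_partial n f k x : jet n (partial k f) x <= jet n.+1 f x.
Proof.
rewrite /= (bigD1 k) //= addrCA lerDl addr_ge0 ?jet_ge0 // sumr_ge0 // => *.
exact: jet_ge0.
Qed.

Lemma jet_norm n f x : `|f x| <= jet n f x.
Proof. exact: (@jet_mono 0). Qed.

Lemma jet_eq_on U f g n : open U -> (forall x, U x -> f x = g x) ->
  forall x, U x -> jet n f x = jet n g x.
Proof.
move=> oU; elim: n f g => /= [|n IH] f g fg x Ux; first by rewrite fg.
congr (_ + _); first exact: IH.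
by apply: eq_bigr => k _; apply: (IH _ _ _ x Ux) => y Uy; exact: (partial_eq_on k oU fg Uy).
Qed.

Lemma jetD U f g n x : open U -> smooth_on U f -> smooth_on U g -> U x ->
  jet n (fun x => f x + g x) x <= jet n f x + jet n g x.
Proof.
move=> oU; elim: n f g => /= [|n IH] f g sf sg Ux; first exact: ler_normD.
rewrite addrACA lerD ?IH // -big_split ler_sum //= => k _.
rewrite (@jet_eq_on U _ (fun x => partial k f x + partial k g x)) //.
  exact: (IH _ _ (@smooth_partial U f k sf) (@smooth_partial U g k sg) Ux).
by move=> y Uy; apply: partialD; [exact: smooth_der sf Uy|exact: smooth_der sg Uy].
Qed.

(** Induction on n: by the Leibniz rule each new derivative gives two products,
    and both occur in the expansion of the product of the jets of order n.+1. *)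
Lemma jetM U f g n x : open U -> smooth_on U f -> smooth_on U g -> U x ->
  jet n (fun x => f x * g x) x <= jet n f x * jet n g x.
Proof.
move=> oU; elim: n f g => /= [|n IH] f g sf sg Ux; first by rewrite normrM.
set a := jet n f x; set b := jet n g x.
set A := \sum_k jet n (partial k f) x; set B := \sum_k jet n (partial k g) x.
have A0 : 0 <= A by apply: sumr_ge0 => *; exact: jet_ge0.
have B0 : 0 <= B by apply: sumr_ge0 => *; exact: jet_ge0.
have H : \sum_k jet n (partial k (fun x => f x * g x)) x <= a * B + A * b.
  rewrite mulr_sumr mulr_suml -big_split ler_sum //= => k _.
  rewrite (@jet_eq_on U _ (fun x => f x * partial k g x + partial k f x * g x)) //; last first.
    by move=> y Uy; apply: partialM; [exact: smooth_der sf Uy|exact: smooth_der sg Uy].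
  have sf' := @smooth_partial U f k sf; have sg' := @smooth_partial U g k sg.
  apply: le_trans (jetD n oU _ _ Ux) _; [exact: smoothM|exact: smoothM|].
  by apply: lerD; apply: IH.
have := IH f g sf sg Ux; rewrite -/a -/b => H2; nra.
Qed.

Lemma jetZ U c f n x : open U -> smooth_on U f -> U x ->
  jet n (fun x => c * f x) x = `|c| * jet n f x.
Proof.
move=> oU; elim: n f => /= [|n IH] f sf Ux; first by rewrite normrM.
rewrite mulrDr IH // mulr_sumr; congr (_ + _); apply: eq_bigr => k _.
rewrite (@jet_eq_on U _ (fun x => c * partial k f x)) //.
  exact: (IH _ (@smooth_partial U f k sf) Ux).
by move=> y Uy; apply: partialZ; exact: smooth_der sf Uy.
Qed.

Lemma jet_cst (c : R) n x : jet n (fun=> c) x = `|c|.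
Proof.
have H m : jet m (fun=> 0) x = 0.
  elim: m => /= [|m IH]; first by rewrite normr0.
  by rewrite IH add0r big1 // => k _; rewrite partial_cst.
by elim: n => //= n ->; rewrite big1 ?addr0 // => k _; rewrite partial_cst.
Qed.

Lemma jet0_near U f n x : open U -> U x -> (forall y, U y -> f y = 0) -> jet n f x = 0.
Proof. by move=> oU Ux f0; rewrite (jet_eq_on n oU f0 Ux) jet_cst normr0. Qed.

Lemma norm_partials s f x : `|partials s f x| <= jet (size s) f x.
Proof.
elim/last_ind: s f => [|s k IH] f //.
rewrite partials_rcons size_rcons; apply: le_trans (IH _) _; exact: jet_partial.
Qed.

End Smooth.

End Calculus.

(** * Mixed derivatives, translations and substitutions *)

Lemma quarter_add (R : realFieldType) (m : R) : 0 < m -> m / 4 + m / 4 < m.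
Proof. lra. Qed.

Lemma dist_via_half (R : realFieldType) (p a b e : R) :
  `|p - a| < e / 2 -> `|p - b| < e / 2 -> `|a - b| <= e.
Proof.
rewrite !ltr_norml => /andP[? ?] /andP[? ?]; rewrite ler_norml; apply/andP; split; lra.
Qed.

Lemma double_difference_sym (R : comPzRingType) (p a b c : R) :
  p - a - (b - c) = p - b - (a - c).
Proof. ring. Qed.

Lemma mul2_cancel (R : fieldType) (h p q a b : R) : h != 0 ->
  p = h * (h * a) -> q = h * (h * b) -> p = q -> a = b.
Proof. by move=> hn -> -> /(mulfI hn)/(mulfI hn). Qed.

Section CalculusOnSpace.
Variable R : realType.

(** Topological statements about row vectors are used through coordinates only. *)
Lemma continuous_coordP d (f : 'rV[R]_d -> R) (x : 'rV[R]_d) :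
  {for x, continuous f} <->
  forall e, 0 < e -> exists2 t, 0 < t &
    forall y : 'rV[R]_d, (forall k, `|y 0 k - x 0 k| < t) -> `|f y - f x| < e.
Proof.
split.
  move=> /(@cvgrPdist_lt _ _ _ (nbhs x) (nbhs_filter x)) H e e0.
  have /nbhs_ballP[t t0 Ht] := H e e0; exists t => // y yx.
  by rewrite distrC; apply: Ht; split => // i j; rewrite ord1 /ball /= distrC.
move=> H; apply/(@cvgrPdist_lt _ _ _ (nbhs x) (nbhs_filter x)) => e e0.
have [t t0 Ht] := H e e0; apply/nbhs_ballP; exists t => // y yx.
by rewrite distrC; apply: Ht => k; have [_ yx'] := yx; have := yx' 0 k; rewrite /ball /= distrC.
Qed.

Lemma open_setT d : open (setT : set 'rV[R]_d).
Proof. exact: openT. Qed.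

Section Translation.
Variables (d : nat) (v : 'rV[R]_d).
Implicit Types f : 'rV[R]_d -> R.

Lemma partial_shift f k : partial k (fun y => f (y + v)) = fun y => partial k f (y + v).
Proof. by apply/funext => x; rewrite /partial /derive /=; under eq_fun do rewrite -addrA. Qed.

Lemma derivable_shift f x u : derivable f (x + v) u -> derivable (fun y => f (y + v)) x u.
Proof. by rewrite /derivable /=; under [in X in _ -> X]eq_fun do rewrite -addrA. Qed.

Lemma smooth_shift f : smooth_on setT f -> smooth_on setT (fun y => f (y + v)).
Proof.
move=> sf; apply: (@smooth_coind _ _ _ [set g | exists2 f, smooth_on setT f & g = fun y => f (y + v)]
  (@open_setT d)); last by exists f.
- move=> g [h sh ->] x _; apply/continuous_coordP => e e0.
  have /continuous_coordP/(_ e e0)[t t0 Ht] := smooth_cont sh (I : setT (x + v)).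
  by exists t => // y yx; apply: Ht => k; rewrite !mxE opprD addrACA subrr addr0.
- by move=> g [h sh ->] x k _; apply: derivable_shift; exact: smooth_der sh I.
- move=> g k [h sh ->]; rewrite partial_shift.
  exists (fun y => partial k h (y + v)) => //.
  by exists (partial k h); first exact: smooth_partial.
Qed.

Lemma jet_shift n f x : jet n (fun y => f (y + v)) x = jet n f (x + v).
Proof.
elim: n f => //= n IH f; rewrite IH; congr (_ + _).
by apply: eq_bigr => k _; rewrite partial_shift IH.
Qed.

End Translation.

Section Schwarz.
Variable d : nat.
Implicit Types f : 'rV[R]_d -> R.

Lemma smooth_mvt f x v k t : smooth_on setT f -> v = delta_mx 0 k ->
  exists2 s, 0 <= s <= 1 & f (x + t *: v) - f x = t * partial k f (x + (s * t) *: v).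
Proof. by move=> sf ->; apply: mvt_line => s; exact: smooth_der sf I. Qed.

(** The mean value theorem, once in each direction: the same second difference
    is also a value of the other mixed derivative, whence Schwarz's theorem. *)
Lemma double_difference f x j k h : smooth_on setT f ->
  exists s1 s2, [/\ 0 <= s1 <= 1, 0 <= s2 <= 1 &
   f (x + h *: delta_mx 0 j + h *: delta_mx 0 k) - f (x + h *: delta_mx 0 j)
    - (f (x + h *: delta_mx 0 k) - f x) =
   h * (h * partial k (partial j f) (x + (s1 * h) *: delta_mx 0 j + (s2 * h) *: delta_mx 0 k))].
Proof.
move=> sf; set ej := delta_mx 0 j; set ek := delta_mx 0 k.
pose u y := f (y + h *: ek) - f y.
have su : smooth_on setT u.
  exact: (smoothB (@open_setT d) (@smooth_shift d (h *: ek) f sf) sf).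
have [s1 s1b E1] := smooth_mvt x h su (erefl ej).
have [s2 s2b E2] := smooth_mvt (x + (s1 * h) *: ej) h (@smooth_partial _ _ _ f j sf) (erefl ek).
exists s1, s2; split => //; rewrite -E2 -/(u (x + h *: ej)) -/(u x) E1; congr (_ * _).
have E0 : partial j u (x + (s1 * h) *: ej) = partial j (fun y => f (y + h *: ek)) (x + (s1 * h) *: ej)
   - partial j f (x + (s1 * h) *: ej).
  apply: deriveB; last exact: smooth_der sf I.
  exact: smooth_der (@smooth_shift d (h *: ek) f sf) I.
by rewrite E0 partial_shift.
Qed.

Lemma partialC f j k : smooth_on setT f ->
  partial j (partial k f) = partial k (partial j f).
Proof.
move=> sf; apply/funext => x.
have [cA cB] : {for x, continuous (partial j (partial k f))} /\
               {for x, continuous (partial k (partial j f))}.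
  by split; apply: smooth_cont (I : setT x); apply: smooth_partial; apply: smooth_partial.
apply/eqP; rewrite -subr_eq0 -normr_le0; apply/ler_addgt0Pl => e e0; rewrite addr0.
have e2 : 0 < e / 2 by rewrite divr_gt0.
have /continuous_coordP/(_ _ e2)[t1 t10 H1] := cA.
have /continuous_coordP/(_ _ e2)[t2 t20 H2] := cB.
have m0 : 0 < Num.min t1 t2 by rewrite lt_min t10.
have [h h0 hh] : exists2 h, 0 < h & h + h < Num.min t1 t2.
  by exists (Num.min t1 t2 / 4); [rewrite divr_gt0|exact: quarter_add].
have hn : h != 0 by rewrite gt_eqF.
have [a1 [a2 [a1b a2b E1]]] := double_difference x j k h sf.
have [b1 [b2 [b1b b2b E2]]] := double_difference x k j h sf.
have close (i i' : 'I_d) c1 c2 : 0 <= c1 <= 1 -> 0 <= c2 <= 1 -> forall l,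
   `|(x + (c1 * h) *: delta_mx 0 i + (c2 * h) *: delta_mx 0 i' : 'rV[R]_d) 0 l - x 0 l| < Num.min t1 t2.
  move=> c1b c2b l; rewrite !mxE !eqxx /= -addrA addrAC subrr add0r.
  have B c (b : bool) : 0 <= c <= 1 -> `|c * h * b%:R| <= h.
    move=> /andP[cge cle]; case: b; last by rewrite mulr0 normr0 ltW.
    by rewrite mulr1 ger0_norm ?mulr_ge0 ?ler_piMl // ltW.
  apply: le_lt_trans (ler_normD _ _) _.
  apply: (@le_lt_trans _ _ (h + h)); first by apply: lerD; apply: B.
  exact: hh.
have E : partial k (partial j f) (x + (a1 * h) *: delta_mx 0 j + (a2 * h) *: delta_mx 0 k)
   = partial j (partial k f) (x + (b1 * h) *: delta_mx 0 k + (b2 * h) *: delta_mx 0 j).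
  apply: (mul2_cancel hn E1 E2).
  rewrite [x + h *: delta_mx 0 k + _]addrAC; exact: double_difference_sym.
have m1 : Num.min t1 t2 <= t1 by rewrite ge_min lexx.
have m2 : Num.min t1 t2 <= t2 by rewrite ge_min lexx orbT.
have {}H1 := H1 _ (fun l => lt_le_trans (close k j b1 b2 b1b b2b l) m1).
have {}H2 := H2 _ (fun l => lt_le_trans (close j k a1 a2 a1b a2b l) m2).
rewrite E in H2; exact: dist_via_half H1 H2.
Qed.

End Schwarz.

Section Substitution.
Variables (d d' : nat) (c : 'rV[R]_d') (r : 'I_d' -> option 'I_d).
Hypothesis r_inj : forall j j' k, r j = Some k -> r j' = Some k -> j = j'.
Implicit Types f : 'rV[R]_d' -> R.

(** Each slot receives a coordinate of z or a constant. Projection to a block of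
    variables, inclusion of a block and freezing of some variables are all of this
    form, and none of them increases jets. *)
Definition csub (z : 'rV[R]_d) : 'rV[R]_d' :=
  \row_j if r j is Some k then z 0 k else c 0 j.

Lemma csub_move h k z : csub (h *: delta_mx 0 k + z) =
  (if [pick j | r j == Some k] is Some j then h *: delta_mx 0 j else 0) + csub z.
Proof.
apply/rowP => j; rewrite !mxE; case: pickP => [j' /eqP rj'|nj]; rewrite !mxE /=.
  case: (eqVneq j j') => [->|jj'] /=; first by rewrite rj' !mxE !eqxx.
  rewrite mulr0 add0r; case rj : (r j) => [l|//]; rewrite !mxE /=.
  case: (eqVneq l k) => [lk|]; last by rewrite mulr0 add0r.
  by rewrite lk in rj; rewrite (r_inj rj rj') eqxx in jj'.
rewrite add0r; case rj : (r j) => [l|//]; rewrite !mxE /=.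
by case: (eqVneq l k) => [lk|]; [have := nj j; rewrite rj lk eqxx|rewrite mulr0 add0r].
Qed.

Lemma partial_csub f k : partial k (f \o csub) =
  if [pick j | r j == Some k] is Some j then partial j f \o csub else fun=> 0.
Proof.
apply/funext => z; rewrite /partial /derive /=.
under eq_fun => h do rewrite csub_move.
case: pickP => // nj; under eq_fun do rewrite add0r subrr scaler0.
exact: lim_cst.
Qed.

Lemma derivable_csub f k z : (forall j, derivable f (csub z) (delta_mx 0 j)) ->
  derivable (f \o csub) z (delta_mx 0 k).
Proof.
move=> df; rewrite /derivable /=; under eq_fun => h do rewrite csub_move.
case: pickP => [j _|nj]; first exact: df.
by under eq_fun do rewrite add0r subrr scaler0; exact: is_cvg_cst.
Qed.

Lemma smooth_csub f : smooth_on setT f -> smooth_on setT (f \o csub).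
Proof.
move=> sf; apply: (@smooth_coind _ _ _ [set g | exists2 f, smooth_on setT f & g = f \o csub]
  (@open_setT d)); last by exists f.
- move=> g [h sh ->] x _; apply/continuous_coordP => e e0.
  have /continuous_coordP/(_ e e0)[t t0 Ht] := smooth_cont sh (I : setT (csub x)).
  exists t => // y yx; apply: Ht => j; rewrite !mxE.
  by case: (r j) => [k|]; rewrite ?subrr ?normr0.
- by move=> g [h sh ->] x k _; apply: derivable_csub => j; exact: smooth_der sh I.
- move=> g k [h sh ->]; exists (partial k (h \o csub)) => //; rewrite partial_csub.
  case: pickP => [j _|_]; first by exists (partial j h); first exact: smooth_partial.
  by exists (fun=> 0); first exact: (smooth_cst 0 (@open_setT d')).
Qed.

Lemma jet_csub n f z : jet n (f \o csub) z <= jet n f (csub z).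
Proof.
elim: n f => //= n IH f; rewrite lerD //.
apply: (@le_trans _ _ (\sum_k \sum_(j | r j == Some k) jet n (partial j f) (csub z))).
  apply: ler_sum => k _; rewrite partial_csub; case: pickP => [j rj|nj].
    rewrite (bigD1 j) //= ler_wpDr ?IH // sumr_ge0 // => *; exact: jet_ge0.
  by rewrite jet_cst normr0 sumr_ge0 // => *; exact: jet_ge0.
rewrite (exchange_big_dep xpredT) //=; apply: ler_sum => j _.
case rj : (r j) => [l|]; last by rewrite big_pred0 ?jet_ge0.
by rewrite (eq_bigl (pred1 l)) ?big_pred1_eq.
Qed.

End Substitution.

Lemma coord_lipschitz d (f : 'rV[R]_d -> R) M :
  (forall x k, derivable f x (delta_mx 0 k)) ->
  (forall x k, `|partial k f x| <= M) ->
  forall x y, `|f y - f x| <= \sum_k M * `|y 0 k - x 0 k|.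
Proof.
move=> df bf x y.
pose p (i : nat) : 'rV[R]_d := \row_k if (k < i)%N then y 0 k else x 0 k.
have -> : x = p 0%N by apply/rowP => k; rewrite !mxE.
have yE : y = p d by apply/rowP => k; rewrite !mxE ltn_ord.
have p0 k : p 0%N 0 k = x 0 k by rewrite !mxE.
under eq_bigr do rewrite p0.
have H i : (i <= d)%N -> `|f (p i) - f (p 0%N)| <= \sum_(k < d | (k < i)%N) M * `|y 0 k - x 0 k|.
  elim: i => [|i IH] id; first by rewrite subrr normr0 big_pred0.
  pose k := Ordinal id.
  have Ep : p i.+1 = p i + (y 0 k - x 0 k) *: delta_mx 0 k.
    apply/rowP => l; rewrite !mxE eqxx /= ltnS leq_eqVlt.
    case: (eqVneq l k) => [->|lk] /=; first by rewrite eqxx ltnn mulr1 addrC subrK.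
    have -> : (l == i :> nat) = false by apply/negbTE; apply: contra lk => /eqP li; apply/eqP/val_inj.
    by rewrite mulr0 addr0.
  have [s _ Es] := @mvt_line _ _ f (p i) (delta_mx 0 k) (y 0 k - x 0 k) (fun s => df (p i + s *: delta_mx 0 k) k).
  rewrite (bigD1 k) //=; apply: le_trans (_ : `|f (p i.+1) - f (p i)| + `|f (p i) - f (p 0%N)| <= _).
    by rewrite (le_trans _ (ler_normD _ _)) // addrA subrK.
  apply: lerD; first by rewrite Ep Es normrM mulrC ler_wpM2r //; exact: bf.
  rewrite (le_trans (IH (ltnW id))) //.
  rewrite le_eqVlt; apply/orP; left; apply/eqP; apply: eq_bigl => l.
  rewrite ltnS [in RHS]leq_eqVlt; case: (eqVneq l k) => [->|lk] /=; first by rewrite ltnn andbF.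
  have -> : (l == i :> nat) = false by apply/negbTE; apply: contra lk => /eqP li; apply/eqP/val_inj.
  by rewrite andbT.
have := H d (leqnn d); rewrite -yE => /le_trans; apply.
rewrite le_eqVlt; apply/orP; left; apply/eqP; apply: eq_bigl => k.
by rewrite ltn_ord.
Qed.

Lemma coord_lipschitz_continuous d (f : 'rV[R]_d -> R) M :
  (forall x k, derivable f x (delta_mx 0 k)) ->
  (forall x k, `|partial k f x| <= M) -> forall x, {for x, continuous f}.
Proof.
move=> df bf x; apply/continuous_coordP => e e0.
pose M' := `|M| * d%:R + 1.
have M0 : 0 < M' by rewrite ltr_wpDl // mulr_ge0.
exists (e / M') => [|y yx]; first by rewrite divr_gt0.
apply: le_lt_trans (coord_lipschitz df bf x y) _.
apply: (@le_lt_trans _ _ (\sum_(k < d) `|M| * (e / M'))).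
  apply: ler_sum => k _; apply: ler_pM => //; last exact: ltW.
  - exact: le_trans (bf x k).
  - exact: ler_norm.
rewrite sumr_const card_ord -mulr_natl mulrA mulrA [d%:R * _]mulrC.
by rewrite ltr_pdivrMr // [X in X < _]mulrC ltr_pM2l // ltrDl.
Qed.

(** Bounds on the first derivatives make a function Lipschitz, so continuity comes
    for free in a class that is stable under derivation. *)
Lemma smooth_bounded d (G : set ('rV[R]_d -> R)) :
  (forall f, G f -> forall x k, derivable f x (delta_mx 0 k)) ->
  (forall f, G f -> exists M, forall x, `|f x| <= M) ->
  (forall f k, G f -> G (partial k f)) ->
  forall f, G f -> smooth_on setT f.
Proof.
move=> Gd Gb Gp; apply: (smooth_coind (@open_setT d)) => [f Gf x _|f Gf x k _|f k Gf].
- have /choice[M HM] k : exists M, forall x, `|partial k f x| <= M by apply: Gb; exact: Gp.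
  apply: (@coord_lipschitz_continuous _ _ (\sum_k `|M k|)) => [y k|y k]; first exact: Gd.
  apply: le_trans (HM k y) _; rewrite (bigD1 k) //= ler_wpDr ?ler_norm // sumr_ge0 //.
- exact: Gd.
- by exists (partial k f) => //; exact: Gp.
Qed.

End CalculusOnSpace.

(** * Functions definable over the reals *)

Section Definability.
Variable R : realType.
Implicit Types (P Q : seq R -> Prop) (t : seq R -> R).

(** Quantifier-free definability with real parameters, on the list of values of the
    free variables. *)
Definition dfn P := exists f : ord.formula R,
  [/\ ord.qf_form f, ord.rformula f & forall e, ord.qf_eval e f <-> P e].

(** The functions that may occur in the atomic formulas of dfn. *)
Definition tmf t := exists2 u : GRing.term R, GRing.rterm u & forall e, GRing.eval e u = t e.

Lemma dfn_ext P Q : (forall e, P e <-> Q e) -> dfn P -> dfn Q.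
Proof. by move=> PQ [f [qf rf Ef]]; exists f; split=> // e; rewrite Ef. Qed.

Lemma tmf_ext t t' : (forall e, t e = t' e) -> tmf t -> tmf t'.
Proof. by move=> tt [u ru Eu]; exists u => // e; rewrite Eu. Qed.

Lemma tmf_var i : tmf (fun e => nth 0 e i).
Proof. by exists (GRing.Var R i). Qed.

Lemma tmf_cst c : tmf (fun=> c).
Proof. by exists (GRing.Const c). Qed.

Lemma tmf_add t1 t2 : tmf t1 -> tmf t2 -> tmf (fun e => t1 e + t2 e).
Proof.
move=> [u ru Eu] [v rv Ev]; exists (GRing.Add u v) => /= [|e]; first by rewrite ru.
by rewrite Eu Ev.
Qed.

Lemma tmf_mul t1 t2 : tmf t1 -> tmf t2 -> tmf (fun e => t1 e * t2 e).
Proof.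
move=> [u ru Eu] [v rv Ev]; exists (GRing.Mul u v) => /= [|e]; first by rewrite ru.
by rewrite Eu Ev.
Qed.

Lemma tmf_opp t1 : tmf t1 -> tmf (fun e => - t1 e).
Proof. by move=> [u ru Eu]; exists (GRing.Opp u) => //= e; rewrite Eu. Qed.

Lemma tmf_exp t1 n : tmf t1 -> tmf (fun e => t1 e ^+ n).
Proof. by move=> [u ru Eu]; exists (GRing.Exp u n) => //= e; rewrite Eu. Qed.

Lemma tmf_sum (I : Type) (s : seq I) (F : I -> seq R -> R) :
  (forall i, tmf (F i)) -> tmf (fun e => \sum_(i <- s) F i e).
Proof.
move=> tF; elim: s => [|i s IH].
  by apply: tmf_ext (tmf_cst 0) => e; rewrite big_nil.
by apply: tmf_ext (tmf_add (tF i) IH) => e; rewrite big_cons.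
Qed.

Lemma tmf_prod (I : Type) (s : seq I) (F : I -> seq R -> R) :
  (forall i, tmf (F i)) -> tmf (fun e => \prod_(i <- s) F i e).
Proof.
move=> tF; elim: s => [|i s IH].
  by apply: tmf_ext (tmf_cst 1) => e; rewrite big_nil.
by apply: tmf_ext (tmf_mul (tF i) IH) => e; rewrite big_cons.
Qed.

Lemma dfn_lt t1 t2 : tmf t1 -> tmf t2 -> dfn (fun e => t1 e < t2 e).
Proof.
move=> [u ru Eu] [v rv Ev]; exists (ord.Lt u v); split => //= [|e]; first by rewrite ru.
by rewrite Eu Ev.
Qed.

Lemma dfn_eq t1 t2 : tmf t1 -> tmf t2 -> dfn (fun e => t1 e = t2 e).
Proof.
move=> [u ru Eu] [v rv Ev]; exists (ord.Equal u v); split => //= [|e]; first by rewrite ru.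
by rewrite Eu Ev; split => /eqP.
Qed.

Lemma dfn_not P : dfn P -> dfn (fun e => ~ P e).
Proof.
move=> [f [qf rf Ef]]; exists (ord.Not f); split=> //= e; rewrite -Ef.
by split => /negP.
Qed.

Lemma dfn_and P Q : dfn P -> dfn Q -> dfn (fun e => P e /\ Q e).
Proof.
move=> [f [qf rf Ef]] [g [qg rg Eg]]; exists (ord.And f g).
split => /= [||e]; rewrite ?qf ?rf //; rewrite -Ef -Eg; by split => /andP.
Qed.

Lemma dfn_imp P Q : dfn P -> dfn Q -> dfn (fun e => P e -> Q e).
Proof.
move=> dP dQ; apply: dfn_ext (dfn_not (dfn_and dP (dfn_not dQ))) => e; split.
  by move=> nPQ p; apply: contrapT => nq; exact: nPQ.
by move=> pq [p nq]; apply: nq; exact: pq.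
Qed.

Lemma dfn_le t1 t2 : tmf t1 -> tmf t2 -> dfn (fun e => t1 e <= t2 e).
Proof.
move=> T1 T2; apply: dfn_ext (dfn_not (dfn_lt T2 T1)) => e.
by rewrite leNgt; split => /negP.
Qed.

(** Substitution of terms for variables; it realizes the reindexings that bring
    bound variables to the front of the list. *)
Fixpoint tsub (s : nat -> GRing.term R) (u : GRing.term R) : GRing.term R :=
  match u with
  | GRing.Var i => s i
  | GRing.Add a b => GRing.Add (tsub s a) (tsub s b)
  | GRing.Opp a => GRing.Opp (tsub s a)
  | GRing.NatMul a n => GRing.NatMul (tsub s a) n
  | GRing.Mul a b => GRing.Mul (tsub s a) (tsub s b)
  | GRing.Inv a => GRing.Inv (tsub s a)
  | GRing.Exp a n => GRing.Exp (tsub s a) n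
  | _ => u
  end.

Fixpoint fsub (s : nat -> GRing.term R) (f : ord.formula R) : ord.formula R :=
  match f with
  | ord.Equal a b => ord.Equal (tsub s a) (tsub s b)
  | ord.Lt a b => ord.Lt (tsub s a) (tsub s b)
  | ord.Le a b => ord.Le (tsub s a) (tsub s b)
  | ord.Unit a => ord.Unit (tsub s a)
  | ord.And f g => ord.And (fsub s f) (fsub s g)
  | ord.Or f g => ord.Or (fsub s f) (fsub s g)
  | ord.Implies f g => ord.Implies (fsub s f) (fsub s g)
  | ord.Not f => ord.Not (fsub s f)
  | _ => f
  end.

Lemma rterm_tsub s u : (forall i, GRing.rterm (s i)) -> GRing.rterm u -> GRing.rterm (tsub s u).
Proof. by move=> rs; elim: u => //= a Ha b Hb /andP[/Ha -> /Hb ->]. Qed.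

Lemma eval_tsub s u e e' : (forall i, GRing.eval e (s i) = nth 0 e' i) ->
  GRing.eval e (tsub s u) = GRing.eval e' u.
Proof.
by move=> E; elim: u => //= [a -> b ->|a ->|a -> n|a -> b ->|a ->|a -> n].
Qed.

Lemma dfn_tsub P s (env : seq R -> seq R) : (forall i, GRing.rterm (s i)) ->
  (forall e i, GRing.eval e (s i) = nth 0 (env e) i) ->
  dfn P -> dfn (fun e => P (env e)).
Proof.
move=> rs Es [f [qf rf Ef]]; exists (fsub s f).
split => [||e]; last first.
- rewrite -Ef; suff -> : ord.qf_eval e (fsub s f) = ord.qf_eval (env e) f by [].
  have E u := eval_tsub u (Es e).
  elim: f {Ef rf} qf => //= [a b _|a b _|a b _|a _|f Hf g Hg|f Hf g Hg|f Hf g Hg|f Hf qf].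
  + by rewrite !E.
  + by rewrite !E.
  + by rewrite !E.
  + by rewrite !E.
  + by move=> /andP[/Hf -> /Hg ->].
  + by move=> /andP[/Hf -> /Hg ->].
  + by move=> /andP[/Hf -> /Hg ->].
  + by rewrite Hf.
- elim: f {Ef qf} rf => //= [a b|a b|a b|f Hf g Hg|f Hf g Hg|f Hf g Hg].
  + by move=> /andP[? ?]; rewrite !rterm_tsub.
  + by move=> /andP[? ?]; rewrite !rterm_tsub.
  + by move=> /andP[? ?]; rewrite !rterm_tsub.
  + by move=> /andP[/Hf -> /Hg ->].
  + by move=> /andP[/Hf -> /Hg ->].
  + by move=> /andP[/Hf -> /Hg ->].
- by elim: f {Ef rf} qf => //= f Hf g Hg /andP[/Hf -> /Hg ->].
Qed.

(** The Tarski-Seidenberg theorem, from quantifier elimination for real closed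
    fields. *)
Lemma dfn_ex P : dfn P -> dfn (fun e => exists v, P (v :: e)).
Proof.
move=> [f [qf rf Ef]]; pose pr i bc := qe_rcf.qfr_to_formula (@qe_rcf.wproj R i bc).
pose g := ord.quantifier_elim pr (ord.Exists 0 f).
have /andP[qg rg] := @ord.quantifier_elim_wf _ pr (@qe_rcf.wf_QE_wproj R) (ord.Exists 0 f) (rf : ord.rformula (ord.Exists 0 f)).
have Hg e : ord.qf_eval e g <-> exists v, P (set_nth 0 e 0 v).
  have gP := @ord.quantifier_elim_rformP _ pr (@qe_rcf.wf_QE_wproj R) (@qe_rcf.valid_QE_wproj R) e _
    (rf : ord.rformula (ord.Exists 0 f)).
  split.
    by move=> /gP[v /= /(ord.qf_evalP _ qf) Hv]; exists v; rewrite -Ef.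
  by case=> v Pv; apply/gP; exists v; apply/(ord.qf_evalP _ qf); rewrite Ef.
pose s i := if i is j.+1 then GRing.Var R j else GRing.Const (0 : R).
have := @dfn_tsub (fun e => exists v, P (set_nth 0 e 0 v)) s (fun e => 0 :: e).
apply.
- by case.
- by move=> e [].
- by exists g.
Qed.

Lemma dfn_all P : dfn P -> dfn (fun e => forall v, P (v :: e)).
Proof.
move=> /dfn_not/dfn_ex/dfn_not; apply: dfn_ext => e; split.
  by move=> nP v; apply: contrapT => nPv; apply: nP; exists v.
by move=> Pv [v]; apply.
Qed.

Lemma dfn_exn d P : dfn P -> dfn (fun e => exists2 x : seq R, size x = d & P (x ++ e)).
Proof.
move=> dP; elim: d => [|d IH].
  apply: dfn_ext dP => e; split; first by exists [::].
  by case=> x /size0nil ->.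
apply: dfn_ext (dfn_ex IH) => e; split.
  move=> [v [x xd Px]]; exists (rcons x v); first by rewrite size_rcons xd.
  by rewrite cat_rcons.
move=> [x]; case/lastP: x => // x v; rewrite size_rcons => -[xd]; rewrite cat_rcons => Px.
by exists v, x.
Qed.

Lemma dfn_map P (us : seq (GRing.term R)) : all (@GRing.rterm R) us -> dfn P ->
  dfn (fun e => P [seq GRing.eval e u | u <- us]).
Proof.
move=> rus; apply: (@dfn_tsub P (fun i => nth (GRing.Const 0) us i)) => [i|e i].
  case: (ltnP i (size us)) => [lt|ge]; last by rewrite nth_default.
  exact: (all_nthP _ rus).
case: (ltnP i (size us)) => [lt|ge]; first by rewrite (nth_map (GRing.Const 0)).
by rewrite !nth_default // size_map.
Qed.

Definition rowof d (e : seq R) : 'rV[R]_d := \row_k nth 0 e k.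

Lemma tmf_meval n (p : mpoly.mpoly n R) :
  tmf (fun e => mpoly.meval (fun k => rowof n e 0 k) p).
Proof.
apply: tmf_ext (fun e => esym (mpoly.mevalE _ _)) _.
apply: tmf_sum => m; apply: tmf_mul; first exact: tmf_cst.
apply: tmf_prod => i; apply: tmf_exp; apply: tmf_ext (tmf_var i) => e.
by rewrite mxE.
Qed.

Lemma dfn_semialgebraic n (S : set 'rV[R]_n) : semialgebraic S -> dfn (fun e => S (rowof n e)).
Proof.
elim=> {S} [p|S _ IH|S T _ IS _ IT].
- by apply: dfn_lt; [exact: tmf_cst|exact: tmf_meval].
- exact: dfn_not.
- exact: dfn_and.
Qed.

End Definability.

(** * Polynomial growth of Nash functions *)

Section Eventually.
Variable R : realType.
Implicit Types (p : {poly R}) (q : {poly {poly R}}).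

(** Eventually in r; the threshold is at least 1 so that powers of r are monotone
    in the exponent. *)
Definition ev (P : R -> Prop) := exists2 r0, 1 <= r0 & forall r, r0 <= r -> P r.

Lemma ev_and (P Q : R -> Prop) : ev P -> ev Q -> ev (fun r => P r /\ Q r).
Proof.
move=> [a a1 Pa] [b b1 Qb]; exists (Num.max a b) => [|r]; first by rewrite le_max a1.
by rewrite ge_max => /andP[ar br]; split; [exact: Pa|exact: Qb].
Qed.

Lemma ev_imp (P Q : R -> Prop) : (forall r, 1 <= r -> P r -> Q r) -> ev P -> ev Q.
Proof.
by move=> PQ [a a1 Pa]; exists a => // r ar; apply: PQ; [exact: le_trans ar|exact: Pa].
Qed.

Lemma ev_ge (c : R) : ev (fun r => c <= r).
Proof.
exists (Num.max 1 c) => [|r]; first by rewrite le_max lexx.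
by rewrite ge_max => /andP[].
Qed.

Lemma poly_upper p : exists N, ev (fun r => `|p.[r]| <= r ^+ N).
Proof.
elim/poly_ind: p => [|p c [N HN]].
  by exists 0%N; exists 1 => // r _; rewrite horner0 normr0.
exists N.+2; apply: ev_imp (ev_and HN (ev_ge (1 + `|c|))) => r r1 [Hr cr].
rewrite hornerMXaddC (le_trans (ler_normD _ _)) // normrM (ger0_norm (le_trans ler01 r1)).
have rN : 1 <= r ^+ N by rewrite exprn_ege1.
have := normr_ge0 c; move: `|c| cr `|p.[r]| Hr => k cr v Hr k0.
have r0 : 0 <= r by lra.
have H1 : v * r <= r ^+ N * r by rewrite ler_wpM2r.
have H2 : (1 + k) * (r ^+ N * r) <= r * (r ^+ N * r).
  by rewrite ler_wpM2r // mulr_ge0 // exprn_ge0.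
have H3 : 1 <= r ^+ N * r by rewrite -exprSr exprn_ege1.
rewrite !exprS mulrCA [X in _ <= r * X]mulrC; nra.
Qed.

Lemma poly_lower p : p != 0 ->
  exists s c : R, [/\ s = 1 \/ s = -1, 0 < c & ev (fun r => c <= s * p.[r])].
Proof.
elim/poly_ind: p => [|p a IH]; first by rewrite eqxx.
case: (eqVneq p 0) => [->|p0 _].
  rewrite mul0r add0r polyC_eq0 => a0; exists (Num.sg a), `|a|; split.
  - by case: sgrP a0 => //; [left|right].
  - by rewrite normr_gt0.
  - by exists 1 => // r _; rewrite hornerC -normrEsg.
have [s [c [s1 c0 H]]] := IH p0; exists s, 1; split=> //.
apply: ev_imp (ev_and H (ev_ge ((1 + `|a|) / c))) => r r1 [Hr].
rewrite ler_pdivrMr // hornerMXaddC mulrDr mulrA => ar.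
have sa : - `|a| <= s * a by case: s1 => ->; rewrite ?mul1r ?mulN1r ?lerN2 ?ler_norm // lerNl -normrN ler_norm.
move: `|a| (s * a) ar sa (s * p.[r]) Hr => k u ar sa z zc.
have H1 : c * r <= z * r by rewrite ler_wpM2r //; lra.
lra.
Qed.

(** Induction on the degree in y: beyond a power of r the product of y with the
    leading part dominates the next coefficient, and the sign no longer changes. *)
Lemma poly2_sign q : (forall r y, (q.[y%:P]).[r] = 0) \/
  exists (s c : R) N, [/\ s = 1 \/ s = -1, 0 < c &
    ev (fun r => forall y, r ^+ N <= y -> c <= s * (q.[y%:P]).[r])].
Proof.
elim/poly_ind: q => [|q a IH]; first by left => r y; rewrite horner0 horner0.
have E r y : (('X * 0 + q * 'X + a%:P).[y%:P]).[r] = (q.[y%:P]).[r] * y + a.[r].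
  by rewrite mulr0 add0r hornerMXaddC hornerD hornerM hornerC.
rewrite mulr0 add0r in E.
case: IH => [q0|[s [c [N [s1 c0 H]]]]].
  case: (eqVneq a 0) => [a0|/poly_lower[s [c [s1 c0 H]]]].
    by left => r y; rewrite E q0 a0 mul0r horner0 addr0.
  right; exists s, c, 0%N; split=> //; apply: ev_imp H => r r1 Hr y _.
  by rewrite E q0 mul0r add0r.
have [K HK] := poly_upper a.
right; exists s, 1, (maxn N K.+1); split => //.
apply: ev_imp (ev_and (ev_and H HK) (ev_ge (2 / c))) => r r1 [[Hr Kr]].
rewrite ler_pdivrMr // => cr y yN; rewrite E mulrDr mulrA.
have yN1 : r ^+ N <= y by apply: le_trans yN; rewrite ler_weXn2l // leq_maxl.
have yK : r ^+ K.+1 <= y by apply: le_trans yN; rewrite ler_weXn2l // leq_maxr.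
have {}Hr := Hr y yN1.
have sa : - `|a.[r]| <= s * a.[r].
  by case: s1 => ->; rewrite ?mul1r ?mulN1r ?lerN2 ?ler_norm // lerNl -normrN ler_norm.
have rK : 1 <= r ^+ K by rewrite exprn_ege1.
move: `|a.[r]| (s * a.[r]) Kr sa (s * (q.[y%:P]).[r]) Hr => v u vK uv z zc.
rewrite exprS in yK; move: (r ^+ K) rK yK vK => t t1 yK vt.
have H3 : 2 * t <= r * c * t by rewrite ler_wpM2r //; lra.
have H4 : c * (r * t) = r * c * t by ring.
have H1 : c * y <= z * y by rewrite ler_wpM2r //; nra.
have H2 : c * (r * t) <= c * y by rewrite ler_wpM2l // ltW.
nra.
Qed.

Lemma term_poly2 (u : GRing.term R) : GRing.rterm u ->
  exists q : {poly {poly R}}, forall r y, GRing.eval [:: r; y] u = (q.[y%:P]).[r].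
Proof.
elim: u => //=.
- case=> [_|[_|n _]]; [exists ('X%:P)|exists 'X|exists 0] => r y.
  + by rewrite hornerC hornerX.
  + by rewrite hornerX hornerC.
  + by rewrite /= nth_nil !horner0.
- by move=> c _; exists (c%:P%:P) => r y; rewrite !hornerC.
- by move=> n _; exists (n%:R%:P%:P) => r y; rewrite !hornerC.
- move=> u IHu v IHv /andP[/IHu[p Ep] /IHv[q Eq]]; exists (p + q) => r y.
  by rewrite Ep Eq !hornerD.
- by move=> u IHu /IHu[p Ep]; exists (- p) => r y; rewrite Ep !hornerN.
- move=> u IHu n /IHu[p Ep]; exists (p *+ n) => r y.
  by rewrite Ep !hornerMn.
- move=> u IHu v IHv /andP[/IHu[p Ep] /IHv[q Eq]]; exists (p * q) => r y.
  by rewrite Ep Eq !hornerM.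
- move=> u IHu n /IHu[p Ep]; exists (p ^+ n) => r y.
  by rewrite Ep !horner_exp.
Qed.

Lemma term_sign_stable (u : GRing.term R) : GRing.rterm u -> exists N,
  ev (fun r => forall y1 y2, r ^+ N <= y1 -> r ^+ N <= y2 ->
    Num.sg (GRing.eval [:: r; y1] u) = Num.sg (GRing.eval [:: r; y2] u)).
Proof.
move=> /term_poly2[q Eq]; case: (poly2_sign q) => [q0|[s [c [N [s1 c0 H]]]]].
  by exists 0%N; exists 1 => // r _ y1 y2 _ _; rewrite !Eq !q0.
exists N; apply: ev_imp H => r r1 H y1 y2 /H h1 /H h2; rewrite !Eq.
have {}h1 := lt_le_trans c0 h1; have {}h2 := lt_le_trans c0 h2.
case: s1 h1 h2 => ->; rewrite ?mul1r ?mulN1r ?oppr_gt0 => h1 h2.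
  by rewrite !gtr0_sg.
by rewrite !ltr0_sg.
Qed.

(** A definable set in the plane does not separate the points of a vertical line
    above the curve y = r ^+ N, for r large: each polynomial in its definition has
    constant sign there. This forces definable functions to grow polynomially. *)
Lemma dfn2_stable (P : seq R -> Prop) : dfn P -> exists N,
  ev (fun r => forall y1 y2, r ^+ N <= y1 -> r ^+ N <= y2 -> P [:: r; y1] -> P [:: r; y2]).
Proof.
move=> [f [qf rf Ef]].
suff [N H] : exists N, ev (fun r => forall y1 y2, r ^+ N <= y1 -> r ^+ N <= y2 ->
    ord.qf_eval [:: r; y1] f = ord.qf_eval [:: r; y2] f).
  exists N; apply: ev_imp H => r _ H y1 y2 h1 h2; rewrite -!Ef.
  by rewrite (H _ _ h1 h2).
have combine (A B : R -> R -> bool) (op : bool -> bool -> bool) :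
    (exists N, ev (fun r => forall y1 y2, r ^+ N <= y1 -> r ^+ N <= y2 -> A r y1 = A r y2)) ->
    (exists N, ev (fun r => forall y1 y2, r ^+ N <= y1 -> r ^+ N <= y2 -> B r y1 = B r y2)) ->
    (exists N, ev (fun r => forall y1 y2, r ^+ N <= y1 -> r ^+ N <= y2 ->
       op (A r y1) (B r y1) = op (A r y2) (B r y2))).
  move=> [N HN] [M HM]; exists (maxn N M); apply: ev_imp (ev_and HN HM) => r r1 [hN hM] y1 y2 h1 h2.
  have lN y : r ^+ maxn N M <= y -> r ^+ N <= y.
    by apply: le_trans; rewrite ler_weXn2l // leq_maxl.
  have lM y : r ^+ maxn N M <= y -> r ^+ M <= y.
    by apply: le_trans; rewrite ler_weXn2l // leq_maxr.
  by rewrite (hN y1 y2) ?(hM y1 y2) ?lN ?lM.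
have sub (a b : GRing.term R) : GRing.rterm a && GRing.rterm b -> exists N,
    ev (fun r => forall y1 y2, r ^+ N <= y1 -> r ^+ N <= y2 ->
     Num.sg (GRing.eval [:: r; y1] a - GRing.eval [:: r; y1] b) =
     Num.sg (GRing.eval [:: r; y2] a - GRing.eval [:: r; y2] b)).
  by move=> rab; exact: (@term_sign_stable (GRing.Add a (GRing.Opp b)) rab).
elim: f {Ef} qf rf => //=.
- by move=> b _ _; exists 0%N; exists 1.
- move=> a b _ /sub[N HN]; exists N; apply: ev_imp HN => r _ H y1 y2 h1 h2.
  by rewrite -subr_eq0 -sgr_eq0 (H _ _ h1 h2) sgr_eq0 subr_eq0.
- move=> a b _ /sub[N HN]; exists N; apply: ev_imp HN => r _ H y1 y2 h1 h2.
  by rewrite -subr_lt0 -sgr_lt0 (H _ _ h1 h2) sgr_lt0 subr_lt0.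
- move=> a b _ /sub[N HN]; exists N; apply: ev_imp HN => r _ H y1 y2 h1 h2.
  by rewrite -subr_le0 -sgr_le0 (H _ _ h1 h2) sgr_le0 subr_le0.
- move=> f Hf g Hg /andP[qf qg] /andP[rf rg].
  exact: (combine (fun r y => ord.qf_eval [:: r; y] f) (fun r y => ord.qf_eval [:: r; y] g) andb
    (Hf qf rf) (Hg qg rg)).
- move=> f Hf g Hg /andP[qf qg] /andP[rf rg].
  exact: (combine (fun r y => ord.qf_eval [:: r; y] f) (fun r y => ord.qf_eval [:: r; y] g) orb
    (Hf qf rf) (Hg qg rg)).
- move=> f Hf g Hg /andP[qf qg] /andP[rf rg].
  exact: (combine (fun r y => ord.qf_eval [:: r; y] f) (fun r y => ord.qf_eval [:: r; y] g) implb
    (Hf qf rf) (Hg qg rg)).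
- move=> f Hf qf rf.
  exact: (combine (fun r y => ord.qf_eval [:: r; y] f) (fun r y => ord.qf_eval [:: r; y] f)
    (fun a _ => ~~ a) (Hf qf rf) (Hf qf rf)).
Qed.

End Eventually.

Section NashGrowth.
Variables (R : realType) (d : nat).
Local Notation V := 'rV[R]_d.
Implicit Types (U : set V) (f g : V -> R).

(** A polynomial weight, comparable to the square of 1 + |x|. *)
Definition wt (x : V) : R := 1 + \sum_k x 0 k ^+ 2.

Lemma wt_ge1 x : 1 <= wt x.
Proof. by rewrite lerDl sumr_ge0 // => k _; exact: sqr_ge0. Qed.

Lemma wt_gt0 x : 0 < wt x.
Proof. exact: lt_le_trans (wt_ge1 x). Qed.

(** Definability of the graph of g over U; the value is variable number d. *)
Definition dfun U g := dfn (fun e => U (rowof d e) /\ nth 0 e d = g (rowof d e)).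

Lemma nash_dfun U g : nash_on U g -> dfun U g.
Proof.
move=> [_ /dfn_semialgebraic]; apply: dfn_ext => e /=.
have -> : lsubmx (rowof (d + 1) e) = rowof d e by apply/rowP => k; rewrite !mxE.
by rewrite !mxE /= addn0.
Qed.

Lemma open_line U x v : open U -> U x ->
  exists2 r : R, 0 < r & forall h, `|h| < r -> U (x + h *: v).
Proof.
move=> oU Ux; have /nbhs_ballP[r r0 Hr] := open_nbhs_nbhs (conj oU Ux).
pose M := 1 + \sum_k `|v 0 k|.
have M0 : 0 < M by rewrite ltr_wpDr // sumr_ge0.
exists (r / M) => [|h hr]; first by rewrite divr_gt0.
apply: Hr; split => // i k; rewrite ord1 !mxE /ball /= opprD addNKr normrN normrM.
apply: le_lt_trans (_ : `|h| * M < r); last by rewrite -ltr_pdivlMr.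
rewrite ler_wpM2l // /M (bigD1 k) //= addrCA lerDl addr_ge0 // sumr_ge0 //.
Qed.

Lemma sqr_le_of_norm (a b t : R) : 0 < t -> `|a| <= Num.sqrt t * `|b| -> a ^+ 2 <= t * b ^+ 2.
Proof.
move=> t0; rewrite -(@ler_pXn2r _ 2) ?nnegrE ?normr_ge0 ?mulr_ge0 ?sqrtr_ge0 //.
by rewrite exprMn (sqr_sqrtr (ltW t0)) !real_normK ?num_real.
Qed.

(** A first-order characterization of the derivative. It is written with squares
    because absolute values are not terms of the language of ordered rings. *)
Lemma partial_dfnP U g k x y : open U -> U x -> derivable g x (delta_mx 0 k) ->
  (forall t : R, 0 < t -> exists2 s, 0 < s & forall h, h != 0 -> h ^+ 2 < s ->
     U (x + h *: delta_mx 0 k) /\ (g (x + h *: delta_mx 0 k) - g x - y * h) ^+ 2 <= t * h ^+ 2) <->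
  y = partial k g x.
Proof.
move=> oU Ux dg; split=> [H|-> t t0].
  apply/esym; rewrite /partial /derive; apply: cvg_lim => //.
  apply/cvgrPdist_le => e e0; have [s s0 Hs] := H (e ^+ 2) (exprn_gt0 2 e0).
  have q0 : 0 < Num.sqrt s by rewrite sqrtr_gt0.
  apply/nbhs_ballP; exists (Num.sqrt s) => // h hs h0.
  have hs2 : h ^+ 2 < s.
    rewrite -[s]sqr_sqrtr ?ltW // -real_normK ?num_real // ltr_pXn2r // ?nnegrE //.
    by move: hs; rewrite /ball /= sub0r normrN.
  have [_] := Hs h h0 hs2; rewrite -exprMn -ler_sqrt ?sqr_ge0 // !sqrtr_sqr => {}Hs.
  rewrite /= [h *: _ + x]addrC.
  set u := g (x + _) in Hs *; rewrite -[_ *: _]/(_ * _).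
  have -> : y - h^-1 * (u - g x) = - (u - g x - y * h) / h by field.
  rewrite normrM normrN normfV ler_pdivrMr ?normr_gt0 // -[X in X * `|h|](ger0_norm (ltW e0)) -normrM.
  exact: Hs.
have e0 : 0 < Num.sqrt t by rewrite sqrtr_gt0.
have := dg; rewrite /derivable => /cvgrPdist_le/(_ _ e0)/nbhs_ballP[r1 r10 H1].
have [r2 r20 H2] := open_line (delta_mx 0 k) oU Ux.
have m0 : 0 < Num.min r1 r2 by rewrite lt_min r10.
exists (Num.min r1 r2 ^+ 2) => [|h h0 hs]; first by rewrite exprn_gt0.
have hm : `|h| < Num.min r1 r2.
  by rewrite -(@ltr_pXn2r _ 2) ?nnegrE ?normr_ge0 ?ltW // real_normK ?num_real.
have [h1 h2] : `|h| < r1 /\ `|h| < r2 by move: hm; rewrite lt_min => /andP[].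
split; first exact: H2.
have := H1 h; rewrite /ball /= sub0r normrN => /(_ h1 h0).
rewrite -/(partial k g x) [h *: _ + x]addrC.
rewrite -[lim _]/(partial k g x); set u := g (x + _); rewrite -[_ *: _]/(_ * _).
have -> : partial k g x - h^-1 * (u - g x) = - (u - g x - partial k g x * h) / h by field.
rewrite normrM normrN normfV ler_pdivrMr ?normr_gt0 // => {}H1.
exact: sqr_le_of_norm H1.
Qed.

Lemma dfn_domain U g : dfun U g -> dfn (fun e => U (rowof d e)).
Proof.
move=> Dg.
pose us := rcons [seq GRing.Var R i.+1 | i <- iota 0 d] (GRing.Var R 0).
have H e : [seq GRing.eval e u | u <- us] = rcons (mkseq (fun i => nth 0 e i.+1) d) (nth 0 e 0).
  by rewrite /us map_rcons /= /mkseq -map_comp.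
have rus : all (@GRing.rterm R) us by rewrite all_rcons all_map /=; apply/allP => i _.
apply: dfn_ext (dfn_ex (dfn_map rus Dg)) => e /=; split.
  move=> [v [Uv _]]; move: Uv; rewrite H /=; congr U; apply/rowP => k; rewrite !mxE.
  by rewrite nth_rcons size_mkseq ltn_ord nth_mkseq.
move=> Ue; exists (g (rowof d e)); rewrite H /=.
have -> : rowof d (rcons (mkseq (fun i : nat => e`_i) d) (g (rowof d e))) = rowof d e.
  by apply/rowP => k; rewrite !mxE nth_rcons size_mkseq ltn_ord nth_mkseq.
by rewrite nth_rcons size_mkseq ltnn eqxx.
Qed.

(** Under the five quantifiers of the definition of a derivative the variables are
    g x, g (x + h e_k), h, s, t, followed by x and the candidate value: the shift
    by five comes from there. *)
Definition shifted (k : 'I_d) : seq (GRing.term R) :=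
  rcons [seq if i == k :> nat then GRing.Add (GRing.Var R (i + 5)) (GRing.Var R 2) else GRing.Var R (i + 5)
    | i <- iota 0 d] (GRing.Var R 1).
Definition unshifted : seq (GRing.term R) :=
  rcons [seq GRing.Var R (i + 5) | i <- iota 0 d] (GRing.Var R 0).

Lemma eval_shifted (k : 'I_d) (e : seq R) v u h s t :
  let e' := [seq GRing.eval [:: v, u, h, s, t & e] a | a <- shifted k] in
  rowof d e' = rowof d e + h *: delta_mx 0 k /\ nth 0 e' d = u.
Proof.
move=> e'.
have E : e' = rcons (mkseq (fun i => if i == k then nth 0 e i + h else nth 0 e i) d) u.
  rewrite /e' /shifted map_rcons /= /mkseq -map_comp; congr rcons.
  by apply: eq_map => i /=; case: eqP => _ /=; rewrite addnC.
rewrite E nth_rcons size_mkseq ltnn eqxx; split=> //.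
apply/rowP => j; rewrite !mxE nth_rcons size_mkseq ltn_ord nth_mkseq // eqxx /=.
by rewrite -val_eqE /=; case: eqP; rewrite ?mulr1 // mulr0 addr0.
Qed.

Lemma eval_unshifted (e : seq R) v u h s t :
  let e' := [seq GRing.eval [:: v, u, h, s, t & e] a | a <- unshifted] in
  rowof d e' = rowof d e /\ nth 0 e' d = v.
Proof.
move=> e'; have E : e' = rcons (mkseq (fun i => nth 0 e i) d) v.
  rewrite /e' /unshifted map_rcons /= /mkseq -map_comp; congr rcons.
  by apply: eq_map => i /=; rewrite addnC.
rewrite E nth_rcons size_mkseq ltnn eqxx; split=> //.
by apply/rowP => j; rewrite !mxE nth_rcons size_mkseq ltn_ord nth_mkseq.
Qed.

(** By the first-order characterization of derivatives and quantifier elimination: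
    derivatives of Nash functions remain definable. *)
Lemma dfun_partial U g k : open U -> smooth_on U g -> dfun U g -> dfun U (partial k g).
Proof.
move=> oU sg Dg; have DU := dfn_domain Dg.
have r1 : all (@GRing.rterm R) (shifted k).
  by rewrite all_rcons all_map /=; apply/allP => i _ /=; case: eqP.
have r2 : all (@GRing.rterm R) unshifted.
  by rewrite all_rcons all_map /=; apply/allP => i _.
have Da := dfn_map r1 Dg; have Db := dfn_map r2 Dg.
have Dc : dfn (fun e : seq R => (nth 0 e 1 - nth 0 e 0 - nth 0 e (5 + d) * nth 0 e 2) ^+ 2
    <= nth 0 e 4 * nth 0 e 2 ^+ 2).
  have vr := @tmf_var R.
  apply: dfn_le; last by apply: tmf_mul => //; apply: tmf_exp.
  apply/tmf_exp/tmf_add; last by apply: tmf_opp; apply: tmf_mul.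
  by apply: tmf_add => //; apply: tmf_opp.
have D1 := dfn_ex (dfn_ex (dfn_and (dfn_and Da Db) Dc)).
have Dh : dfn (fun e : seq R => nth 0 e 0 <> 0).
  by apply: dfn_not; apply: dfn_eq; [exact: tmf_var|exact: tmf_cst].
have Dh2 : dfn (fun e : seq R => nth 0 e 0 ^+ 2 < nth 0 e 1).
  by apply: dfn_lt; [apply: tmf_exp; exact: tmf_var|exact: tmf_var].
have Dp : dfn (fun e : seq R => 0 < nth 0 e 0).
  by apply: dfn_lt; [exact: tmf_cst|exact: tmf_var].
have D2 := dfn_ex (dfn_and Dp (dfn_all (dfn_imp Dh (dfn_imp Dh2 D1)))).
have D3 := dfn_and DU (dfn_all (dfn_imp Dp D2)).
apply: dfn_ext D3 => e /=; set x := rowof d e; set y := nth 0 e d.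
split=> -[Ux]; have dg := @smooth_der _ _ U g x k sg Ux.
  move=> H; split=> //; apply/(partial_dfnP y oU Ux dg) => t t0.
  have [s [s0 Hs]] := H t t0; exists s => // h /eqP h0 hs.
  have [u [v [[[Ha Ea] [Hb Eb]]]]] := Hs h h0 hs.
  have [Ex Eu] := eval_shifted k e v u h s t; have [Ex' Ev] := eval_unshifted e v u h s t.
  by move: Ha Ea Hb Eb; rewrite /= in Ex Eu Ex' Ev *; rewrite Ex Eu Ex' Ev => ? -> ? -> ?.
move=> /(partial_dfnP y oU Ux dg) H; split=> // t t0.
have [s s0 Hs] := H t t0; exists s; split=> // h /eqP h0 hs.
have [Uh Eh] := Hs h h0 hs; exists (g (x + h *: delta_mx 0 k)), (g x).
have [Ex Eu] := eval_shifted k e (g x) (g (x + h *: delta_mx 0 k)) h s t.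
have [Ex' Ev] := eval_unshifted e (g x) (g (x + h *: delta_mx 0 k)) h s t.
by rewrite /= in Ex Eu Ex' Ev; rewrite Ex Eu Ex' Ev.
Qed.

End NashGrowth.

Section PolynomialFunctions.
Variables (R : realType) (d : nat).
Local Notation V := 'rV[R]_d.
Implicit Types (U : set V) (f g q : V -> R).

(** Polynomial functions, generated syntactically: closure properties are then
    proved by induction without any reference to coefficients. *)
Inductive pf : (V -> R) -> Prop :=
| pf_cst c : pf (fun=> c)
| pf_coord k : pf (fun x => x 0 k)
| pf_add f g : pf f -> pf g -> pf (fun x => f x + g x)
| pf_mul f g : pf f -> pf g -> pf (fun x => f x * g x).

Lemma derivable_coord k x (v : V) : is_derive x v (fun y : V => y 0 k) (v 0 k).
Proof.
have E : (fun h : R => h^-1 *: (((fun y : V => y 0 k) \o shift x) (h *: v) - x 0 k)) @ 0^' --> v 0 k.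
  apply/cvgrPdist_lt => e e0; near=> h; rewrite /= !mxE addrK -[_ *: _]/(_ * _) mulrA mulVf.
    by rewrite mul1r subrr normr0.
  by near: h; exact: nbhs_dnbhs_neq.
split; first by apply/cvg_ex; exists (v 0 k).
by rewrite /derive; apply: cvg_lim.
Unshelve. all: by end_near. Qed.

Lemma pf_cont f : pf f -> forall x, {for x, continuous f}.
Proof.
elim=> {f} [c x|k x|f g _ cf _ cg x|f g _ cf _ cg x].
- exact: cst_continuous.
- by apply/continuous_coordP => e e0; exists e.
- exact: contD.
- exact: contM.
Qed.

Lemma pf_der f : pf f -> forall x k, derivable f x (delta_mx 0 k).
Proof.
elim=> {f} [c x k|k x j|f g _ df _ dg x k|f g _ df _ dg x k].
- exact: derivable_cst.
- by case: (derivable_coord k x (delta_mx 0 j)).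
- exact: derivableD.
- exact: derivableM.
Qed.

Lemma pf_partial f k : pf f -> pf (partial k f).
Proof.
elim=> {f} [c|j|f g pF IHf pG IHg|f g pF IHf pG IHg].
- by rewrite partial_cst; exact: pf_cst.
- have -> : partial k (fun x : V => x 0 j) = fun=> (delta_mx 0 k : V) 0 j; last exact: pf_cst.
  by apply/funext => x; case: (derivable_coord j x (delta_mx 0 k)).
- have -> : partial k (fun x => f x + g x) = fun x => partial k f x + partial k g x.
    by apply/funext => x; rewrite partialD //; exact: pf_der.
  exact: pf_add.
- have -> : partial k (fun x => f x * g x) = fun x => f x * partial k g x + partial k f x * g x.
    by apply/funext => x; rewrite partialM //; exact: pf_der.
  by apply: pf_add; apply: pf_mul.
Qed.

Lemma pf_smooth U f : open U -> pf f -> smooth_on U f.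
Proof.
move=> oU; apply: (smooth_coind oU) => [{}f pF x _|{}f pF x k _|{}f k pF].
- exact: pf_cont.
- exact: pf_der.
- by exists (partial k f); [exact: pf_partial|].
Qed.

Lemma pf_sum (I : Type) (s : seq I) (F : I -> V -> R) :
  (forall i, pf (F i)) -> pf (fun x => \sum_(i <- s) F i x).
Proof.
move=> pF; elim: s => [|i s IH].
  have -> : (fun x => \sum_(i <- [::]) F i x) = fun=> 0 by apply/funext => x; rewrite big_nil.
  exact: pf_cst.
have -> : (fun x => \sum_(i <- i :: s) F i x) = fun x => F i x + \sum_(j <- s) F j x.
  by apply/funext => x; rewrite big_cons.
exact: pf_add.
Qed.

Lemma pf_exp f n : pf f -> pf (fun x => f x ^+ n).
Proof.
move=> pF; elim: n => [|n IH].
  have -> : (fun x => f x ^+ 0) = fun=> 1 by apply/funext => x; rewrite expr0.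
  exact: pf_cst.
have -> : (fun x => f x ^+ n.+1) = fun x => f x * f x ^+ n by apply/funext => x; rewrite exprS.
exact: pf_mul.
Qed.

Lemma pf_wt : pf (@wt R d).
Proof.
apply: pf_add; first exact: pf_cst.
by apply: pf_sum => k; apply: pf_exp; exact: pf_coord.
Qed.

Lemma pf_tmf f : pf f -> tmf (fun e => f (rowof d e)).
Proof.
elim=> {f} [c|k|f g _ tf _ tg|f g _ tf _ tg].
- exact: tmf_cst.
- by apply: tmf_ext (tmf_var R k) => e; rewrite mxE.
- exact: tmf_add.
- exact: tmf_mul.
Qed.

Lemma pf_mpoly f : pf f -> exists p : mpoly.mpoly d R, forall x : V, mpoly.meval (fun k => x 0 k) p = f x.
Proof.
elim=> {f} [c|k|f g _ [p Ep] _ [q Eq]|f g _ [p Ep] _ [q Eq]].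
- by exists (mpoly.mpolyC d c) => x; rewrite mpoly.mevalC.
- by exists (mpoly.mpolyX R (mpoly.mnm1 k)) => x; rewrite mpoly.mevalXU.
- by exists (p + q) => x; rewrite mpoly.mevalD Ep Eq.
- by exists (p * q) => x; rewrite mpoly.mevalM Ep Eq.
Qed.

Lemma pf_semialgebraic f : pf f -> semialgebraic [set x | 0 < f x].
Proof.
move=> /pf_mpoly[p Ep]; have := semialg_pos p.
by congr semialgebraic; apply/seteqP; split => x /=; rewrite Ep.
Qed.

Lemma pf_closed_ge q (c : R) : pf q -> closed [set x | c <= q x].
Proof.
move=> pq; apply: (@closed_comp _ _ q [set t | c <= t]) => [x _|]; last exact: closed_ge.
exact: pf_cont.
Qed.

Lemma wt_coord (x : V) k : `|x 0 k| <= wt x.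
Proof.
have H : x 0 k ^+ 2 <= wt x - 1.
  by rewrite /wt addrC addKr (bigD1 k) //= lerDl sumr_ge0 // => j _; exact: sqr_ge0.
have w1 := wt_ge1 x; rewrite leNgt; apply/negP => lt.
have : wt x ^+ 2 < `|x 0 k| ^+ 2 by rewrite ltr_pXn2r ?nnegrE ?normr_ge0 ?(le_trans ler01 w1).
rewrite real_normK ?num_real //; move: (wt x) (x 0 k ^+ 2) w1 H {lt} => w s w1 H; nra.
Qed.

(** Nash functions are continuous on U only; they are bounded on these sets, which
    stay away from the boundary of U. *)
Lemma sublevel_compact q (c r : R) : pf q -> compact [set x | wt x <= r /\ c <= q x].
Proof.
move=> pq; apply: (@subclosed_compact _ _ [set v : V | forall i, `[- r, r]%classic (v ord0 i)]).
- have -> : [set x | wt x <= r /\ c <= q x] = [set x | - r <= -1 * wt x] `&` [set x | c <= q x].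
    by apply/seteqP; split => x /=; rewrite mulN1r lerN2.
  apply: closedI; apply: pf_closed_ge => //.
  by apply: pf_mul; [exact: pf_cst|exact: pf_wt].
- by apply: (@rV_compact _ d (fun=> `[- r, r]%classic)) => i; exact: segment_compact.
- move=> x /= [wr _] i; rewrite in_itv /= -ler_norml.
  exact: le_trans (wt_coord x i) wr.
Qed.

Lemma bounded_on_sublevel U q g (c r : R) : pf q -> (forall x, c <= q x -> U x) ->
  (forall x, U x -> {for x, continuous g}) ->
  exists M, forall x, wt x <= r -> c <= q x -> g x ^+ 2 <= M.
Proof.
move=> pq qU cg; set K := [set x | wt x <= r /\ c <= q x].
have [[x0 Kx0]|nK] := pselect (exists x, K x); last first.
  by exists 0 => x wr cq; exfalso; apply: nK; exists x.
have cK : {within K, continuous (fun x => g x ^+ 2)}.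
  apply: continuous_in_subspaceT => x /set_mem[_ /qU Ux].
  by apply: contM; exact: cg.
have [x1 _ Hx1] := EVT_max_rV (ex_intro _ x0 Kx0) (@sublevel_compact q c r pq) cK.
by exists (g x1 ^+ 2) => x wr cq; apply: Hx1; rewrite inE.
Qed.

(** The set of pairs (r, y) with g ^+ 2 <= y wherever wt <= r and c <= q is
    definable, and by compactness it contains all high points above each r. By
    stability it then contains (r, r ^+ N) for all large r. *)
Lemma dfun_growth U q g (c : R) : pf q -> (forall x, c <= q x -> U x) ->
  (forall x, U x -> {for x, continuous g}) -> dfun U g ->
  exists C N, 0 <= C /\ forall x, c <= q x -> `|g x| <= C * wt x ^+ N.
Proof.
move=> pq qU cg Dg.
have D1 : dfn (fun e : seq R => wt (rowof d e) <= nth 0 e d.+1).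
  by apply: dfn_le; [apply: pf_tmf pf_wt|exact: tmf_var].
have D2 : dfn (fun e : seq R => c <= q (rowof d e)).
  by apply: dfn_le; [exact: tmf_cst|exact: pf_tmf].
have D3 : dfn (fun e : seq R => nth 0 e d.+2 < nth 0 e d ^+ 2).
  by apply: dfn_lt; [exact: tmf_var|apply: tmf_exp; exact: tmf_var].
have DP := dfn_not (dfn_ex (dfn_exn d (dfn_and (dfn_and D1 D2) (dfn_and Dg D3)))).
have [N [r0 r01 HN]] := dfn2_stable DP; cbv beta in HN.
have rowx (x : seq R) e : size x = d -> rowof d (x ++ e) = \row_k nth 0 x k.
  by move=> xd; apply/rowP => k; rewrite !mxE nth_cat xd ltn_ord.
have nthx (x : seq R) e i : size x = d -> nth 0 (x ++ e) (d + i) = nth 0 e i.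
  by move=> xd; rewrite nth_cat xd ltnNge leq_addr /= addKn.
have nth0 (x : seq R) e : size x = d -> nth 0 (x ++ e) d = nth 0 e 0.
  by move=> xd; rewrite -(nthx x e 0 xd) addn0.
have nth1 (x : seq R) e : size x = d -> nth 0 (x ++ e) d.+1 = nth 0 e 1.
  by move=> xd; rewrite -(nthx x e 1 xd) addn1.
have nth2 (x : seq R) e : size x = d -> nth 0 (x ++ e) d.+2 = nth 0 e 2.
  by move=> xd; rewrite -(nthx x e 2 xd) addn2.
have rowK (x : V) : \row_k nth 0 [seq x 0 k | k <- enum 'I_d] k = x.
  apply/rowP => k; rewrite !mxE (nth_map k) ?size_enum_ord ?ltn_ord //.
  by rewrite nth_ord_enum.
exists (r0 ^+ N), N; split; first by rewrite exprn_ge0 // (le_trans ler01).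
move=> x cq; rewrite -exprMn.
(* r exceeds both the threshold r0 and wt x, and is linear in the latter *)
set r := r0 * wt x.
have rr : r0 <= r by rewrite ler_peMr ?wt_ge1 // (le_trans ler01).
have r1 : 1 <= r by exact: le_trans rr.
have wr : wt x <= r by rewrite ler_peMl // (le_trans ler01 (wt_ge1 x)).
have [M HM] := @bounded_on_sublevel U q g c r pq qU cg.
have := HN r rr (Num.max M (r ^+ N)) (r ^+ N); rewrite le_max !lexx orbT.
have HP1 : ~ (exists v, exists2 y : seq R, size y = d &
    (wt (rowof d (y ++ [:: v; r; Num.max M (r ^+ N)])) <= nth 0 (y ++ [:: v; r; Num.max M (r ^+ N)]) d.+1 /\
     c <= q (rowof d (y ++ [:: v; r; Num.max M (r ^+ N)]))) /\
    (U (rowof d (y ++ [:: v; r; Num.max M (r ^+ N)])) /\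
     nth 0 (y ++ [:: v; r; Num.max M (r ^+ N)]) d = g (rowof d (y ++ [:: v; r; Num.max M (r ^+ N)]))) /\
     nth 0 (y ++ [:: v; r; Num.max M (r ^+ N)]) d.+2 < nth 0 (y ++ [:: v; r; Num.max M (r ^+ N)]) d ^+ 2).
  move=> [v [y yd]]; rewrite !rowx // nth0 // nth1 // nth2 //= => -[[w1 cq1] [[_ ->]]].
  by rewrite ltNge le_max HM.
move=> /(_ isT isT HP1) HP2.
have : g x ^+ 2 <= r ^+ N.
  rewrite leNgt; apply/negP => lt; apply: HP2; exists (g x), [seq x 0 k | k <- enum 'I_d].
    by rewrite size_map size_enum_ord.
  have yd : size [seq x 0 k | k <- enum 'I_d] = d by rewrite size_map size_enum_ord.
  rewrite !rowx // rowK nth0 // nth1 // nth2 //=; split=> //; split=> //; split=> //; exact: qU.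
move=> gr; have rN : 1 <= r ^+ N by rewrite exprn_ege1.
rewrite -(@ler_pXn2r _ 2) ?nnegrE ?(le_trans ler01 rN) // real_normK ?num_real //.
by apply: le_trans gr _; rewrite expr2 ler_peMl // (le_trans ler01).
Qed.

Lemma wt_weaken (C C' : R) N M (x : V) : 0 <= C -> C <= C' -> (N <= M)%N -> C * wt x ^+ N <= C' * wt x ^+ M.
Proof.
move=> C0 CC NM; apply: ler_pM => //; first by rewrite exprn_ge0 // ltW // wt_gt0.
by rewrite ler_weXn2l ?wt_ge1.
Qed.

Lemma growth_weaken (A : set V) (F : nat -> V -> R) n :
  (forall i, (i < n)%N -> exists C N, 0 <= C /\ forall x, A x -> F i x <= C * wt x ^+ N) ->
  exists C N, 0 <= C /\ forall x, A x -> \sum_(i < n) F i x <= C * wt x ^+ N.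
Proof.
elim: n => [|n IH] H; first by exists 0, 0%N; split=> // x _; rewrite big_ord0 mul0r.
have [C [N [C0 HC]]] := IH (fun i lt => H i (ltnW lt)).
have [C' [N' [C0' HC']]] := H n (ltnSn n).
exists (C + C'), (maxn N N'); split; first exact: addr_ge0.
move=> x Ax; rewrite big_ord_recr /= mulrDl; apply: lerD.
  by apply: le_trans (HC x Ax) _; apply: wt_weaken; rewrite ?leq_maxl.
by apply: le_trans (HC' x Ax) _; apply: wt_weaken; rewrite ?leq_maxr.
Qed.

(** All derivatives of g are definable, so each of them has polynomial growth. *)
Lemma nash_growth U q g (c : R) n : open U -> pf q -> (forall x, c <= q x -> U x) ->
  nash_on U g -> exists C N, 0 <= C /\ forall x, c <= q x -> jet n g x <= C * wt x ^+ N.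
Proof.
move=> oU pq qU ng; have sg := ng.1; move/nash_dfun: ng => Dg.
elim: n g sg Dg => [|n IH] g sg Dg /=.
  by apply: dfun_growth pq qU _ Dg => x Ux; exact: smooth_cont sg Ux.
have [C [N [C0 HC]]] := IH g sg Dg.
have [C' [N' [C0' HC']]] : exists C N, 0 <= C /\ forall x, c <= q x ->
    \sum_(k < d) jet n (partial k g) x <= C * wt x ^+ N.
  pose F i x := if insub i is Some k then jet n (partial k g) x else 0.
  have [|C' [N' [C0' HC']]] := @growth_weaken [set x | c <= q x] F d.
    move=> i id; rewrite /F insubT; apply: IH; first exact: smooth_partial.
    exact: dfun_partial.
  exists C', N'; split=> // x cq; have := HC' x cq; rewrite /F.
  by under eq_bigr do rewrite valK.
exists (C + C'), (maxn N N'); split; first exact: addr_ge0.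
move=> x cq; rewrite mulrDl; apply: lerD.
  by apply: le_trans (HC x cq) _; apply: wt_weaken; rewrite ?leq_maxl.
by apply: le_trans (HC' x cq) _; apply: wt_weaken; rewrite ?leq_maxr.
Qed.

End PolynomialFunctions.

(** * A smooth step function *)

Section SmoothStep.
Variable R : realType.
Implicit Types (t : R) (f g : R -> R) (P : {poly R}).

(** A function with all its derivatives, in the form of a sequence. *)
Definition smooth1 (p : nat -> R -> R) := forall n t, is_derive t 1 (p n) (p n.+1 t).

(** The functions P(1/t) exp(-1/t), extended by 0: a class that is stable under
    derivation. *)
Definition flat P t : R := if 0 < t then P.[t^-1] * expR (- t^-1) else 0.

(** The substitution s = 1/t turns d/dt into - s ^+ 2 d/ds. *)
Definition flat_next P : {poly R} := 'X^2 * (P - P^`()).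

(** The exponential series beats every power of 1/t; the extra factor 1/t is for
    the derivative at 0. *)
Lemma flat_small P : exists c d : R, [/\ 0 <= c, 0 < d & forall t, 0 < t -> t < d -> `|flat P t / t| <= c * t].
Proof.
have [N [s0 s01 HN]] := poly_upper (P * 'X).
pose K : R := N.+1%:R ^+ N.+1.
exists K, s0^-1; split; [by rewrite exprn_ge0|by rewrite invr_gt0 (lt_le_trans ltr01)|].
move=> t t0 ts; rewrite /flat t0; set s := t^-1.
have s00 : 0 < s0 by exact: lt_le_trans s01.
have ss : s0 <= s by rewrite /s -[s0]invrK lef_pV2 ?posrE ?invr_gt0 // ltW.
have sp : 0 < s by rewrite invr_gt0.
have {}HN := HN s ss; rewrite hornerM hornerX in HN.
have Hexp : s ^+ N.+1 / K <= expR s.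
  have -> : expR s = expR (s / N.+1%:R) ^+ N.+1.
    by rewrite -expRM_natl mulrC divfK // pnatr_eq0.
  rewrite /K -expr_div_n ler_pXn2r ?nnegrE ?expR_ge0 ?divr_ge0 ?(ltW sp) //.
  by apply: le_trans (expR_ge1Dx _); rewrite lerDr.
have K0 : 0 < K by rewrite exprn_gt0.
have -> : `|P.[s] * expR (- s) / t| = `|P.[s] * s| / expR s.
  by rewrite expRN mulrAC normrM [in RHS]/s (gtr0_norm (_ : 0 < (expR s)^-1)) // invr_gt0 expR_gt0.
rewrite ler_pdivrMr ?expR_gt0 //; apply: le_trans HN _.
have -> : t = s^-1 by rewrite /s invrK.
apply: le_trans (_ : K / s * (s ^+ N.+1 / K) <= _); last first.
  by rewrite ler_wpM2l // divr_ge0 ?ltW.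
by rewrite exprS -subr_ge0 (_ : _ - _ = 0) //; field; rewrite !gt_eqF.
Qed.

Lemma flat_derive P t : is_derive t 1 (flat P) (flat (flat_next P) t).
Proof.
case: (ltgtP t 0) => [t0|t0|->].
- have N : \forall s \near t, (fun=> 0) s = flat P s.
    near=> s; rewrite /flat ltNge (_ : s <= 0) //.
    by apply: ltW; near: s; exact: lt_nbhsl.
  have -> : flat (flat_next P) t = 0 by rewrite /flat ltNge ltW.
  exact: (near_eq_is_derive N (is_derive_cst _ _ _)).
- have N : \forall s \near t, (fun s => P.[s^-1] * expR (- s^-1)) s = flat P s.
    near=> s; rewrite /flat (_ : 0 < s) //.
    by near: s; exact: lt_nbhsr.
  apply: (near_eq_is_derive N).
  have tn : t != 0 by rewrite gt_eqF.
  have dV : is_derive t 1 (fun s : R => s^-1) (- t ^- 2).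
    by have := is_deriveV tn (is_derive_id t 1); rewrite [_ *: _]mulr1.
  have dP : is_derive t 1 (fun s : R => P.[s^-1]) (P^`().[t^-1] * (- t ^- 2)).
    exact: is_derive1_comp (is_derive_poly P t^-1) dV.
  have dE : is_derive t 1 (fun s : R => expR (- s^-1)) (expR (- t^-1) * (- - t ^- 2)).
    have dN : is_derive t 1 (fun s : R => - s^-1) (- - t ^- 2) by exact: is_deriveN.
    exact: (@is_derive1_comp _ (@expR R) (fun s => - s^-1) t _ _ (is_derive_expR _) dN).
  have dM := is_deriveM dP dE.
  apply: is_derive_eq; rewrite /flat t0 /flat_next !hornerE exprVn -!/(_ * _).
  rewrite -[P.[t^-1] *: _]/(_ * _) -[expR (- t^-1) *: _]/(_ * _); ring.
- have -> : flat (flat_next P) 0 = 0 by rewrite /flat ltxx.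
  have E : (fun h : R => h^-1 *: ((flat P \o shift 0) (h *: 1) - flat P 0)) @ 0^' --> 0.
    have [c [d [c0 d0 H]]] := flat_small P.
    apply/cvgrPdist_le => e e0; near=> h.
    rewrite sub0r normrN /= addr0 [h *: 1]mulr1 {2}/flat ltxx subr0 -[_ *: _]/(_ * _) mulrC.
    have [h0|h0] := ltP 0 h; last by rewrite /flat ltNge h0 mul0r normr0 ltW.
    have hs : h < d.
      by apply: le_lt_trans (ler_norm h) _; near: h; exact: dnbhs0_lt.
    apply: le_trans (H h h0 hs) _.
    have hc : h <= e / (c + 1).
      apply: le_trans (ler_norm h) _; apply: ltW.
      by near: h; apply: dnbhs0_lt; rewrite divr_gt0 // ltr_wpDl.
    have c1 : 0 < c + 1 by rewrite ltr_wpDl.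
    rewrite ler_pdivlMr // in hc; by apply: le_trans hc; rewrite mulrDr mulr1 [c * h]mulrC lerDl ltW.
  split; first by apply/cvg_ex; exists 0.
  by rewrite /derive; apply: cvg_lim.
Unshelve. all: by end_near. Qed.

(** The analogue in one variable of the coinduction for smooth_on. *)
Lemma smooth1_coind (G : set (R -> R)) :
  (forall f, G f -> exists2 g, G g & forall t, is_derive t 1 f (g t)) ->
  forall f, G f -> exists2 p, smooth1 p & p 0%N = f.
Proof.
move=> H f Gf; pose D f t := 'D_1 f t.
have GD h : G h -> G (D h) /\ forall t, is_derive t 1 h (D h t).
  move=> /H[g Gg dg]; have -> : D h = g by apply/funext => t; case: (dg t).
  by [].
have Gn n : G (iter n D f) by elim: n => //= n IH; case: (GD _ IH).
exists (fun n => iter n D f) => // n t.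
by case: (GD _ (Gn n)) => _; apply.
Qed.

(** An algebra of functions stable under derivation that contains a step: the outer
    flat vanishes once flat 1 exceeds a. *)
Inductive flatgen (a : R) : (R -> R) -> Prop :=
| fg_cst c : flatgen a (fun=> c)
| fg_flat P : flatgen a (flat P)
| fg_comp P : flatgen a (fun t => flat P (a - flat 1 t))
| fg_add f g : flatgen a f -> flatgen a g -> flatgen a (fun t => f t + g t)
| fg_mul f g : flatgen a f -> flatgen a g -> flatgen a (fun t => f t * g t).

Lemma flatgen_derive a f : flatgen a f -> exists2 g, flatgen a g & forall t, is_derive t 1 f (g t).
Proof.
elim=> {f} [c|P|P|f g Gf [f' Gf' df] Gg [g' Gg' dg]|f g Gf [f' Gf' df] Gg [g' Gg' dg]].
- by exists (fun=> 0); [exact: fg_cst|move=> t; exact: is_derive_cst].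
- by exists (flat (flat_next P)); [exact: fg_flat|exact: flat_derive].
- exists (fun t => flat (flat_next P) (a - flat 1 t) * (-1 * flat (flat_next 1) t)).
    apply: fg_mul; first exact: fg_comp.
    by apply: fg_mul; [exact: fg_cst|exact: fg_flat].
  move=> t; apply: (is_derive1_comp (flat_derive P _)).
  have d1 := is_deriveB (is_derive_cst a t 1) (flat_derive 1 t).
  by apply: is_derive_eq; rewrite sub0r mulN1r.
- exists (fun t => f' t + g' t); first exact: fg_add.
  by move=> t; exact: is_deriveD.
- exists (fun t => f t * g' t + g t * f' t); first by apply: fg_add; apply: fg_mul.
  by move=> t; exact: is_deriveM.
Qed.

Lemma smooth1_near (p : nat -> R -> R) (A : set R) c : smooth1 p -> open A ->
  (forall t, A t -> p 0%N t = c) -> forall n t, A t -> p n.+1 t = 0.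
Proof.
move=> sp oA H; have step n c' : (forall t, A t -> p n t = c') -> forall t, A t -> p n.+1 t = 0.
  move=> Hn t At; have dp := sp n t.
  have N : \forall s \near t, (fun=> c') s = p n s.
    by apply: filterS (open_nbhs_nbhs (conj oA At)) => s /Hn.
  have dc := near_eq_is_derive N (is_derive_cst c' t 1).
  by case: dp => _ <-; case: dc.
by elim=> [|n IH]; [exact: step H|exact: step IH].
Qed.

Lemma smooth1_cont p : smooth1 p -> forall n, continuous (p n).
Proof.
move=> sp n t; apply: differentiable_continuous; apply/derivable1_diffP.
by case: (sp n t).
Qed.

(** With a = flat 1 1, the function 1 - flat 1 (a - flat 1 t) / flat 1 a is 0 for
    t < 0 and 1 for t > 1. The derivatives are bounded on [0, 1] by compactness and
    vanish elsewhere. *)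
Lemma smooth_step : exists p : nat -> R -> R, [/\ smooth1 p,
  forall n t, t < 0 -> p n t = 0, forall t, 1 < t -> p 0%N t = 1,
  forall n t, 1 < t -> p n.+1 t = 0 & forall n, exists B, forall t, `|p n t| <= B].
Proof.
pose a := flat 1 1; have a0 : 0 < a by rewrite /a /flat ltr01 hornerC mul1r expR_gt0.
have Ga : 0 < flat 1 a by rewrite /flat a0 hornerC mul1r expR_gt0.
pose f t := 1 + (- (flat 1 a)^-1) * flat 1 (a - flat 1 t).
have Gf : flatgen a f.
  by apply: fg_add; [exact: fg_cst|apply: fg_mul; [exact: fg_cst|exact: fg_comp]].
have [p sp p0] := smooth1_coind (@flatgen_derive a) Gf.
have H0 t : t < 0 -> p 0%N t = 0.
  move=> t0; rewrite p0 /f {3}/flat ltNge ltW //= subr0 mulNr mulVf ?subrr //.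
  by rewrite gt_eqF.
have H1 t : 1 < t -> p 0%N t = 1.
  move=> t1; have t0 : 0 < t by exact: lt_trans t1.
  rewrite p0 /f {2}/flat ltNge subr_le0 (_ : a <= flat 1 t) /= ?mulr0 ?addr0 //.
  rewrite /a /flat ltr01 t0 !hornerC !mul1r ler_expR lerN2 invr1.
  by rewrite invf_le1 // ltW.
have Hl : forall n t, t < 0 -> p n t = 0.
  case=> [//|n]; apply: (@smooth1_near p [set t | t < 0] 0 sp) => //; exact: open_lt.
have Hr : forall n t, 1 < t -> p n.+1 t = 0.
  by apply: (@smooth1_near p [set t | 1 < t] 1 sp) => //; exact: open_gt.
exists p; split=> // n.
have cn : continuous (fun t => `|p n t|).
  by move=> t; apply: continuous_comp; [exact: smooth1_cont|exact: norm_continuous].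
have [c _ Hc] := @EVT_max R (fun t => `|p n t|) 0 1 ler01 (continuous_subspaceT cn).
exists (Num.max 1 `|p n c|) => t; rewrite le_max.
have [t0|t0] := ltP t 0; first by rewrite Hl // normr0 ler01.
have [t1|t1] := ltP 1 t; last by rewrite Hc ?orbT // in_itv /= t0.
apply/orP; left; case: n {Hc cn} => [|n]; first by rewrite (H1 t t1) normr1.
by rewrite (Hr n t t1) normr0 ler01.
Qed.

End SmoothStep.

Section Composition.
Variables (R : realType) (d : nat).
Local Notation V := 'rV[R]_d.
Implicit Types (U : set V) (q : V -> R) (p : nat -> R -> R).

Lemma comp_derive p q n x (v : V) : smooth1 p -> derivable q x v ->
  is_derive x v (fun y => p n (q y)) (p n.+1 (q x) * 'D_v q x).
Proof.
move=> sp dq.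
have dq0 : derivable q (x + 0 *: v) v by rewrite scale0r addr0.
have H := is_derive1_comp (sp n _) (line_derive dq0).
rewrite scale0r addr0 in H.
have E : (fun h : R => h^-1 *: (((p n \o (fun s => q (x + s *: v))) \o shift 0) (h *: 1) -
     (p n \o (fun s => q (x + s *: v))) 0)) =
   (fun h : R => h^-1 *: (((fun y => p n (q y)) \o shift x) (h *: v) - p n (q x))).
  by apply/funext => h; rewrite /= addr0 [h *: 1]mulr1 scale0r addr0 [x + _]addrC.
case: H => H1 H2; split; first by move: H1; rewrite /derivable E.
by rewrite -H2 /derive E.
Qed.

Lemma smooth_comp1 U p q : open U -> smooth1 p -> smooth_on U q ->
  forall n, smooth_on U (fun x => p n (q x)).
Proof.
move=> oU sp sq n.
pose B := smooth_on U `|` [set f | exists m, f = fun x => p m (q x)].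
apply: (@sumprod_smooth _ _ U B) => //; last by apply: sp_base; right; exists n.
- move=> f [sf x Ux|[m ->] x Ux]; first exact: smooth_cont sf Ux.
  have cq := smooth_cont sq Ux.
  by apply: (@continuous_comp _ _ _ q (p m)) => //; exact: smooth1_cont.
- move=> f [sf x k Ux|[m ->] x k Ux]; first exact: smooth_der sf Ux.
  by case: (comp_derive m sp (@smooth_der _ _ U q x k sq Ux)).
- move=> f k [sf|[m ->]].
    by exists (partial k f) => //; apply: sp_base; left; exact: smooth_partial.
  exists (fun x => p m.+1 (q x) * partial k q x).
    apply: sp_mul; apply: sp_base; first by right; exists m.+1.
    by left; exact: smooth_partial.
  by move=> x Ux; case: (comp_derive m sp (@smooth_der _ _ U q x k sq Ux)).
Qed.

(** Faa di Bruno with a crude bound: each derivative produces one more factor of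
    size at most 1 + jet n q x. *)
Lemma jet_comp1 U p q n m x B : open U -> smooth1 p -> smooth_on U q -> U x ->
  (forall i, (i <= n)%N -> `|p (m + i)%N (q x)| <= B) ->
  jet n (fun x => p m (q x)) x <= B * (1 + jet n q x) ^+ n.
Proof.
move=> oU sp sq Ux; elim: n m => [|n IH] m HB /=.
  by rewrite expr0 mulr1; have := HB 0%N isT; rewrite addn0.
have B0 : 0 <= B by apply: le_trans (HB 0%N isT).
set J := jet n q x; set S := \sum_k jet n (partial k q) x.
have J0 : 0 <= J by exact: jet_ge0.
have S0 : 0 <= S by apply: sumr_ge0 => *; exact: jet_ge0.
have H0 : jet n (fun x => p m (q x)) x <= B * (1 + J) ^+ n.
  by apply: IH => i lei; apply: HB; exact: leqW.
have H1 : jet n (fun x => p m.+1 (q x)) x <= B * (1 + J) ^+ n.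
  by apply: IH => i lei; rewrite addSnnS; apply: HB.
have H2 : \sum_k jet n (partial k (fun x => p m (q x))) x <= B * (1 + J) ^+ n * S.
  rewrite mulr_sumr; apply: ler_sum => k _.
  rewrite (@jet_eq_on _ _ U _ (fun x => p m.+1 (q x) * partial k q x)) //; last first.
    by move=> y Uy; case: (comp_derive m sp (@smooth_der _ _ U q y k sq Uy)).
  apply: le_trans (jetM n oU (smooth_comp1 oU sp sq m.+1) (@smooth_partial _ _ U q k sq) Ux) _.
  by rewrite ler_wpM2r ?jet_ge0.
apply: le_trans (lerD H0 H2) _.
rewrite -{1}[B * _]mulr1 -mulrDr -mulrA ler_wpM2l // exprSr addrA.
apply: ler_pM; rewrite ?exprn_ge0 ?addr_ge0 //; last first.
  by rewrite -addrA [J + S]addrC addrA lerDl.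
by apply: lerXn2r; rewrite ?nnegrE ?addr_ge0 // lerDl.
Qed.

End Composition.

(** * Rapidly decreasing functions and tempered distributions *)

Section Rapid.
Variables (R : realType) (d : nat).
Local Notation V := 'rV[R]_d.
Implicit Types (f g : V -> R) (A : pred 'I_d) (x y z : V).

Let oT : open (setT : set V) := @open_setT R d.

Definition rapid f := smooth_on setT f /\
  forall n N, exists M, forall x, wt x ^+ N * jet n f x <= M.

(** The multipliers of the rapidly decreasing functions. *)
Definition tempered f := smooth_on setT f /\
  forall n, exists C N, 0 <= C /\ forall x, jet n f x <= C * wt x ^+ N.

Lemma wtX_ge0 x N : 0 <= wt x ^+ N.
Proof. by rewrite exprn_ge0 // ltW // wt_gt0. Qed.

Lemma wtX_ge1 x N : 1 <= wt x ^+ N.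
Proof. by rewrite exprn_ege1 // wt_ge1. Qed.

Lemma rapid_smooth f : rapid f -> smooth_on setT f.
Proof. by case. Qed.

Lemma rapid_der f x k : rapid f -> derivable f x (delta_mx 0 k).
Proof. by move=> rf; exact: smooth_der rf.1 I. Qed.

Arguments rapid_der [f] x k _.

Lemma rapid_partial f k : rapid f -> rapid (partial k f).
Proof.
move=> [sf bf]; split; first exact: smooth_partial.
move=> n N; have [M HM] := bf n.+1 N; exists M => x.
by apply: le_trans (HM x); rewrite ler_wpM2l ?wtX_ge0 // jet_partial.
Qed.

Lemma rapid0 : rapid (fun=> 0).
Proof.
split; first exact: smooth_cst.
by move=> n N; exists 0 => x; rewrite jet_cst normr0 mulr0.
Qed.

Lemma rapidD f g : rapid f -> rapid g -> rapid (fun x => f x + g x).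
Proof.
move=> [sf bf] [sg bg]; split; first exact: smoothD.
move=> n N; have [M HM] := bf n N; have [M' HM'] := bg n N; exists (M + M') => x.
apply: le_trans (lerD (HM x) (HM' x)); rewrite -mulrDr ler_wpM2l ?wtX_ge0 //.
exact: (jetD n oT sf sg I).
Qed.

Lemma rapidZ c f : rapid f -> rapid (fun x => c * f x).
Proof.
move=> [sf bf]; split; first exact: smoothZ.
move=> n N; have [M HM] := bf n N; exists (`|c| * M) => x.
by rewrite (jetZ _ _ oT sf I) mulrCA ler_wpM2l.
Qed.

Lemma rapidB f g : rapid f -> rapid g -> rapid (fun x => f x - g x).
Proof.
move=> rf rg; have := rapidD rf (rapidZ (-1) rg).
by under [in X in rapid X -> _]eq_fun do rewrite mulN1r.
Qed.

Lemma temperedM_rapid g f : tempered g -> rapid f -> rapid (fun x => g x * f x).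
Proof.
move=> [sg bg] [sf bf]; split; first exact: smoothM.
move=> n N; have [C [K [C0 HC]]] := bg n; have [M HM] := bf n (N + K)%N.
exists (C * M) => x; apply: le_trans (_ : C * (wt x ^+ (N + K) * jet n f x) <= _).
  apply: le_trans (_ : wt x ^+ N * (jet n g x * jet n f x) <= _).
    by rewrite ler_wpM2l ?wtX_ge0 // (jetM n oT sg sf I).
  have := HC x; have := wtX_ge0 x N; have := jet_ge0 n f x.
  rewrite exprD; move: (wt x ^+ N) (wt x ^+ K) (jet n f x) (jet n g x) => a b j k j0 a0 H.
  rewrite [X in _ <= X](_ : _ = a * (C * b * j)); last by ring.
  by rewrite ler_wpM2l // ler_wpM2r.
by rewrite ler_wpM2l.
Qed.

Lemma tempered_cst c : tempered (fun=> c).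
Proof.
split; first exact: smooth_cst.
by move=> n; exists `|c|, 0%N; split=> // x; rewrite jet_cst mulr1.
Qed.

Lemma temperedD f g : tempered f -> tempered g -> tempered (fun x => f x + g x).
Proof.
move=> [sf bf] [sg bg]; split; first exact: smoothD.
move=> n; have [C [N [C0 HC]]] := bf n; have [C' [N' [C0' HC']]] := bg n.
exists (C + C'), (maxn N N'); split; first exact: addr_ge0.
move=> x; apply: le_trans (jetD n oT sf sg I) _; rewrite mulrDl; apply: lerD.
  by apply: le_trans (HC x) _; apply: wt_weaken; rewrite ?leq_maxl.
by apply: le_trans (HC' x) _; apply: wt_weaken; rewrite ?leq_maxr.
Qed.

Lemma temperedM f g : tempered f -> tempered g -> tempered (fun x => f x * g x).
Proof.
move=> [sf bf] [sg bg]; split; first exact: smoothM.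
move=> n; have [C [N [C0 HC]]] := bf n; have [C' [N' [C0' HC']]] := bg n.
exists (C * C'), (N + N')%N; split; first exact: mulr_ge0.
move=> x; apply: le_trans (jetM n oT sf sg I) _; rewrite exprD mulrACA.
by apply: ler_pM; rewrite ?jet_ge0.
Qed.

Lemma jet_coord n k x : jet n (fun y : V => y 0 k) x = `|x 0 k| + n%:R.
Proof.
have pE j : partial j (fun y : V => y 0 k) = fun=> (j == k)%:R.
  by apply/funext => y; case: (derivable_coord k y (delta_mx 0 j)) => _;
     rewrite mxE eqxx /= eq_sym.
have E m : \sum_(j < d) jet m (partial j (fun y : V => y 0 k)) x = 1.
  rewrite (bigD1 k) //= pE eqxx jet_cst normr1 big1 ?addr0 // => j /negbTE jk.
  by rewrite pE jk jet_cst normr0.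
elim: n => [|n IH]; first by rewrite addr0.
by rewrite /= E IH -addrA -natr1.
Qed.

(** Constants and coordinates are tempered, and tempered functions form an algebra. *)
Lemma pf_tempered f : pf f -> tempered f.
Proof.
elim=> {f} [c|k|f g _ tf _ tg|f g _ tf _ tg].
- exact: tempered_cst.
- split; first by apply: pf_smooth => //; exact: pf_coord.
  move=> n; exists (1 + n%:R), 1%N; split=> [|x]; first by rewrite addr_ge0.
  rewrite jet_coord expr1 mulrDl mul1r; apply: lerD; first exact: wt_coord.
  by rewrite ler_peMr ?wt_ge1.
- exact: temperedD.
- exact: temperedM.
Qed.

Lemma tempered_comp1 (p : nat -> R -> R) q m : smooth1 p -> tempered q ->
  (forall n, exists B, forall t, `|p n t| <= B) -> tempered (fun x => p m (q x)).
Proof.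
move=> sp [sq bq] bp; split; first exact: smooth_comp1.
move=> n; have [C [N [C0 HC]]] := bq n; have /choice[B HB] := bp.
pose B' := \sum_(i < n.+1) `|B (m + i)%N|.
have B0 : 0 <= B' by apply: sumr_ge0.
exists (B' * (1 + C) ^+ n), (N * n)%N; split.
  by rewrite mulr_ge0 // exprn_ge0 // addr_ge0.
move=> x; apply: le_trans (@jet_comp1 _ _ setT p q n m x B' oT sp sq I _) _.
  move=> i lei; apply: le_trans (HB _ _) _.
  rewrite /B' (bigD1 (Ordinal (lei : (i < n.+1)%N))) //=.
  by rewrite ler_wpDr ?ler_norm // sumr_ge0.
rewrite -mulrA ler_wpM2l // exprM -exprMn; apply: lerXn2r.
- by rewrite nnegrE addr_ge0 ?jet_ge0.
- by rewrite nnegrE mulr_ge0 ?addr_ge0 // wtX_ge0.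
- by rewrite mulrDl mul1r; apply: lerD; [exact: wtX_ge1|exact: HC].
Qed.

(** Peetre's inequality. *)
Lemma wt_shift x v : wt x <= 2 * wt v * wt (x + v).
Proof.
rewrite /wt; under [X in _ <= _ * (1 + X)]eq_bigr do rewrite mxE.
set a := \sum_k x 0 k ^+ 2; set b := \sum_k v 0 k ^+ 2; set c := \sum_k (x 0 k + v 0 k) ^+ 2.
have b0 : 0 <= b by apply: sumr_ge0 => k _; exact: sqr_ge0.
have c0 : 0 <= c by apply: sumr_ge0 => k _; exact: sqr_ge0.
have abc : a <= 2 * b + 2 * c.
  rewrite /a /b /c !mulr_sumr -big_split; apply: ler_sum => k _ /=.
  move: (x 0 k) (v 0 k) => s t; have := sqr_ge0 (s + 2 * t); nra.
clearbody a b c; nra.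
Qed.

Lemma rapid_shift v f : rapid f -> rapid (fun x => f (x + v)).
Proof.
move=> [sf bf]; split; first exact: smooth_shift.
move=> n N; have [M HM] := bf n N; exists ((2 * wt v) ^+ N * M) => x.
rewrite jet_shift; apply: le_trans (_ : (2 * wt v) ^+ N * (wt (x + v) ^+ N * jet n f (x + v)) <= _).
  rewrite mulrA ler_wpM2r ?jet_ge0 // -exprMn.
  apply: lerXn2r; rewrite ?nnegrE ?wt_shift // ?mulr_ge0 // ltW //; exact: wt_gt0.
by rewrite ler_wpM2l // exprn_ge0 // mulr_ge0 // ltW // wt_gt0.
Qed.

Definition wtA A x : R := 1 + \sum_(k | A k) x 0 k ^+ 2.

(** Test functions of the variables in A alone. They do not decrease in the other
    variables, hence the weight wtA. *)
Definition rapidA A g := [/\ smooth_on setT g,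
  forall x y, (forall k, A k -> x 0 k = y 0 k) -> g x = g y &
  forall n N, exists M, forall x, wtA A x ^+ N * jet n g x <= M].

(** The point with coordinates x along A and z elsewhere. Keeping all points in one
    space avoids product types. *)
Definition glue A x z : V := csub x (fun j => if A j then None else Some j) z.

Lemma glueE A x z k : glue A x z 0 k = if A k then x 0 k else z 0 k.
Proof. by rewrite /glue !mxE; case: (A k). Qed.

Lemma glue_inj A j j' k : (if A j then None else Some j) = Some k ->
  (if A j' then None else Some j') = Some k -> j = j'.
Proof. by case: (A j) => // -[->]; case: (A j') => // -[->]. Qed.

Lemma wtA_ge1 A x : 1 <= wtA A x.
Proof. by rewrite lerDl sumr_ge0 // => k _; exact: sqr_ge0. Qed.

Lemma wtAX_ge0 A x N : 0 <= wtA A x ^+ N.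
Proof. by rewrite exprn_ge0 // (le_trans ler01) // wtA_ge1. Qed.

Lemma wtA_wt A x : wtA A x <= wt x.
Proof.
by rewrite lerD2l [X in _ <= X](bigID A) /= lerDl sumr_ge0 // => k _; exact: sqr_ge0.
Qed.

Lemma wt_glue A x z : wt z <= wtA A z * wt (glue A x z).
Proof.
rewrite /wtA /wt (bigID A) [X in _ * (1 + X)](bigID A) /=.
rewrite [X in _ * (1 + (_ + X))](eq_bigr (fun k => z 0 k ^+ 2)); last first.
  by move=> k /negbTE nA; rewrite glueE nA.
set a := \sum_(k | A k) z 0 k ^+ 2; set b := \sum_(k | ~~ A k) _; set c := \sum_(k | A k) _.
have a0 : 0 <= a by apply: sumr_ge0 => k _; exact: sqr_ge0.
have b0 : 0 <= b by apply: sumr_ge0 => k _; exact: sqr_ge0.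
have c0 : 0 <= c by apply: sumr_ge0 => k _; exact: sqr_ge0.
clearbody a b c; nra.
Qed.

Lemma wtA_glue A x z : wtA A x <= wt (glue A x z).
Proof.
apply: le_trans (wtA_wt A _); rewrite lerD2l le_eqVlt; apply/orP; left; apply/eqP.
by apply: eq_bigr => k Ak; rewrite glueE Ak.
Qed.

Lemma smooth_glue A x f : smooth_on setT f -> smooth_on setT (fun z => f (glue A x z)).
Proof. by move=> sf; exact: (@smooth_csub _ _ _ x _ (@glue_inj A) f sf). Qed.

Lemma jet_glue A n x f z : jet n (fun z => f (glue A x z)) z <= jet n f (glue A x z).
Proof. exact: (@jet_csub _ _ _ x _ (@glue_inj A) n f z). Qed.

(** The jets of the two factors multiply, and the weight splits because wt z is at
    most wtA A z times the weight of the glued point. *)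
Lemma tensor_bound A n N K g f x z : smooth_on setT g -> smooth_on setT f ->
  wtA A x ^+ K * (wt z ^+ N * jet n (fun z => g z * f (glue A x z)) z) <=
  (wtA A z ^+ N * jet n g z) * (wt (glue A x z) ^+ (N + K) * jet n f (glue A x z)).
Proof.
move=> sg sf; set y := glue A x z.
have H1 := jetM n oT sg (smooth_glue A x sf) (I : setT z).
have H2 := jet_glue A n x f z; rewrite -/y in H2.
have H3 : wt z ^+ N <= wtA A z ^+ N * wt y ^+ N.
  rewrite -exprMn; apply: lerXn2r; rewrite ?nnegrE; last exact: wt_glue.
    exact: ltW (wt_gt0 z).
  by rewrite mulr_ge0 ?(le_trans ler01) ?wtA_ge1 ?wt_ge1.
have H4 : wtA A x ^+ K <= wt y ^+ K.
  apply: lerXn2r; rewrite ?nnegrE ?wtA_glue //; last exact: ltW (wt_gt0 _).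
  by rewrite (le_trans ler01) ?wtA_ge1.
have H5 : jet n (fun z => g z * f (glue A x z)) z <= jet n g z * jet n f y.
  by apply: le_trans H1 _; rewrite ler_wpM2l ?jet_ge0.
rewrite exprD [X in _ <= X](_ : _ = wt y ^+ K * ((wtA A z ^+ N * wt y ^+ N) *
   (jet n g z * jet n f y))); last by ring.
apply: ler_pM; rewrite ?wtAX_ge0 ?mulr_ge0 ?wtX_ge0 ?jet_ge0 //.
by apply: ler_pM; rewrite ?wtX_ge0 ?jet_ge0.
Qed.

Lemma rapid_tensor A g f x : rapidA A g -> rapid f -> rapid (fun z => g z * f (glue A x z)).
Proof.
move=> [sg _ bg] [sf bf]; split.
  by apply: smoothM; [exact: oT|exact: sg|exact: smooth_glue].
move=> n N; have [M HM] := bg n N; have [M' HM'] := bf n (N + 0)%N.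
exists (M * M') => z; have := tensor_bound A n N 0 x z sg sf.
rewrite expr0 mul1r => /le_trans; apply.
by apply: ler_pM => //; rewrite mulr_ge0 ?wtAX_ge0 ?wtX_ge0 ?jet_ge0.
Qed.

(** Tempered distributions; since the seminorms are directed, continuity amounts to
    one bounding seminorm. *)
Definition tdist (T : (V -> R) -> R) :=
  (forall a f g, rapid f -> rapid g -> T (fun x => a * f x + g x) = a * T f + T g) /\
  exists n N C, 0 <= C /\ forall f, rapid f -> forall M,
    (forall x, wt x ^+ N * jet n f x <= M) -> `|T f| <= C * M.

Lemma tdist0 T : tdist T -> T (fun=> 0) = 0.
Proof.
move=> [lT _]; have := lT 1 _ _ rapid0 rapid0.
rewrite [1 * T _]mul1r (_ : (fun x => _) = fun=> 0); last by apply/funext => x; rewrite mulr0 addr0.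
by move=> H; apply: (@addIr _ (T (fun=> 0))); rewrite add0r -H.
Qed.

Lemma tdistD T f g : tdist T -> rapid f -> rapid g -> T (fun x => f x + g x) = T f + T g.
Proof.
move=> [lT _] rf rg; have := lT 1 _ _ rf rg; rewrite mul1r => <-.
by congr T; apply/funext => x; rewrite mul1r.
Qed.

Lemma tdistZ T c f : tdist T -> rapid f -> T (fun x => c * f x) = c * T f.
Proof.
move=> dT rf; have := dT.1 c _ _ rf rapid0; rewrite tdist0 // addr0 => <-.
by congr T; apply/funext => x; rewrite addr0.
Qed.

Lemma tdistB T f g : tdist T -> rapid f -> rapid g -> T (fun x => f x - g x) = T f - T g.
Proof.
move=> dT rf rg; have rN := rapidZ (-1) rg; have := tdistD dT rf rN.
rewrite tdistZ // mulN1r => <-; by congr T; apply/funext => x; rewrite mulN1r.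
Qed.

(** This is used to test the variables one at a time. *)
Lemma tdist_tensor A T g x : tdist T -> rapidA A g ->
  tdist (fun f => T (fun z => g z * f (glue A x z))).
Proof.
move=> dT rg; split.
  move=> a f h rf rh; rewrite -dT.1; [|exact: rapid_tensor|exact: rapid_tensor].
  by congr T; apply/funext => z; rewrite mulrDr mulrCA.
have [n [N [C [C0 HC]]]] := dT.2; have [sg _ bg] := rg; have [M0 HM0] := bg n N.
exists n, N, (C * M0); split.
  by rewrite mulr_ge0 // (le_trans _ (HM0 0)) // mulr_ge0 ?wtAX_ge0 ?jet_ge0.
move=> f rf M HM; rewrite -mulrA; apply: HC; first exact: rapid_tensor.
move=> z; have := tensor_bound A n N 0 x z sg rf.1; rewrite expr0 mul1r => /le_trans; apply.
by apply: ler_pM; rewrite ?mulr_ge0 ?wtAX_ge0 ?wtX_ge0 ?jet_ge0 // addn0.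
Qed.

End Rapid.

Arguments rapid_der {R d} [f] x k _.
Arguments rapid_shift {R d} v [f] _.
Arguments rapid_partial {R d} [f] k _.
Arguments rapidZ {R d} c [f] _.
Arguments rapid_tensor {R d} [A g f] x _ _.

(** * Contraction of some of the variables *)

Section Contraction.
Variables (R : realType) (d : nat).
Local Notation V := 'rV[R]_d.
Implicit Types (f g : V -> R) (x y z : V).
Let oT : open (setT : set V) := @open_setT R d.

(** The error of the difference quotient. Its seminorms are O(h), which allows
    differentiation under a distribution. *)
Definition diffq h k f y : R := h^-1 * (f (y + h *: delta_mx 0 k) - f y) - partial k f y.

Lemma rapid_diffq h k f : rapid f -> rapid (diffq h k f).
Proof.
move=> rf; apply: rapidB; last exact: rapid_partial.
by apply: rapidZ; apply: rapidB => //; exact: rapid_shift.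
Qed.

Lemma partial_diffq h k l f : rapid f -> partial l (diffq h k f) = diffq h k (partial l f).
Proof.
move=> rf; apply/funext => y.
have rs := rapid_shift (h *: delta_mx 0 k) rf.
have e1 : partial l (fun y => f (y + h *: delta_mx 0 k) - f y) y =
    partial l f (y + h *: delta_mx 0 k) - partial l f y.
  have := @deriveB _ _ _ (fun y => f (y + h *: delta_mx 0 k)) f y (delta_mx 0 l)
    (rapid_der y l rs) (rapid_der y l rf).
  by rewrite -!/(partial _ _ _) partial_shift.
have rd := rapidB rs rf.
have := @deriveB _ _ _ (fun y => h^-1 * (f (y + h *: delta_mx 0 k) - f y)) (partial k f) y (delta_mx 0 l)
  (rapid_der y l (rapidZ h^-1 rd)) (rapid_der y l (rapid_partial k rf)).
rewrite -!/(partial _ _ _) => e2.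
transitivity (partial l (fun y => h^-1 * (f (y + h *: delta_mx 0 k) - f y)) y - partial l (partial k f) y).
  exact: e2.
rewrite (partialZ _ (rapid_der y l rd)) e1 /diffq.
have E := congr1 (fun F => F y) (@partialC R d f l k (rapid_smooth rf)); cbv beta in E.
rewrite E.
reflexivity.
Qed.

Lemma diffq_bound0 h k f y M N : rapid f -> h != 0 -> `|h| <= 1 ->
  (forall x, wt x ^+ N * jet 2 f x <= M) ->
  wt y ^+ N * `|diffq h k f y| <= 4 ^+ N * `|h| * M.
Proof.
move=> rf h0 h1 HM; rewrite /diffq; set e := delta_mx 0 k.
have [s1 s1b E1] := smooth_mvt y h rf.1 (erefl e).
have [s2 s2b E2] := smooth_mvt y (s1 * h) (@smooth_partial _ _ _ f k rf.1) (erefl e).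
rewrite E1 mulrA mulVf // mul1r E2; set t := s2 * _; set D := partial k _ _.
have s1n : `|s1| <= 1 by case/andP: s1b => a b; rewrite ger0_norm.
have s2n : `|s2| <= 1 by case/andP: s2b => a b; rewrite ger0_norm.
have tn : `|t| <= 1.
  by rewrite /t !normrM mulr_ile1 // ?normr_ge0 ?mulr_ge0 // mulr_ile1.
have w4 : wt y ^+ N <= 4 ^+ N * wt (y + t *: e) ^+ N.
  rewrite -exprMn; apply: lerXn2r; rewrite ?nnegrE ?mulr_ge0 ?(ltW (wt_gt0 _)) //.
  apply: le_trans (wt_shift y (t *: e)) _; rewrite ler_wpM2r ?(ltW (wt_gt0 _)) //.
  rewrite /wt (bigD1 k) //= big1 ?addr0; last first.
    by move=> j /negbTE jk; rewrite !mxE jk andbF mulr0 expr0n.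
  rewrite !mxE !eqxx mulr1 -real_normK ?num_real //.
  have : `|t| ^+ 2 <= 1 by rewrite exprn_ile1.
  move: (`|t| ^+ 2) => u; lra.
have Dj : `|D| <= jet 2 f (y + t *: e).
  apply: le_trans (jet_partial 1 f k _); exact: (jet_partial 0).
rewrite !normrM -[_ * _ * `|D|]mulrA.
apply: le_trans (_ : 4 ^+ N * wt (y + t *: e) ^+ N * (1 * (`|h| * jet 2 f (y + t *: e))) <= _).
  apply: ler_pM w4 _; rewrite ?wtX_ge0 ?mulr_ge0 //.
  by apply: ler_pM => //; rewrite ?mulr_ge0 // ler_wpM2l.
rewrite [X in X <= _](_ : _ = 4 ^+ N * `|h| * (wt (y + t *: e) ^+ N * jet 2 f (y + t *: e))); last by ring.
by rewrite ler_wpM2l ?mulr_ge0 // exprn_ge0.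
Qed.

Lemma diffq_bound h k n f y M N : rapid f -> h != 0 -> `|h| <= 1 ->
  (forall x, wt x ^+ N * jet (n + 2) f x <= M) ->
  wt y ^+ N * jet n (diffq h k f) y <= (1 + d%:R) ^+ n * (4 ^+ N * `|h| * M).
Proof.
move=> rf h0 h1; elim: n f rf => [|n IH] f rf HM.
  by rewrite expr0 mul1r; exact: diffq_bound0.
rewrite /= exprS mulrDr -mulrA mulrDl mul1r; apply: lerD.
  apply: IH => // x; apply: le_trans (HM x); rewrite ler_wpM2l ?wtX_ge0 //.
  by rewrite addSn; exact: jetS.
rewrite mulr_sumr; apply: le_trans (_ : \sum_(k < d) (1 + d%:R) ^+ n * (4 ^+ N * `|h| * M) <= _).
  apply: ler_sum => l _; rewrite partial_diffq //; apply: IH; first exact: rapid_partial.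
  move=> x; apply: le_trans (HM x); rewrite ler_wpM2l ?wtX_ge0 //.
  by rewrite addSn; exact: jet_partial.
by rewrite sumr_const card_ord mulr_natl.
Qed.

Variables (A : pred 'I_d) (T : (V -> R) -> R) (g : V -> R).
Hypotheses (dT : tdist T) (rg : rapidA A g).

(** T is tested with g in the variables in A and with f in the others; the variables
    of f in A stay free. *)
Definition contract f x : R := T (fun z => g z * f (glue A x z)).

Lemma contract0 : contract (fun=> 0) = fun=> 0.
Proof. by apply/funext => x; rewrite /contract; under eq_fun do rewrite mulr0; exact: tdist0. Qed.

Lemma contract_bound : exists n N C, 0 <= C /\ forall f, rapid f -> forall K M,
  (forall y, wt y ^+ (N + K) * jet n f y <= M) ->
  forall x, wtA A x ^+ K * `|contract f x| <= C * M.
Proof.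
have [n [N [C [C0 HC]]]] := dT.2; have [sg _ bg] := rg; have [M0 HM0] := bg n N.
have M00 : 0 <= M0 by rewrite (le_trans _ (HM0 0)) // mulr_ge0 ?wtAX_ge0 ?jet_ge0.
exists n, N, (C * M0); split; first exact: mulr_ge0.
move=> f rf K M HM x; have w0 : 0 < wtA A x ^+ K by rewrite exprn_gt0 // (lt_le_trans ltr01) // wtA_ge1.
have : `|contract f x| <= C * (M0 * M / wtA A x ^+ K).
  apply: HC; first exact: rapid_tensor.
  move=> z; rewrite ler_pdivlMr // mulrC.
  apply: le_trans (tensor_bound A n N K x z sg rf.1) _.
  by apply: ler_pM; rewrite ?mulr_ge0 ?wtAX_ge0 ?wtX_ge0 ?jet_ge0.
by rewrite !mulrA ler_pdivlMr // mulrC.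
Qed.

Lemma glue_move h k x z : glue A (h *: delta_mx 0 k + x) z =
  (if A k then h *: delta_mx 0 k else 0) + glue A x z.
Proof.
apply/rowP => j; rewrite glueE [RHS]mxE glueE; case Ak: (A k); rewrite ?mxE ?add0r.
  case Aj : (A j) => //; case: (eqVneq j k) => [jk|_]; first by rewrite jk Ak in Aj.
  by rewrite andbF mulr0 add0r.
case Aj : (A j) => //; case: (eqVneq j k) => [jk|_]; first by rewrite -jk Aj in Ak.
by rewrite andbF mulr0 add0r.
Qed.

(** A distribution is continuous and the difference quotients of f converge in
    every seminorm, so the derivative passes under T. *)
Lemma contract_derive f x k : rapid f ->
  is_derive x (delta_mx 0 k) (contract f) (if A k then contract (partial k f) x else 0).
Proof.
move=> rf; set e := delta_mx 0 k.
have E : (fun h : R => h^-1 *: ((contract f \o shift x) (h *: e) - contract f x)) @ 0^' -->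
    (if A k then contract (partial k f) x else 0).
  case Ak: (A k); last first.
    have -> : (fun h : R => h^-1 *: ((contract f \o shift x) (h *: e) - contract f x)) = fun=> 0.
      apply/funext => h /=; rewrite /contract; under eq_fun do rewrite glue_move Ak add0r.
      by rewrite subrr scaler0.
    exact: cvg_cst.
  have [n [N [C [C0 HC]]]] := contract_bound.
  have [M HM] := rf.2 (n + 2)%N (N + 0)%N.
  have M0 : 0 <= M by rewrite (le_trans _ (HM 0)) // mulr_ge0 ?wtX_ge0 ?jet_ge0.
  pose L := C * ((1 + d%:R) ^+ n * (4 ^+ (N + 0) * M)).
  have L0 : 0 <= L by rewrite !mulr_ge0 // exprn_ge0 // addr_ge0.
  apply/cvgrPdist_le => eps eps0; near=> h.
  have h0 : h != 0 by near: h; exact: nbhs_dnbhs_neq.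
  have h1 : `|h| <= 1 by apply: ltW; near: h; exact: dnbhs0_lt.
  have hL : `|h| <= eps / (L + 1).
    by apply: ltW; near: h; apply: dnbhs0_lt; rewrite divr_gt0 // ltr_wpDl.
  have rA := rapid_tensor x rg rf.
  have rB := rapid_tensor x rg (rapid_shift (h *: e) rf).
  have rC := rapid_tensor x rg (rapid_partial k rf).
  have -> : contract (partial k f) x - h^-1 *: ((contract f \o shift x) (h *: e) - contract f x)
      = - contract (diffq h k f) x.
    rewrite /contract /= -[_ *: _]/(_ * _).
    under [X in _ * (T X - _)]eq_fun do rewrite glue_move Ak addrC.
    rewrite -(tdistB dT rB rA) -(tdistZ _ dT) ?opprB; last exact: rapidB.
    rewrite -opprB -(tdistB dT); [|by apply: rapidZ; exact: rapidB|by []].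
    congr (- T _); apply/funext => z; rewrite /diffq; ring.
  have := HC _ (rapid_diffq h k rf) 0%N ((1 + d%:R) ^+ n * (4 ^+ (N + 0) * `|h| * M)) _ x.
  rewrite expr0 mul1r normrN => /(_ _)/le_trans; apply.
    by move=> y; exact: diffq_bound.
  rewrite [X in X <= _](_ : _ = L * `|h|); last by rewrite /L; ring.
  have L1 : 0 < L + 1 by rewrite ltr_wpDl.
  rewrite ler_pdivlMr // in hL; apply: le_trans hL.
  by rewrite mulrDr mulr1 mulrC lerDl.
split; first by apply/cvg_ex; exists (if A k then contract (partial k f) x else 0).
by rewrite /derive; apply: cvg_lim.
Unshelve. all: by end_near. Qed.

Lemma contract_partial f k : rapid f -> exists2 f', rapid f' &
  partial k (contract f) = contract f' /\ (forall n y, jet n f' y <= jet n.+1 f y).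
Proof.
move=> rf; case Ak : (A k).
  exists (partial k f); first exact: rapid_partial.
  split; last by move=> n y; exact: jet_partial.
  by apply/funext => x; case: (contract_derive x k rf); rewrite Ak.
exists (fun=> 0); first exact: rapid0.
split; last by move=> n y; rewrite jet_cst normr0 jet_ge0.
by apply/funext => x; rewrite contract0; case: (contract_derive x k rf); rewrite Ak.
Qed.

Lemma contract_smooth f : rapid f -> smooth_on setT (contract f).
Proof.
move=> rf; apply: (@smooth_bounded _ _ [set h | exists2 f, rapid f & h = contract f]); last by exists f.
- by move=> h [f' rf' ->] x k; case: (contract_derive x k rf').
- move=> h [f' rf' ->]; have [n [N [C [C0 HC]]]] := contract_bound.
  have [M HM] := rf'.2 n (N + 0)%N; exists (C * M) => x.
  by have := HC f' rf' 0%N M HM x; rewrite expr0 mul1r.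
- by move=> h k [f' rf' ->]; have [f'' rf'' [E _]] := contract_partial k rf'; exists f''.
Qed.

(** Each derivative of the contraction is the contraction of a derivative, so the
    bound of order 0 gives all of them, with the same loss n and N. *)
Lemma contract_jet_bound : exists n N C, 0 <= C /\ forall m f, rapid f -> forall K M,
  (forall y, wt y ^+ (N + K) * jet (n + m) f y <= M) ->
  forall x, wtA A x ^+ K * jet m (contract f) x <= (1 + d%:R) ^+ m * (C * M).
Proof.
have [n [N [C [C0 HC]]]] := contract_bound; exists n, N, C; split=> //.
elim=> [|m IH] f rf K M HM x.
  by rewrite expr0 mul1r; apply: HC => // y; have := HM y; rewrite addn0.
have Hle (f' : V -> R) : (forall i y, jet i f' y <= jet i.+1 f y) ->
    forall y, wt y ^+ (N + K) * jet (n + m) f' y <= M.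
  move=> Hf' y; apply: le_trans (HM y); rewrite ler_wpM2l ?wtX_ge0 // addnS; exact: Hf'.
rewrite /= exprS mulrDr -mulrA mulrDl mul1r; apply: lerD.
  by apply: IH => //; apply: Hle => i y; exact: jetS.
rewrite mulr_sumr; apply: le_trans (_ : \sum_(k < d) (1 + d%:R) ^+ m * (C * M) <= _).
  apply: ler_sum => k _; have [f' rf' [-> Hf']] := contract_partial k rf.
  by apply: IH => //; exact: Hle.
by rewrite sumr_const card_ord mulr_natl.
Qed.

End Contraction.

(** * Density of products of functions of separate variables *)

Section Density.
Variables (R : realType) (d : nat).
Local Notation V := 'rV[R]_d.
Implicit Types (f g : V -> R) (x y z : V).
Let oT : open (setT : set V) := @open_setT R d.

Section OneCoordinate.
Variable k : 'I_d.

Definition setc (t : R) x : V := glue (pred1 k) (t *: delta_mx 0 k) x.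

Lemma setcE t x j : setc t x 0 j = if j == k then t else x 0 j.
Proof.
rewrite /setc glueE /=; case: eqVneq => [->|//]; by rewrite !mxE !eqxx mulr1.
Qed.

Lemma setc_id x : setc (x 0 k) x = x.
Proof. by apply/rowP => j; rewrite setcE; case: eqVneq => [->|]. Qed.

Lemma setc_setc s t x : setc s (setc t x) = setc s x.
Proof. by apply/rowP => j; rewrite !setcE; case: eqVneq. Qed.

Lemma setc_line t s x : setc t x + s *: delta_mx 0 k = setc (t + s) x.
Proof.
apply/rowP => j; rewrite mxE !setcE !mxE eqxx /=; case: eqVneq => _.
  by rewrite mulr1.
by rewrite mulr0 addr0.
Qed.

Lemma partial_setc t f l : smooth_on setT f -> partial l (fun x => f (setc t x)) =
  if l == k then fun=> 0 else fun x => partial l f (setc t x).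
Proof.
move=> sf; rewrite [LHS](@partial_csub _ _ _ (t *: delta_mx 0 k) _ (@glue_inj _ (pred1 k)) f l) /=.
case: pickP => [j /=|nj].
  by case: (eqVneq j k) => // jk /eqP[jl]; rewrite -jl (negbTE jk).
have := nj l => /=; case: (eqVneq l k) => //; by rewrite eqxx.
Qed.

Definition dk i f := iter i (partial k) f.

Lemma smooth_dk i f : smooth_on setT f -> smooth_on setT (dk i f).
Proof. by move=> sf; elim: i => [//|i IH]; exact: smooth_partial. Qed.

Lemma dkS i f : dk i (partial k f) = dk i.+1 f.
Proof. by rewrite /dk -iterSr. Qed.

Lemma rapid_dk i f : rapid f -> rapid (dk i f).
Proof. by move=> rf; elim: i => //= i IH; exact: rapid_partial. Qed.

Lemma partial_dk i l f : smooth_on setT f -> partial l (dk i f) = dk i (partial l f).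
Proof.
move=> sf; elim: i => //= i IH; rewrite -IH.
exact: (@partialC R d (dk i f) l k (smooth_dk i sf)).
Qed.

Lemma jet_dk n i f x : jet n (dk i f) x <= jet (n + i) f x.
Proof.
elim: i n => [|i IH] n; first by rewrite addn0.
by apply: le_trans (jet_partial n (dk i f) k x) _; rewrite addnS -addSn.
Qed.

Definition monom c i x : R := (x 0 k - c) ^+ i / i`!%:R.

(** Taylor expansion at x 0 k = c in the k-th variable alone: each term is a
    function of that variable times a function of the others. *)
Definition taylor m c f x : R := \sum_(i < m) monom c i x * dk i f (setc c x).

Definition remainder m c f x : R := f x - taylor m c f x.

Lemma pf_monom c i : pf (monom c i).
Proof.
apply: pf_mul; last exact: pf_cst.
by apply: pf_exp; apply: pf_add; [exact: pf_coord|exact: pf_cst].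
Qed.

Lemma partial_monom c i l x : partial l (monom c i.+1) x = if l == k then monom c i x else 0.
Proof.
have dc : is_derive x (delta_mx 0 l) (fun y : V => y 0 k - c) (l == k)%:R.
  have d1 := derivable_coord k x (delta_mx 0 l).
  have d2 := is_deriveB d1 (is_derive_cst c x (delta_mx 0 l)).
  by apply: is_derive_eq; rewrite subr0 !mxE eqxx eq_sym.
have E : partial l (monom c i.+1) x =
    i.+1%:R * (x 0 k - c) ^+ i * (l == k)%:R / i.+1`!%:R.
  have -> : monom c i.+1 = fun y => (i.+1`!%:R)^-1 * (y 0 k - c) ^+ i.+1.
    by apply/funext => y; rewrite /monom mulrC.
  have dX : is_derive x (delta_mx 0 l) (fun y : V => (y 0 k - c) ^+ i.+1)
      (i.+1%:R * (x 0 k - c) ^+ i * (l == k)%:R).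
    elim: i => [|i IH].
      have -> : (fun y : V => (y 0 k - c) ^+ 1) = (fun y => y 0 k - c) by apply/funext.
      by rewrite expr0 mul1r mul1r.
    have -> : (fun y : V => (y 0 k - c) ^+ i.+2) = (fun y => (y 0 k - c) * (y 0 k - c) ^+ i.+1).
      by apply/funext => y; rewrite exprS.
    have := is_deriveM dc IH; rewrite -![_ *: _]/(_ * _) => H.
    have -> : i.+2%:R * (x 0 k - c) ^+ i.+1 * (l == k)%:R = (x 0 k - c) *
       (i.+1%:R * (x 0 k - c) ^+ i * (l == k)%:R) + (x 0 k - c) ^+ i.+1 * (l == k)%:R.
      rewrite -natr1 exprS; ring.
    exact: H.
  rewrite partialZ; last by case: dX.
  by rewrite mulrC; congr (_ * _); case: dX.
rewrite E; case: (l == k); last by rewrite mulr0 mul0r.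
rewrite mulr1 /monom factS natrM; field.
by rewrite [1 + _]addrC natr1 !pnatr_eq0 -lt0n fact_gt0.
Qed.

Lemma smooth_setc c f : smooth_on setT f -> smooth_on setT (fun x => f (setc c x)).
Proof. exact: smooth_glue. Qed.

Lemma smooth_taylor_term c i f : smooth_on setT f ->
  smooth_on setT (fun x => monom c i x * dk i f (setc c x)).
Proof.
move=> sf; apply: (smoothM oT); first exact: (pf_smooth oT (pf_monom c i)).
by apply: smooth_setc; exact: smooth_dk.
Qed.

Lemma taylorS m c f : taylor m.+1 c f = fun x => taylor m c f x + monom c m x * dk m f (setc c x).
Proof. by apply/funext => x; rewrite /taylor big_ord_recr. Qed.

Lemma smooth_taylor m c f : smooth_on setT f -> smooth_on setT (taylor m c f).
Proof.
move=> sf; elim: m => [|m IH].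
  have -> : taylor 0 c f = fun=> 0 by apply/funext => x; rewrite /taylor big_ord0.
  exact: (smooth_cst 0 oT).
by rewrite taylorS; exact: (smoothD oT IH (smooth_taylor_term c m sf)).
Qed.

Lemma partial_taylor_term i c f l x : smooth_on setT f ->
  partial l (fun x => monom c i x * dk i f (setc c x)) x =
  if l == k then (if i is j.+1 then monom c j x * dk j (partial k f) (setc c x) else 0)
  else monom c i x * dk i (partial l f) (setc c x).
Proof.
move=> sf; have sd := smooth_dk i sf.
have D1 : derivable (monom c i) x (delta_mx 0 l) by exact: pf_der (pf_monom c i) _ _.
have D2 : derivable (fun x => dk i f (setc c x)) x (delta_mx 0 l).
  exact: (@smooth_der _ _ setT _ x l (smooth_setc c sd) I).
rewrite (partialM D1 D2) partial_setc //; case: (eqVneq l k) => [->|lk].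
  rewrite mulr0 add0r; case: i {sd D1 D2} => [|i].
    have -> : monom c 0 = fun=> 1 by apply/funext => y; rewrite /monom expr0 fact0 divr1.
    by rewrite partial_cst mul0r.
  by rewrite partial_monom eqxx dkS.
rewrite partial_dk //; case: i {sd D1 D2} => [|i].
  have -> : monom c 0 = fun=> 1 by apply/funext => y; rewrite /monom expr0 fact0 divr1.
  by rewrite partial_cst mul0r addr0.
by rewrite partial_monom (negbTE lk) mul0r addr0.
Qed.

Lemma partial_taylor m c f l x : smooth_on setT f ->
  partial l (taylor m c f) x = if l == k then taylor m.-1 c (partial k f) x else taylor m c (partial l f) x.
Proof.
move=> sf; elim: m => [|m IH].
  have E (f' : V -> R) : taylor 0 c f' = fun=> 0 by apply/funext => y; rewrite /taylor big_ord0.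
  by rewrite !E partial_cst; case: (l == k).
rewrite taylorS partialD; first last.
- exact: (@smooth_der _ _ setT _ x l (smooth_taylor_term c m sf) I).
- exact: (@smooth_der _ _ setT _ x l (smooth_taylor m c sf) I).
rewrite IH partial_taylor_term //; case: (eqVneq l k) => [lk|lk] /=; last by rewrite [in RHS]taylorS.
case: m {IH} => [|m] /=; first by rewrite addr0.
by rewrite [in RHS]taylorS.
Qed.

Lemma partial_remainder m c f l : smooth_on setT f ->
  partial l (remainder m c f) = if l == k then remainder m.-1 c (partial k f) else remainder m c (partial l f).
Proof.
move=> sf; apply/funext => x.
have := @deriveB _ _ _ f (taylor m c f) x (delta_mx 0 l)
  (@smooth_der _ _ setT f x l sf I) (@smooth_der _ _ setT _ x l (smooth_taylor m c sf) I).
rewrite -!/(partial _ _ _) (partial_taylor m c l x sf) => E.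
transitivity (partial l f x - (if l == k then taylor m.-1 c (partial k f) x else taylor m c (partial l f) x)).
  exact: E.
by rewrite /remainder; case: eqVneq => [->|].
Qed.

Lemma smooth_remainder m c f : smooth_on setT f -> smooth_on setT (remainder m c f).
Proof. by move=> sf; exact: (smoothB oT sf (smooth_taylor m c sf)). Qed.

Lemma remainder_at m c f x : (0 < m)%N -> remainder m c f (setc c x) = 0.
Proof.
case: m => // m _; rewrite /remainder /taylor big_ord_recl /= big1 ?addr0.
  by rewrite /monom expr0 fact0 divr1 mul1r setc_setc subrr.
by move=> i _; rewrite /monom /= setcE eqxx subrr expr0n mul0r mul0r.
Qed.

(** Induction on m by the mean value theorem, since the derivative of a remainder
    is the remainder of the derivative. *)
Lemma remainder_bound0 m c f x de K : smooth_on setT f -> 0 <= de ->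
  (forall t, `|t - c| <= de -> `|dk m f (setc t x)| <= K) ->
  forall t, `|t - c| <= de -> `|remainder m c f (setc t x)| <= de ^+ m * K.
Proof.
move=> sf de0; elim: m f sf => [|m IH] f sf HK t tc.
  by rewrite expr0 mul1r /remainder /taylor big_ord0 subr0; exact: HK.
have [s s01 E] := smooth_mvt (setc c x) (t - c) (smooth_remainder m.+1 c sf) (erefl (delta_mx 0 k)).
rewrite !setc_line [c + (t - c)]addrC subrK remainder_at // subr0 in E.
rewrite E normrM exprS -mulrA.
apply: ler_pM => //; rewrite partial_remainder // eqxx /=.
apply: IH; first exact: smooth_partial.
  by move=> u uc; rewrite dkS; exact: HK.
rewrite addrC addKr normrM; apply: le_trans tc; case/andP: s01 => s0 s1.
by rewrite (ger0_norm s0) ler_piMl.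
Qed.

Lemma wt_setc s t x : `|s - t| <= 1 -> wt (setc s x) <= 4 * wt (setc t x).
Proof.
move=> st; have := wt_shift (setc s x) ((t - s) *: delta_mx 0 k).
rewrite setc_line [s + _]addrC subrK => /le_trans; apply; rewrite ler_wpM2r ?(ltW (wt_gt0 _)) //.
rewrite /wt (bigD1 k) //= big1 ?addr0; last first.
  by move=> j /negbTE jk; rewrite !mxE jk andbF mulr0 expr0n.
rewrite !mxE !eqxx mulr1 -real_normK ?num_real // distrC.
have : `|s - t| ^+ 2 <= 1 by rewrite exprn_ile1.
move: (`|s - t| ^+ 2) => u; lra.
Qed.

(** A derivative in the k-th variable lowers the order of the remainder by one, so
    n derivatives leave a factor de ^+ (m - n). *)
Lemma remainder_jet_bound n N f M m c x de : smooth_on setT f -> 0 <= de -> de + de <= 1 ->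
  `|x 0 k - c| <= de -> (n <= m)%N ->
  (forall y, wt y ^+ N * jet (m + n) f y <= M) ->
  wt x ^+ N * jet n (remainder m c f) x <= (1 + d%:R) ^+ n * (4 ^+ N * de ^+ (m - n) * M).
Proof.
move=> sf de0 de2 xc; have de1 : de <= 1 by apply: le_trans de2; rewrite lerDl.
elim: n m f sf => [|n IH] m f sf nm HM.
  rewrite expr0 mul1r subn0 /=.
  have w0 : 0 < wt x ^+ N by rewrite exprn_gt0 // wt_gt0.
  have := @remainder_bound0 m c f x de (4 ^+ N * M / wt x ^+ N) sf de0 _ (x 0 k) xc.
  rewrite setc_id => /(_ _)/le_trans H; rewrite mulrC -ler_pdivlMr //; apply: H.
    move=> t tc; rewrite ler_pdivlMr // mulrC.
    apply: le_trans (_ : 4 ^+ N * (wt (setc t x) ^+ N * jet (m + 0) f (setc t x)) <= _); last first.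
      by rewrite ler_wpM2l // exprn_ge0.
    rewrite mulrA -exprMn; apply: ler_pM; rewrite ?wtX_ge0 //.
      apply: lerXn2r; rewrite ?nnegrE ?mulr_ge0 ?(ltW (wt_gt0 _)) //.
      rewrite -{1}[x]setc_id; apply: wt_setc.
      have -> : x 0 k - t = (x 0 k - c) - (t - c) by ring.
      exact: le_trans (ler_normB _ _) (le_trans (lerD xc tc) de2).
    by apply: le_trans (jet_norm 0 _ _) _; rewrite addn0; exact: (jet_dk 0 m).
  by rewrite !mulrA [de ^+ m * _]mulrC.
have nm' : (n <= m)%N by exact: ltnW.
have pM : (n <= m.-1)%N by case: m nm {HM nm'}.
have e1 : de ^+ (m - n) <= de ^+ (m - n.+1).
  by apply: ler_wiXn2l => //; exact: leq_sub2l.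
have M0 : 0 <= M by apply: le_trans (HM 0); rewrite mulr_ge0 ?wtX_ge0 ?jet_ge0.
have up u : u <= (1 + d%:R) ^+ n * (4 ^+ N * de ^+ (m - n) * M) ->
    u <= (1 + d%:R) ^+ n * (4 ^+ N * de ^+ (m - n.+1) * M).
  move=> /le_trans; apply; rewrite ler_wpM2l ?exprn_ge0 ?addr_ge0 // ler_wpM2r //.
  by rewrite ler_wpM2l ?exprn_ge0.
rewrite /= mulrDr exprS -mulrA mulrDl mul1r; apply: lerD.
  apply/up/IH => // y; apply: le_trans (HM y); rewrite ler_wpM2l ?wtX_ge0 //.
  by rewrite addnS; exact: jetS.
rewrite mulr_sumr; apply: le_trans (_ : \sum_(l < d) (1 + d%:R) ^+ n *
    (4 ^+ N * de ^+ (m - n.+1) * M) <= _); last by rewrite sumr_const card_ord mulr_natl.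
apply: ler_sum => l _; rewrite partial_remainder //; case: eqVneq => [_|lk].
  have -> : (m - n.+1 = m.-1 - n)%N by rewrite -subn1 subnAC subn1 subnS.
  apply: (IH _ _ (@smooth_partial _ _ setT f k sf) pM).
  move=> y; apply: le_trans (HM y); rewrite ler_wpM2l ?wtX_ge0 //.
  have -> : (m + n.+1 = (m.-1 + n).+1.+1)%N by case: m nm {HM nm' pM e1 up} => // m _; rewrite addSn addnS.
  by apply: le_trans (jet_partial _ _ _ _) _; exact: jetS.
apply/up/(IH _ _ (@smooth_partial _ _ setT f l sf) nm').
move=> y; apply: le_trans (HM y); rewrite ler_wpM2l ?wtX_ge0 // addnS; exact: jet_partial.
Qed.

Lemma wtA_pred1 x : wtA (pred1 k) x = 1 + x 0 k ^+ 2.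
Proof. by rewrite /wtA big_pred1_eq. Qed.

(** Where |x 0 k| is at most K the weight is bounded, so polynomial growth of the
    jets is enough. *)
Lemma rapid_compact g K : smooth_on setT g ->
  (forall x y, x 0 k = y 0 k -> g x = g y) ->
  (forall x, K < `|x 0 k| -> g x = 0) ->
  (forall n, exists C N, 0 <= C /\ forall x, jet n g x <= C * wtA (pred1 k) x ^+ N) ->
  rapidA (pred1 k) g.
Proof.
move=> sg dg g0 bg; split=> //.
  by move=> x y xy; apply: dg; apply: xy => /=.
move=> n N; have [C [N' [C0 HC]]] := bg n.
exists (C * (1 + (`|K|) ^+ 2) ^+ (N + N')) => x.
have [xK|Kx] := leP `|x 0 k| `|K|; last first.
  rewrite (@jet0_near _ _ [set y | `|K| < `|y 0 k|] g n x) ?mulr0.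
  - by rewrite mulr_ge0 // exprn_ge0 // addr_ge0 // exprn_ge0.
  - have pc : forall y : V, {for y, continuous (fun y => `|y 0 k|)}.
      by move=> y; apply/continuous_coordP => e e0; exists e => // z zy; apply: le_lt_trans (ler_dist_dist _ _) (zy k).
    by apply: (@open_comp _ _ (fun y : V => `|y 0 k|) [set t | `|K| < t]) => [y _|]; [exact: pc|exact: open_gt].
  - exact: Kx.
  - by move=> y /= Ky; apply: g0; apply: le_lt_trans Ky; exact: ler_norm.
apply: le_trans (_ : wtA (pred1 k) x ^+ N * (C * wtA (pred1 k) x ^+ N') <= _).
  by rewrite ler_wpM2l // wtAX_ge0.
rewrite mulrCA -exprD ler_wpM2l //; apply: lerXn2r; rewrite ?nnegrE.
- by rewrite (le_trans ler01) // wtA_ge1.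
- by rewrite addr_ge0 // exprn_ge0.
- rewrite wtA_pred1 lerD2l -real_normK ?num_real //; apply: lerXn2r; rewrite ?nnegrE //.
Qed.

Variable p : nat -> R -> R.
Hypotheses (sp : smooth1 p) (p_lt0 : forall n t, t < 0 -> p n t = 0)
  (p_gt1 : forall t, 1 < t -> p 0%N t = 1)
  (p_bd : forall n, exists B, forall t, `|p n t| <= B).

Definition stair (J : nat) (c : R) (x : V) : R := p 0 (J%:R * (x 0 k - c)).

Lemma smooth1_scale (J c : R) : smooth1 (fun n t => J ^+ n * p n (J * (t - c))).
Proof.
move=> n t.
have d1 : is_derive t 1 (fun t => J * (t - c)) J.
  have d0 := is_deriveB (is_derive_id t (1 : R)) (is_derive_cst c t 1).
  have := is_deriveM (is_derive_cst J t 1) d0; rewrite -![_ *: _]/(_ * _) => H.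
  by apply: is_derive_eq; rewrite subr0 mulr1 mulr0 addr0.
have d2 := @is_derive1_comp _ (p n) (fun t => J * (t - c)) t _ _ (sp n (J * (t - c))) d1.
have := is_deriveM (is_derive_cst (J ^+ n) t 1) d2; rewrite -![_ *: _]/(_ * _) => H.
by apply: is_derive_eq; rewrite mulr0 addr0 exprS /cst /=; ring.
Qed.

Lemma stairE J c : stair J c = fun x => (fun n t => J%:R ^+ n * p n (J%:R * (t - c))) 0%N (x 0 k).
Proof. by apply/funext => x; rewrite /stair expr0 mul1r. Qed.

Lemma smooth_stair J c : smooth_on setT (stair J c).
Proof.
rewrite stairE; apply: (smooth_comp1 oT (smooth1_scale J%:R c)).
exact: (pf_smooth oT (pf_coord R k)).
Qed.

Lemma stair_jet n : exists B, 0 <= B /\ forall J c x, (0 < J)%N ->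
  jet n (stair J c) x <= J%:R ^+ n * B * wtA (pred1 k) x ^+ n.
Proof.
have /choice[B HB] := p_bd; pose B' := \sum_(i < n.+1) `|B i|.
have B0 : 0 <= B' by apply: sumr_ge0.
exists (B' * (2 + n%:R) ^+ n); split; first by rewrite mulr_ge0 // exprn_ge0 // addr_ge0.
move=> J c x J0; rewrite stairE.
have J1 : 1 <= J%:R :> R by rewrite ler1n.
apply: le_trans (@jet_comp1 _ _ setT _ _ n 0 x (J%:R ^+ n * B') oT (smooth1_scale J%:R c)
   (pf_smooth oT (pf_coord R k)) I _) _.
  move=> i lei; rewrite add0n normrM ger0_norm ?exprn_ge0 //; apply: ler_pM; rewrite ?exprn_ge0 //.
    by rewrite ler_weXn2l.
  apply: le_trans (HB _ _) _; rewrite /B' (bigD1 (Ordinal (lei : (i < n.+1)%N))) //=.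
  by rewrite ler_wpDr ?ler_norm // sumr_ge0.
rewrite -!mulrA ler_wpM2l ?exprn_ge0 // ler_wpM2l // -exprMn; apply: lerXn2r.
- by rewrite nnegrE addr_ge0 ?jet_ge0.
- by rewrite nnegrE; apply: mulr_ge0; [exact: addr_ge0|exact: le_trans ler01 (wtA_ge1 _ _)].
rewrite jet_coord wtA_pred1 -real_normK ?num_real //.
move: `|x 0 k| (normr_ge0 (x 0 k)) (n%:R) (ler0n R n) => u u0 v v0.
have := sqr_ge0 (u - 1); nra.
Qed.

(** The difference of two steps at distance 1 / J. These bumps telescope to a step,
    and no partition of unity needs to be normalized. *)
Definition bumpf J c x := stair J c x - stair J (c + J%:R^-1) x.

Lemma smooth_bumpf J c : smooth_on setT (bumpf J c).
Proof. exact: (smoothB oT (smooth_stair J c) (smooth_stair J _)). Qed.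

Lemma bumpf_supp J c x : (0 < J)%N -> 2 / J%:R < `|x 0 k - c| -> bumpf J c x = 0.
Proof.
move=> J0; have Jp : 0 < J%:R :> R by rewrite ltr0n.
have E : J%:R * (x 0 k - (c + J%:R^-1)) = J%:R * (x 0 k - c) - 1.
  by rewrite opprD addrA mulrBr [J%:R / _]mulfV // gt_eqF.
rewrite ltr_pdivrMr // /bumpf /stair E {E}.
rewrite -[X in _ * X](ger0_norm (ltW Jp)) -normrM mulrC; set t := J%:R * _.
have [t0|t0] := leP 0 t.
  rewrite (ger0_norm t0) => t2.
  by rewrite !p_gt1 ?subrr // ?ltrBrDr // (lt_trans _ t2) // ltr1n.
rewrite (ltr0_norm t0) => t2; rewrite !p_lt0 ?subrr //.
by rewrite subr_lt0 (lt_trans t0).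
Qed.

Lemma bumpf_jet n : exists B, 0 <= B /\ forall J c x, (0 < J)%N ->
  jet n (bumpf J c) x <= J%:R ^+ n * B * wtA (pred1 k) x ^+ n.
Proof.
have [B [B0 HB]] := stair_jet n; exists (B + B); split; first exact: addr_ge0.
move=> J c x J0; have sN := smoothZ (-1) oT (smooth_stair J (c + J%:R^-1)).
have -> : bumpf J c = fun x => stair J c x + -1 * stair J (c + J%:R^-1) x.
  by apply/funext => y; rewrite mulN1r.
apply: le_trans (jetD n oT (smooth_stair J c) sN I) _.
rewrite (jetZ _ _ oT (smooth_stair J _) I) normrN1 mul1r mulrDr mulrDl.
by apply: lerD; exact: HB.
Qed.

Lemma jet_bumpf0 n J c x : (0 < J)%N -> 2 / J%:R < `|x 0 k - c| -> jet n (bumpf J c) x = 0.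
Proof.
move=> J0 xc; apply: (@jet0_near _ _ [set y : V | 2 / J%:R < `|y 0 k - c|]) => //.
  have pc : forall y : V, {for y, continuous (fun y => `|y 0 k - c|)}.
    move=> y; apply/continuous_coordP => e e0; exists e => // z zy.
    apply: le_lt_trans (ler_dist_dist _ _) _; rewrite opprB addrA subrK; exact: zy.
  by apply: (@open_comp _ _ (fun y : V => `|y 0 k - c|) [set t | 2 / J%:R < t]) => [y _|]; [exact: pc|exact: open_gt].
by move=> y /=; exact: bumpf_supp.
Qed.

Lemma rapidA_bumpf_monom J c i : (0 < J)%N ->
  rapidA (pred1 k) (fun x => bumpf J c x * monom c i x).
Proof.
move=> J0; have sm := pf_smooth oT (pf_monom c i).
apply: (@rapid_compact _ (`|c| + 2 / J%:R)).
- exact: (smoothM oT (smooth_bumpf J c) sm).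
- by move=> x y xy; rewrite /bumpf /stair /monom xy.
- move=> x Kx; rewrite bumpf_supp ?mul0r //.
  rewrite -(ltrD2l `|c|); apply: lt_le_trans Kx _.
  by rewrite -{1}(subrK c (x 0 k)) addrC; exact: ler_normD.
- move=> n; have [B [B0 HB]] := bumpf_jet n.
  have [C [N [C0 HC]]] : exists C N, 0 <= C /\ forall x, jet n (monom c i) x <= C * wtA (pred1 k) x ^+ N.
    have H : exists C N, 0 <= C /\ forall x, jet n (fun x : V => (x 0 k - c) ^+ i) x <= C * wtA (pred1 k) x ^+ N.
      have pk : pf (fun x : V => x 0 k - c) by apply: pf_add; [exact: pf_coord|exact: pf_cst].
      elim: i {sm} => [|i [C [N [C0 HC]]]].
        exists 1, 0%N; split=> // x; under [X in jet n X]eq_fun do rewrite expr0.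
        by rewrite jet_cst normr1 expr0 mulr1.
      exists ((2 + n%:R + `|c|) * C), N.+1; split; first by rewrite mulr_ge0 // !addr_ge0.
      move=> x; under [X in jet n X]eq_fun do rewrite exprS.
      apply: le_trans (jetM n oT (pf_smooth oT pk) (pf_smooth oT (pf_exp i pk)) I) _.
      rewrite exprS mulrACA; apply: ler_pM; rewrite ?jet_ge0 //.
      have := jetD n oT (pf_smooth oT (pf_coord R k)) (smooth_cst (- c) oT) (I : setT x).
      move=> /le_trans; apply; rewrite jet_cst normrN jet_coord wtA_pred1 -real_normK ?num_real //.
      move: `|x 0 k| (normr_ge0 (x 0 k)) (n%:R) (ler0n R n) `|c| (normr_ge0 c) => u u0 v v0 w w0.
      have := sqr_ge0 (u - 1); nra.
    have [C [N [C0 HC]]] := H; exists (`|(i`!%:R)^-1| * C), N; split=> [|x]; first exact: mulr_ge0.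
    have -> : monom c i = fun x => (i`!%:R)^-1 * (x 0 k - c) ^+ i.
      by apply/funext => y; rewrite /monom mulrC.
    have pk : pf (fun x : V => (x 0 k - c) ^+ i).
      by apply: pf_exp; apply: pf_add; [exact: pf_coord|exact: pf_cst].
    by rewrite (jetZ _ _ oT (pf_smooth oT pk) I) -mulrA ler_wpM2l.
  exists (J%:R ^+ n * B * C), (n + N)%N; split; first by rewrite !mulr_ge0 // exprn_ge0.
  move=> x; apply: le_trans (jetM n oT (smooth_bumpf J c) sm I) _.
  by rewrite exprD mulrACA; apply: ler_pM; rewrite ?jet_ge0 // HB.
Qed.

Variable T : (V -> R) -> R.
Hypothesis dT : tdist T.
Hypothesis T_kill : forall g f x0, rapidA (pred1 k) g -> rapid f ->
  T (fun z => g z * f (glue (pred1 k) x0 z)) = 0.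

Lemma rapid_bumpfM J c f : (0 < J)%N -> rapid f -> rapid (fun x => bumpf J c x * f x).
Proof.
move=> J0 rf; apply: temperedM_rapid => //; split; first exact: smooth_bumpf.
move=> n; have [B [B0 HB]] := bumpf_jet n.
exists (J%:R ^+ n * B), n; split=> [|x]; first by rewrite mulr_ge0 // exprn_ge0.
apply: le_trans (HB J c x J0) _; rewrite ler_wpM2l ?mulr_ge0 ?exprn_ge0 //.
by apply: lerXn2r; rewrite ?nnegrE ?wtA_wt ?(le_trans ler01 (wtA_ge1 _ _)) ?(ltW (wt_gt0 _)).
Qed.

Lemma rapid_stairM J c f : (0 < J)%N -> rapid f -> rapid (fun x => stair J c x * f x).
Proof.
move=> J0 rf; apply: temperedM_rapid => //; split; first exact: smooth_stair.
move=> n; have [B [B0 HB]] := stair_jet n.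
exists (J%:R ^+ n * B), n; split=> [|x]; first by rewrite mulr_ge0 // exprn_ge0.
apply: le_trans (HB J c x J0) _; rewrite ler_wpM2l ?mulr_ge0 ?exprn_ge0 //.
by apply: lerXn2r; rewrite ?nnegrE ?wtA_wt ?(le_trans ler01 (wtA_ge1 _ _)) ?(ltW (wt_gt0 _)).
Qed.

(** Every Taylor term is a product of a function of the k-th variable and a function
    of the other ones, so T vanishes on it. *)
Lemma kill_taylor J c m f : (0 < J)%N -> rapid f ->
  rapid (fun x => bumpf J c x * taylor m c f x) /\ T (fun x => bumpf J c x * taylor m c f x) = 0.
Proof.
move=> J0 rf; elim: m => [|m [r0 T0]].
  have -> : (fun x => bumpf J c x * taylor 0 c f x) = fun=> 0.
    by apply/funext => x; rewrite /taylor big_ord0 mulr0.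
  by split; [exact: rapid0|exact: tdist0].
have -> : (fun x => bumpf J c x * taylor m.+1 c f x) = fun x => bumpf J c x * taylor m c f x +
   (bumpf J c x * monom c m x) * dk m f (glue (pred1 k) (c *: delta_mx 0 k) x).
  by apply/funext => x; rewrite taylorS mulrDr mulrA.
have rg := rapidA_bumpf_monom c m J0; have rd := rapid_dk m rf.
have rt := rapid_tensor (c *: delta_mx 0 k) rg rd.
split; first exact: rapidD.
by rewrite tdistD // T0 add0r; exact: T_kill.
Qed.

(** Only the Taylor remainder survives. Its jet of order n is O(J ^- (m - n)) on the
    bump, and the jet of the bump is O(J ^+ n): with m = 2 n + 3 this leaves J ^- 3. *)
Lemma kill_bump f : rapid f -> exists K, 0 <= K /\ forall J c, (3 < J)%N ->
  `|T (fun x => bumpf J c x * f x)| <= K / J%:R ^+ 3.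
Proof.
move=> rf; have [n [N [C [C0 HC]]]] := dT.2; have [B [B0 HB]] := bumpf_jet n.
pose m := (n + n + 3)%N; have [M HM] := rf.2 (m + n)%N (N + n)%N.
have M0 : 0 <= M by apply: le_trans (HM 0); rewrite mulr_ge0 ?wtX_ge0 ?jet_ge0.
pose K := C * (B * ((1 + d%:R) ^+ n * (4 ^+ (N + n) * 2 ^+ (m - n) * M))).
exists K; split; first by rewrite !mulr_ge0 ?exprn_ge0 ?addr_ge0.
move=> J c J3; have J0 : (0 < J)%N by apply: leq_trans J3.
have Jp : 0 < J%:R :> R by rewrite ltr0n.
have [rt Tt] := kill_taylor c m J0 rf; have rb := rapid_bumpfM c J0 rf.
have -> : T (fun x => bumpf J c x * f x) = T (fun x => bumpf J c x * remainder m c f x).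
  rewrite -[LHS]subr0 -Tt -tdistB //; congr T; apply/funext => x.
  by rewrite /remainder mulrBr.
have rR : rapid (fun x => bumpf J c x * remainder m c f x).
  have := rapidB rb rt; rewrite (_ : (fun x => _ - _) = (fun x => bumpf J c x * remainder m c f x)) //.
  by apply/funext => x; rewrite /remainder mulrBr.
rewrite /K -mulrA; apply: HC => // x.
have JX i : 0 < J%:R ^+ i :> R by rewrite exprn_gt0.
have [xc|xc] := ltP (2 / J%:R) `|x 0 k - c|.
  apply: le_trans (_ : wt x ^+ N * (jet n (bumpf J c) x * jet n (remainder m c f) x) <= _).
    by rewrite ler_wpM2l ?wtX_ge0 // (jetM n oT (smooth_bumpf J c) (smooth_remainder m c rf.1) I).
  by rewrite jet_bumpf0 // mul0r mulr0 !mulr_ge0 ?exprn_ge0 ?addr_ge0 ?invr_ge0.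
have de2 : 2 / J%:R + 2 / J%:R <= 1 :> R.
  rewrite -mulrDl ler_pdivrMr // mul1r -natrD ler_nat; exact: J3.
have de0 : 0 <= 2 / J%:R :> R by rewrite divr_ge0.
have nm : (n <= m)%N by rewrite /m -addnA leq_addr.
have Hr := remainder_jet_bound rf.1 de0 de2 xc nm HM.
apply: le_trans (_ : wt x ^+ N * ((J%:R ^+ n * B * wt x ^+ n) * jet n (remainder m c f) x) <= _).
  rewrite ler_wpM2l ?wtX_ge0 //.
  apply: le_trans (jetM n oT (smooth_bumpf J c) (smooth_remainder m c rf.1) I) _.
  rewrite ler_wpM2r ?jet_ge0 //; apply: le_trans (HB J c x J0) _.
  rewrite ler_wpM2l ?mulr_ge0 ?exprn_ge0 //.
  by apply: lerXn2r; rewrite ?nnegrE ?wtA_wt ?(le_trans ler01 (wtA_ge1 _ _)) ?(ltW (wt_gt0 _)).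
rewrite [X in X <= _](_ : _ = J%:R ^+ n * B * (wt x ^+ (N + n) * jet n (remainder m c f) x)); last first.
  by rewrite exprD; ring.
apply: le_trans (ler_wpM2l _ Hr) _; first by rewrite mulr_ge0 ?exprn_ge0.
rewrite expr_div_n (_ : (m - n = n + 3)%N); last by rewrite /m -addnA addKn.
rewrite le_eqVlt; apply/orP; left; apply/eqP; rewrite [in X in _ / X]exprD; field.
by rewrite !gt_eqF.
Qed.

Lemma kill_stairs f : rapid f -> exists K, 0 <= K /\ forall J i c, (3 < J)%N ->
  `|T (fun x => stair J c x * f x)| <= i%:R * (K / J%:R ^+ 3) +
    `|T (fun x => stair J (c + i%:R / J%:R) x * f x)|.
Proof.
move=> rf; have [K [K0 HK]] := kill_bump rf; exists K; split=> // J i c J3.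
have J0 : (0 < J)%N by apply: leq_trans J3.
elim: i c => [|i IH] c; first by rewrite !mul0r addr0 add0r.
have E : T (fun x => stair J c x * f x) = T (fun x => bumpf J c x * f x) +
    T (fun x => stair J (c + J%:R^-1) x * f x).
  rewrite -tdistD //; [|exact: rapid_bumpfM|exact: rapid_stairM].
  by congr T; apply/funext => x; rewrite -mulrDl /bumpf subrK.
rewrite E; apply: le_trans (ler_normD _ _) _.
rewrite -(natr1 i) [(i%:R + 1) * _]mulrDl mul1r -addrA addrCA; apply: lerD (HK J c J3) _.
apply: le_trans (IH _) _; rewrite lerD2l.
by rewrite -addrA -[X in X + _ / _]mul1r -mulrDl [1 + _]addrC.
Qed.

(** Where |x 0 k| is at least J - 1 one has J <= 2 wt x, so rapid decrease of f
    compensates the powers of J. *)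
Lemma kill_tail f B n N C : rapid f -> 0 <= C -> 0 <= B ->
  (forall f, rapid f -> forall M, (forall x, wt x ^+ N * jet n f x <= M) -> `|T f| <= C * M) ->
  exists K, 0 <= K /\ forall (J : nat) (u : V -> R), (3 < J)%N -> smooth_on setT u ->
   rapid (fun x => u x * f x) ->
   (forall x, jet n u x <= J%:R ^+ n * B * wt x ^+ n) ->
   (forall x, `|x 0 k| < J%:R - 1 -> jet n u x = 0) ->
   `|T (fun x => u x * f x)| <= K / J%:R.
Proof.
move=> rf C0 B0 HC; have [M HM] := rf.2 n (N + n + n.+1)%N.
have M0 : 0 <= M by apply: le_trans (HM 0); rewrite mulr_ge0 ?wtX_ge0 ?jet_ge0.
exists (C * (B * (2 ^+ n.+1 * M))); split; first by rewrite !mulr_ge0 ?exprn_ge0.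
move=> J u J3 su ruf ju ju0; rewrite -mulrA; apply: HC => // x.
have J0 : (0 < J)%N by apply: leq_trans J3.
have Jp : 0 < J%:R :> R by rewrite ltr0n.
apply: le_trans (_ : wt x ^+ N * (jet n u x * jet n f x) <= _).
  by rewrite ler_wpM2l ?wtX_ge0 // (jetM n oT su rf.1 I).
have [xJ|Jx] := ltP `|x 0 k| (J%:R - 1).
  by rewrite ju0 // mul0r mulr0 !mulr_ge0 ?exprn_ge0 ?invr_ge0.
have wJ : J%:R <= 2 * wt x.
  apply: le_trans (_ : 2 * wtA (pred1 k) x <= _); last by rewrite ler_wpM2l // wtA_wt.
  rewrite wtA_pred1 -real_normK ?num_real //.
  move: (J%:R) `|x 0 k| Jx => r v rx; have := sqr_ge0 (v - 1); nra.
have wp : 0 < wt x by exact: wt_gt0.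
apply: le_trans (_ : wt x ^+ N * (J%:R ^+ n * B * wt x ^+ n * jet n f x) <= _).
  by rewrite ler_wpM2l ?wtX_ge0 // ler_wpM2r ?jet_ge0.
rewrite ler_pdivlMr // [X in X <= _](_ : _ = B * (J%:R ^+ n.+1 * (wt x ^+ (N + n) * jet n f x))); last first.
  by rewrite exprS exprD; ring.
rewrite ler_wpM2l //; apply: le_trans (_ : (2 * wt x) ^+ n.+1 * (wt x ^+ (N + n) * jet n f x) <= _).
  rewrite ler_wpM2r ?mulr_ge0 ?wtX_ge0 ?jet_ge0 //.
  by apply: lerXn2r; rewrite ?nnegrE ?mulr_ge0 ?(ltW wp) ?(ltW Jp).
rewrite exprMn -mulrA ler_wpM2l ?exprn_ge0 //.
by apply: le_trans (HM x); rewrite [wt x ^+ (N + n + _)]exprD mulrA [_ * wt x ^+ (N + n)]mulrC.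
Qed.

(** Cover the range from - J to J by 2 J ^ 2 bumps of width 1 / J. Each contributes
    O(1 / J ^ 3) and each of the two tails O(1 / J). *)
Lemma kill_coordinate f : rapid f -> T f = 0.
Proof.
move=> rf; have [n [N [C [C0 HC]]]] := dT.2; have [B [B0 HB]] := stair_jet n.
have [K1 [K10 HK1]] := kill_stairs rf.
have B10 : 0 <= B + 1 by exact: addr_ge0.
have [K2 [K20 HK2]] := kill_tail rf C0 B10 HC.
have wAw x : wtA (pred1 k) x ^+ n <= wt x ^+ n.
  by apply: lerXn2r; rewrite ?nnegrE ?wtA_wt ?(le_trans ler01 (wtA_ge1 _ _)) ?(ltW (wt_gt0 _)).
have nearJ (J : nat) (u : V -> R) x : (forall y, `|y 0 k| < J%:R - 1 -> u y = 0) ->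
    `|x 0 k| < J%:R - 1 -> jet n u x = 0.
  move=> Hu xJ; apply: (@jet0_near _ _ [set y : V | `|y 0 k| < J%:R - 1]) => //.
  have pc : forall y : V, {for y, continuous (fun y => `|y 0 k|)}.
    by move=> y; apply/continuous_coordP => e e0; exists e => // z zy; apply: le_lt_trans (ler_dist_dist _ _) (zy k).
  by apply: (@open_comp _ _ (fun y : V => `|y 0 k|) [set t | t < J%:R - 1]) => [y _|]; [exact: pc|exact: open_lt].
suff H (J : nat) : (3 < J)%N -> `|T f| <= (K2 + 2 * K1 + K2) / J%:R.
  apply/eqP; rewrite -normr_le0 leNgt; apply/negP => Tp.
  pose L := K2 + 2 * K1 + K2.
  have L0 : 0 <= L by rewrite !addr_ge0 ?mulr_ge0.
  pose J := (Num.Def.archi_bound (L / `|T f|) + 4)%N.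
  have J3 : (3 < J)%N by rewrite /J addnS ltnS -[3%N]add0n leq_add2r.
  have := H J J3; rewrite -/L leNgt => /negP; apply.
  have Jp : 0 < J%:R :> R by rewrite ltr0n (leq_trans _ J3).
  rewrite ltr_pdivrMr // mulrC -ltr_pdivrMr //.
  apply: lt_le_trans (archi_boundP _) _; first by rewrite divr_ge0.
  by rewrite ler_nat leq_addr.
move=> J3; have J0 : (0 < J)%N by apply: leq_trans J3.
have Jp : 0 < J%:R :> R by rewrite ltr0n.
have rs c := rapid_stairM c J0 rf.
have JX : 1 <= J%:R ^+ n :> R by rewrite exprn_ege1 // ler1n.
have t1 : `|T (fun x => stair J J%:R x * f x)| <= K2 / J%:R.
  apply: HK2 => //; first exact: smooth_stair.
    move=> x; apply: le_trans (HB J J%:R x J0) _; apply: ler_pM => //.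
    - by rewrite mulr_ge0 ?exprn_ge0.
    - exact: wtAX_ge0.
    - by rewrite ler_wpM2l ?exprn_ge0 // lerDl.
  move=> x; apply: nearJ => y yJ; apply: p_lt0; rewrite pmulr_rlt0 // subr_lt0.
  apply: le_lt_trans (ler_norm _) (lt_le_trans yJ _); by rewrite gerDl lerN10.
have su : smooth_on setT (fun x => 1 + -1 * stair J (- J%:R) x).
  by apply: (smoothD oT (smooth_cst 1 oT)); exact: (smoothZ (-1) oT (smooth_stair J (- J%:R))).
have t2 : `|T (fun x => (1 + -1 * stair J (- J%:R) x) * f x)| <= K2 / J%:R.
  apply: HK2 => //.
  - have := rapidB rf (rs (- J%:R)); congr rapid; apply/funext => x.
    by rewrite mulN1r mulrBl mul1r.
  - move=> x; have sN := smoothZ (-1) oT (smooth_stair J (- J%:R)).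
    apply: le_trans (jetD n oT (smooth_cst 1 oT) sN I) _.
    rewrite jet_cst normr1 (jetZ _ _ oT (smooth_stair J _) I) normrN1 mul1r.
    rewrite mulrDr mulr1 mulrDl addrC; apply: lerD.
      by apply: le_trans (HB J _ x J0) _; rewrite ler_wpM2l // mulr_ge0 ?exprn_ge0.
    by rewrite mulr_ege1 // wtX_ge1.
  - move=> x; apply: nearJ => y yJ; rewrite /stair p_gt1 ?mulr1 ?subrr //.
    rewrite opprK; have : 1 < y 0 k + J%:R.
      have := ler_norm (- y 0 k); rewrite normrN => H1.
      move: H1 yJ; move: `|y 0 k| (y 0 k) (J%:R) => a b c ? ?; lra.
    move=> H1; apply: lt_le_trans (H1) _; rewrite ler_peMl ?ler1n //.
    by apply: ltW; apply: lt_trans (H1).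
have E : T f = T (fun x => (1 + -1 * stair J (- J%:R) x) * f x) + T (fun x => stair J (- J%:R) x * f x).
  rewrite -tdistD //; last first.
    have := rapidB rf (rs (- J%:R)); congr rapid; apply/funext => x.
    by rewrite mulN1r mulrBl mul1r.
  by congr T; apply/funext => x; rewrite -mulrDl mulN1r subrK mul1r.
have := HK1 J (2 * J ^ 2)%N (- J%:R) J3.
have -> : - J%:R + (2 * J ^ 2)%:R / J%:R = J%:R :> R.
  by rewrite natrM natrX; field; rewrite gt_eqF.
have -> : (2 * J ^ 2)%:R * (K1 / J%:R ^+ 3) = 2 * K1 / J%:R :> R.
  by rewrite natrM natrX; field; rewrite gt_eqF.
move=> t3; rewrite E [(K2 + _ + _) / _]mulrDl [(K2 + _) / _]mulrDl; apply: le_trans (ler_normD _ _) _.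
by rewrite -addrA; apply: lerD t2 _; apply: le_trans t3 _; rewrite lerD2l.
Qed.

End OneCoordinate.

(** Freezing the variables in A at x0 makes f an arbitrary test function of the
    others. *)
Definition tkill A (T : (V -> R) -> R) := forall g f x0, rapidA A g -> rapid f ->
  T (fun z => g z * f (glue A x0 z)) = 0.

(** Density of the products of test functions in separate variables. Induction on
    the number of variables in A, by the case of one variable. *)
Lemma tensor_dense A T : tdist T -> tkill A T -> forall f, rapid f -> T f = 0.
Proof.
have [p [sp p0 p1 _ pb]] := smooth_step R.
move=> dT kT.
suff H (s : seq 'I_d) : tkill (mem s) T -> forall f, rapid f -> T f = 0.
  apply: (H [seq x <- enum 'I_d | A x]).
  have E : (mem [seq x <- enum 'I_d | A x] : pred 'I_d) = A.
    by apply/funext => j; rewrite /= mem_filter mem_enum andbT.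
  by rewrite E.
elim: s => [|k s IH] ks f rf.
  have r1 : rapidA (mem [::]) (fun _ : V => 1 : R).
    split; [exact: (smooth_cst 1 oT)|by []|]; move=> n N; exists 1 => x.
    by rewrite jet_cst normr1 mulr1 /wtA big_pred0 ?addr0 ?expr1n.
  have := ks _ _ 0 r1 rf; congr (T _ = _); apply/funext => z; rewrite mul1r; congr f.
  by apply/rowP => j; rewrite glueE.
apply: IH => // g f' x0 rg rf'.
have [ksm|ksm] := boolP (k \in s).
  have E : (mem (k :: s) : pred 'I_d) = mem s.
    by apply/funext => j; rewrite /= in_cons; case: eqVneq => [->|].
  by rewrite E in ks; exact: ks.
have dT' := tdist_tensor x0 dT rg.
apply: (@kill_coordinate k p sp p0 p1 pb _ dT' _ f' rf') => u h c ru rh.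
pose x1 : V := \row_j if j == k then c 0 j else x0 0 j.
have rgu : rapidA (mem (k :: s)) (fun z => g z * u z).
  have [sg dg bg] := rg; have [su du bu] := ru; split.
  - exact: (smoothM oT sg su).
  - move=> x y xy; congr (_ * _); first by apply: dg => j js; apply: xy; rewrite /= in_cons (js : j \in s) orbT.
    by apply: du => j /eqP ->; apply: xy; rewrite /= in_cons eqxx.
  - move=> n N; have [M HM] := bg n N; have [M' HM'] := bu n N; exists (M * M') => x.
    have wle : wtA (mem (k :: s)) x <= wtA (mem s) x * wtA (pred1 k) x.
      rewrite /wtA big_pred1_eq.
      have -> : \sum_(j | mem (k :: s) j) x 0 j ^+ 2 = x 0 k ^+ 2 + \sum_(j | mem s j) x 0 j ^+ 2.
        rewrite (bigD1 k) /= ?mem_head //; congr (_ + _); apply: eq_bigl => j.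
        by rewrite in_cons; case: eqVneq => [->|] /=; rewrite ?(negbTE ksm) ?andbT.
      have a0 : 0 <= \sum_(j | mem s j) x 0 j ^+ 2 by apply: sumr_ge0 => j _; exact: sqr_ge0.
      have := sqr_ge0 (x 0 k); move: (x 0 k ^+ 2) (\sum_(j | mem s j) x 0 j ^+ 2) a0 => a b; nra.
    apply: le_trans (_ : (wtA (mem s) x * wtA (pred1 k) x) ^+ N * (jet n g x * jet n u x) <= _).
      apply: ler_pM; rewrite ?wtAX_ge0 ?jet_ge0 //; last exact: (jetM n oT sg su I).
      apply: lerXn2r; rewrite ?nnegrE //; first exact: le_trans ler01 (wtA_ge1 _ _).
      by apply: mulr_ge0; exact: le_trans ler01 (wtA_ge1 _ _).
    rewrite exprMn mulrACA; apply: ler_pM => //; rewrite mulr_ge0 ?wtAX_ge0 ?jet_ge0 //.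
have := ks _ _ x1 rgu rh; congr (T _ = _); apply/funext => z; rewrite -mulrA; congr (_ * (_ * h _)).
  have [_ du _] := ru; apply: du => j /eqP ->.
  by rewrite glueE /= (negbTE ksm).
apply/rowP => j; rewrite !glueE /= in_cons mxE; case: eqVneq => // _; by case: (j \in s).
Qed.

End Density.

(** * Nash differential operators on real functions *)

Section NashOperators.
Variables (R : realType) (d : nat).
Local Notation V := 'rV[R]_d.
Local Notation op := ((V -> R) -> (V -> R)).
Implicit Types (U W : set V) (f g h q : V -> R) (D E : op).
Let oT : open (setT : set V) := @open_setT R d.

(** Nash differential operators have real coefficients, so they act on real-valued
    functions. *)
Inductive rdop U : op -> Prop :=
| rd_mult g : nash_on U g -> rdop U (fun f x => g x * f x)
| rd_partial k : rdop U (partial k)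
| rd_add D E : rdop U D -> rdop U E -> rdop U (fun f x => D f x + E f x)
| rd_comp D E : rdop U D -> rdop U E -> rdop U (fun f => D (E f)).

Definition rsch U f := smooth_on U f /\
  forall D, rdop U D -> exists M, forall x, U x -> `|D f x| <= M.

(** Real distributions. Continuity at 0 in terms of epsilon and delta amounts to
    this bound by linearity. *)
Definition rdist U (T : (V -> R) -> R) :=
  (forall a f g, rsch U f -> rsch U g -> T (fun x => a * f x + g x) = a * T f + T g) /\
  exists r (D : 'I_r -> op) C, [/\ 0 <= C, forall i, rdop U (D i) &
    forall f, rsch U f -> forall M, 0 <= M -> (forall i x, U x -> `|D i f x| <= M) -> `|T f| <= C * M].

Lemma rdop_smooth U D f : open U -> rdop U D -> smooth_on U f -> smooth_on U (D f).
Proof.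
move=> oU rD; elim: rD f => {D} [g [sg _]|k|D E _ IHD _ IHE|D E _ IHD _ IHE] f sf.
- exact: smoothM.
- exact: smooth_partial.
- exact: (smoothD oU (IHD f sf) (IHE f sf)).
- exact: (IHD _ (IHE f sf)).
Qed.

Lemma rdop_local U W D f h : open W -> (forall x, W x -> U x) -> rdop U D ->
  (forall x, W x -> f x = h x) -> forall x, W x -> D f x = D h x.
Proof.
move=> oW WU rD; elim: rD f h => {D} [g _|k|D E _ IHD _ IHE|D E _ IHD _ IHE] f h fh x Wx.
- by rewrite fh.
- exact: (partial_eq_on k oW fh Wx).
- by rewrite (IHD f h fh x Wx) (IHE f h fh x Wx).
- exact: (IHD _ _ (IHE f h fh) x Wx).
Qed.

Lemma rdop_linear U D a f h : open U -> rdop U D -> smooth_on U f -> smooth_on U h ->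
  forall x, U x -> D (fun x => a * f x + h x) x = a * D f x + D h x.
Proof.
move=> oU rD; elim: rD f h => {D} [g _|k|D E rD IHD rE IHE|D E rD IHD rE IHE] f h sf sh x Ux.
- by rewrite mulrDr mulrCA.
- have sa := smoothZ a oU sf.
  rewrite partialD; [|exact: (@smooth_der _ _ U _ x k sa Ux)|exact: (@smooth_der _ _ U _ x k sh Ux)].
  by rewrite (partialZ _ (@smooth_der _ _ U f x k sf Ux)).
- by rewrite (IHD f h sf sh x Ux) (IHE f h sf sh x Ux) mulrDr addrACA.
- rewrite (rdop_local oU (fun x Ux => Ux) rD (IHE f h sf sh) Ux).
  exact: (IHD _ _ (rdop_smooth oU rE sf) (rdop_smooth oU rE sh) x Ux).
Qed.

Lemma rdop0 U D x : open U -> rdop U D -> U x -> D (fun=> 0) x = 0.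
Proof.
move=> oU rD Ux; have s0 := smooth_cst (0 : R) oU.
have := rdop_linear 1 oU rD s0 s0 Ux; rewrite [1 * D _ _]mul1r.
have -> : (fun=> 1 * 0 + 0 : R) = (fun _ : V => 0 : R).
  by apply/funext => y; rewrite mulr0 addr0.
by move=> H; apply: (@addIr _ (D (fun=> 0) x)); rewrite add0r -H.
Qed.

Lemma rsch0 U : open U -> rsch U (fun=> 0).
Proof.
move=> oU; split; first exact: smooth_cst.
by move=> D rD; exists 0 => x Ux; rewrite (rdop0 oU rD Ux) normr0.
Qed.

Lemma rschL U a f h : open U -> rsch U f -> rsch U h -> rsch U (fun x => a * f x + h x).
Proof.
move=> oU [sf bf] [sh bh]; split; first exact: (smoothD oU (smoothZ a oU sf) sh).
move=> D rD; have [M HM] := bf D rD; have [M' HM'] := bh D rD.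
exists (`|a| * M + M') => x Ux; rewrite (rdop_linear a oU rD sf sh Ux).
apply: le_trans (ler_normD _ _) _; apply: lerD; last exact: HM'.
by rewrite normrM ler_wpM2l // HM.
Qed.

Lemma rdistB U T f h : open U -> rdist U T -> rsch U f -> rsch U h ->
  T (fun x => f x - h x) = T f - T h.
Proof.
move=> oU [lT _] rf rh; have := lT (-1) _ _ rh rf; rewrite mulN1r addrC => <-.
by congr T; apply/funext => x; rewrite mulN1r addrC.
Qed.

(** The coefficients may be unbounded near the boundary of U, but where c <= q they
    have polynomial growth. *)
Lemma rdop_growth U q c D : open U -> pf q -> (forall x, c <= q x -> U x) -> rdop U D ->
  exists n, forall m, exists C N, 0 <= C /\ forall f x, smooth_on U f -> c <= q x ->
    jet m (D f) x <= C * wt x ^+ N * jet (m + n) f x.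
Proof.
move=> oU pq qU; elim=> {D} [g ng|k|D E rD [n IHD] rE [k IHE]|D E rD [n IHD] rE [k IHE]].
- exists 0%N => m; have [C [N [C0 HC]]] := nash_growth m oU pq qU ng.
  exists C, N; split=> // f x sf cq; rewrite addn0.
  apply: le_trans (jetM m oU ng.1 sf (qU x cq)) _.
  by rewrite ler_wpM2r ?jet_ge0 // HC.
- exists 1%N => m; exists 1, 0%N; split=> // f x sf cq.
  by rewrite expr0 !mul1r addn1; exact: jet_partial.
- exists (maxn n k) => m; have [C [N [C0 HC]]] := IHD m; have [C' [N' [C0' HC']]] := IHE m.
  exists (C + C'), (maxn N N'); split; first exact: addr_ge0.
  move=> f x sf cq; have Ux := qU x cq.
  apply: le_trans (jetD m oU (rdop_smooth oU rD sf) (rdop_smooth oU rE sf) Ux) _.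
  rewrite !mulrDl; apply: lerD.
    apply: le_trans (HC f x sf cq) _; apply: ler_pM; rewrite ?jet_ge0 ?mulr_ge0 ?wtX_ge0 //.
      by apply: wt_weaken; rewrite ?leq_maxl.
    by apply: jet_mono; rewrite leq_add2l leq_maxl.
  apply: le_trans (HC' f x sf cq) _; apply: ler_pM; rewrite ?jet_ge0 ?mulr_ge0 ?wtX_ge0 //.
    by apply: wt_weaken; rewrite ?leq_maxr.
  by apply: jet_mono; rewrite leq_add2l leq_maxr.
- exists (n + k)%N => m; have [C [N [C0 HC]]] := IHD m; have [C' [N' [C0' HC']]] := IHE (m + n)%N.
  exists (C * C'), (N + N')%N; split; first exact: mulr_ge0.
  move=> f x sf cq; apply: le_trans (HC _ x (rdop_smooth oU rE sf) cq) _.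
  rewrite exprD mulrACA -[X in _ <= X]mulrA addnA.
  by rewrite ler_wpM2l ?mulr_ge0 ?wtX_ge0 // HC'.
Qed.

(** The polynomial growth of the coefficients is absorbed by the weight; where q < c
    locality gives 0. *)
Lemma rapid_op_bound U q c D : open U -> pf q -> (forall x, c <= q x -> U x) -> rdop U D ->
  exists n N C, 0 <= C /\ forall f, rapid f -> (forall x, q x < c -> f x = 0) ->
   forall M, (forall x, wt x ^+ N * jet n f x <= M) -> forall x, U x -> `|D f x| <= C * M.
Proof.
move=> oU pq qU rD; have [n H] := rdop_growth oU pq qU rD.
have [C [N [C0 HC]]] := H 0%N; exists n, N, C; split=> // f rf f0 M HM x Ux.
have sf : smooth_on U f by apply: smooth_sub rf.1.
have [cq|qc] := leP c (q x).
  apply: le_trans (HC f x sf cq) _; by rewrite -mulrA ler_wpM2l.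
have M0 : 0 <= M by apply: le_trans (HM 0); rewrite mulr_ge0 ?wtX_ge0 ?jet_ge0.
have oW : open (U `&` [set y | q y < c]).
  apply: openI => //; apply: (@open_comp _ _ q [set t | t < c]) => [y _|]; last exact: open_lt.
  exact: pf_cont.
rewrite (rdop_local oW _ rD (_ : forall y, (U `&` [set y | q y < c]) y -> f y = (fun=> 0) y)) //.
- by rewrite (rdop0 oU rD Ux) normr0 mulr_ge0.
- by move=> y [].
- by move=> y [_ /f0].
Qed.

Lemma rapid_rsch U q c f : open U -> pf q -> (forall x, c <= q x -> U x) -> rapid f ->
  (forall x, q x < c -> f x = 0) -> rsch U f.
Proof.
move=> oU pq qU rf f0; split; first by apply: smooth_sub rf.1.
move=> D rD; have [n [N [C [C0 HC]]]] := rapid_op_bound oU pq qU rD.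
by have [M HM] := rf.2 n N; exists (C * M) => x Ux; exact: HC.
Qed.

Lemma pf_prod (I : Type) (s : seq I) (F : I -> V -> R) :
  (forall i, pf (F i)) -> pf (fun x => \prod_(i <- s) F i x).
Proof.
move=> pF; elim: s => [|i s IH].
  have -> : (fun x => \prod_(i <- [::]) F i x) = fun=> 1 by apply/funext => x; rewrite big_nil.
  exact: pf_cst.
have -> : (fun x => \prod_(i <- i :: s) F i x) = fun x => F i x * \prod_(j <- s) F j x.
  by apply/funext => x; rewrite big_cons.
exact: pf_mul.
Qed.

Lemma meval_pf (p : mpoly.mpoly d R) : pf (fun x : V => mpoly.meval (fun k => x 0 k) p).
Proof.
rewrite (funext (fun x : V => mpoly.mevalE (fun k => x 0 k) p)).
apply: pf_sum => m; apply: pf_mul; first exact: pf_cst.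
by apply: pf_prod => i; apply: pf_exp; exact: pf_coord.
Qed.

End NashOperators.

Section NashExamples.
Variables (R : realType) (d : nat).
Local Notation V := 'rV[R]_d.
Local Notation op := ((V -> R) -> (V -> R)).
Implicit Types (U W : set V) (f g h q : V -> R) (D E : op).
Let oT : open (setT : set V) := @open_setT R d.

Lemma pf_lsub f : pf f -> pf (fun z : 'rV[R]_(d + 1) => f (lsubmx z)).
Proof.
elim=> {f} [c|k|f g _ pF _ pG|f g _ pF _ pG].
- exact: pf_cst.
- have -> : (fun z : 'rV[R]_(d + 1) => lsubmx z 0 k) = fun z => z 0 (lshift 1 k).
    by apply/funext => z; rewrite mxE.
  exact: pf_coord.
- exact: pf_add.
- exact: pf_mul.
Qed.

Lemma semialgebraic_lsub U : semialgebraic U ->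
  semialgebraic [set z : 'rV[R]_(d + 1) | U (lsubmx z)].
Proof.
elim=> {U} [p|S _ IH|S T _ IS _ IT].
- exact: (pf_semialgebraic (pf_lsub (meval_pf p))).
- exact: semialg_compl.
- exact: semialg_inter.
Qed.

Lemma semialgebraic_zero n (f : 'rV[R]_n -> R) : pf f -> semialgebraic [set x | f x = 0].
Proof.
move=> pF; have pN : pf (fun x => -1 * f x) by apply: pf_mul => //; exact: pf_cst.
have := semialg_inter (semialg_compl (pf_semialgebraic pF)) (semialg_compl (pf_semialgebraic pN)).
congr semialgebraic; apply/seteqP; split=> x /=.
  rewrite mulN1r oppr_gt0 => -[/negP h1 /negP h2].
  by apply/eqP; rewrite eq_le leNgt h1 leNgt h2.
by move=> ->; rewrite mulr0 ltxx.
Qed.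

Lemma nash_pf U f : open U -> semialgebraic U -> pf f -> nash_on U f.
Proof.
move=> oU sU pF; split; first exact: pf_smooth.
have pz : pf (fun z : 'rV[R]_(d + 1) => rsubmx z 0 0 + -1 * f (lsubmx z)).
  apply: pf_add.
    have -> : (fun z : 'rV[R]_(d + 1) => rsubmx z 0 0) = fun z => z 0 (rshift d 0).
      by apply/funext => z; rewrite mxE.
    exact: pf_coord.
  by apply: pf_mul; [exact: pf_cst|exact: pf_lsub].
have := semialg_inter (semialgebraic_lsub sU) (semialgebraic_zero pz).
congr semialgebraic; apply/seteqP; split=> z /= [Uz]; rewrite mulN1r.
  by move/eqP; rewrite subr_eq0 => /eqP.
by move=> ->; rewrite subrr.
Qed.

(** The graph of 1 / q is cut out by q * y = 1. *)
Lemma nash_inv q : pf q -> nash_on [set x | 0 < q x] (fun x => (q x)^-1).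
Proof.
move=> pq; set U := [set x | 0 < q x].
have oU : open U.
  by apply: (@open_comp _ _ q [set t | 0 < t]) => [y _|]; [exact: pf_cont|exact: open_gt].
split.
  pose B := @pf R d `|` [set f | f = fun x => (q x)^-1].
  apply: (@sumprod_smooth _ _ U B) => //; last by apply: sp_base; right.
  - move=> f [pF|->] x Ux; first exact: pf_cont.
    have qn : q x != 0 by rewrite gt_eqF.
    by apply: (@continuous_comp _ _ _ q (@GRing.inv R)); [exact: pf_cont|exact: inv_continuous].
  - move=> f [pF|->] x k Ux; first exact: pf_der.
    by apply: derivableV; [rewrite gt_eqF|exact: pf_der].
  - move=> f k [pF|->].
      by exists (partial k f) => //; apply: sp_base; left; exact: pf_partial.
    exists (fun x => (-1 * partial k q x) * ((q x)^-1 * (q x)^-1)).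
      apply: sp_mul; first by apply: sp_base; left; apply: pf_mul; [exact: pf_cst|exact: pf_partial].
      by apply: sp_mul; apply: sp_base; right.
    move=> x Ux; have qn : q x != 0 by rewrite gt_eqF.
    have := deriveV qn (@pf_der R d q pq x k) => E.
    transitivity (- (q x) ^- 2 *: 'D_(delta_mx 0 k) q x); first exact: E.
    by rewrite -[_ *: _]/(_ * _) -/(partial k q x) -exprVn expr2; ring.
have pz : pf (fun z : 'rV[R]_(d + 1) => q (lsubmx z) * rsubmx z 0 0 + -1).
  apply: pf_add; last exact: pf_cst.
  apply: pf_mul; first exact: pf_lsub.
  have -> : (fun z : 'rV[R]_(d + 1) => rsubmx z 0 0) = fun z => z 0 (rshift d 0).
    by apply/funext => z; rewrite mxE.
  exact: pf_coord.
have := semialg_inter (semialgebraic_lsub (pf_semialgebraic pq)) (semialgebraic_zero pz).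
congr semialgebraic; apply/seteqP; split=> z /= [Uz]; have qn : q (lsubmx z) != 0 by rewrite gt_eqF.
  move/eqP; rewrite subr_eq0 => /eqP E; split=> //.
  by apply: (mulfI qn); rewrite E mulfV.
by move=> ->; split=> //; rewrite mulfV // subrr.
Qed.

Lemma rdop_pf U f : open U -> semialgebraic U -> pf f -> rdop U (fun h x => f x * h x).
Proof. by move=> oU sU pF; apply: rd_mult; exact: nash_pf. Qed.

Lemma rdop_id U : open U -> semialgebraic U -> rdop U id.
Proof.
move=> oU sU; have := rdop_pf oU sU (@pf_cst R d 1); congr rdop.
by apply/funext => f; apply/funext => x; rewrite mul1r.
Qed.

Lemma rdop_partials U s : open U -> semialgebraic U -> rdop U (partials s).
Proof.
move=> oU sU; elim: s => [|k s IH]; first exact: rdop_id.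
exact: (rd_comp (rd_partial U k) IH).
Qed.

(** The words that jet n sums over, with their multiplicities. *)
Fixpoint jet_index n : seq (seq 'I_d) :=
  if n is n'.+1 then jet_index n' ++ flatten [seq [seq rcons s k | s <- jet_index n'] | k <- enum 'I_d]
  else [:: [::]].

Lemma jet_indexE n f x : jet n f x = \sum_(s <- jet_index n) `|partials s f x|.
Proof.
elim: n f => [|n IH] f; first by rewrite big_seq1.
rewrite /= big_cat /= IH; congr (_ + _).
rewrite big_flatten /= big_map big_enum /=; apply: eq_bigr => k _.
by rewrite IH big_map; apply: eq_bigr => s _; rewrite partials_rcons.
Qed.

(** Partial derivatives times powers of the weight are themselves Nash operators, so
    the Nash seminorms control the weighted jets. *)
Lemma jet_ops U n N : open U -> semialgebraic U -> exists r (D : 'I_r -> op) K,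
  [/\ 0 <= K, forall i, rdop U (D i) & forall f M x, U x ->
    (forall i, `|D i f x| <= M) -> wt x ^+ N * jet n f x <= K * M].
Proof.
move=> oU sU; pose r := size (jet_index n).
exists r, (fun i f x => wt x ^+ N * partials (nth [::] (jet_index n) i) f x), r%:R.
split=> // [i|f M x Ux HM].
  exact: (rd_comp (rdop_pf oU sU (pf_exp N (@pf_wt R d))) (rdop_partials _ oU sU)).
rewrite jet_indexE mulr_sumr (big_nth [::]) big_mkord -/r.
apply: le_trans (_ : \sum_(i < r) M <= _); last by rewrite sumr_const card_ord mulr_natl.
apply: ler_sum => i _; have := HM i; rewrite normrM ger0_norm ?wtX_ge0 //.
Qed.

Lemma pf1 : @pf R d (fun=> 1). Proof. exact: pf_cst. Qed.

Lemma semialgebraicT : semialgebraic (setT : set V).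
Proof.
have := pf_semialgebraic pf1; congr semialgebraic; apply/seteqP; split=> x //= _.
Qed.

(** Polynomials are Nash functions, and Nash functions on the whole space have
    polynomial growth with all their derivatives: the two families of seminorms
    bound each other. *)
Lemma rapid_rschT f : rapid f <-> rsch setT f.
Proof.
split=> [rf|[sf bf]].
  apply: (@rapid_rsch _ _ setT (fun=> 1) 1) => //; first exact: pf1.
  by move=> x; rewrite ltxx.
split=> // n N; have [r [D [K [K0 rD HK]]]] := jet_ops n N oT semialgebraicT.
have /choice[M HM] : forall i, exists M, forall x : V, setT x -> `|D i f x| <= M.
  by move=> i; exact: bf.
exists (K * \sum_i `|M i|) => x; apply: HK => // i.
apply: le_trans (HM i x I) _; rewrite (bigD1 i) //= ler_wpDr ?ler_norm // sumr_ge0 //.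
Qed.

Lemma tdist_rdist (T : (V -> R) -> R) : tdist T <-> rdist setT T.
Proof.
split=> -[lT].
  move=> [n [N [C [C0 HC]]]]; split.
    by move=> a f g /rapid_rschT rf /rapid_rschT rg; exact: lT.
  have [r [D [K [K0 rD HK]]]] := jet_ops n N oT semialgebraicT.
  exists r, D, (C * K); split=> //; first exact: mulr_ge0.
  move=> f /rapid_rschT rf M M0 HM; rewrite -mulrA; apply: HC => // x.
  by apply: HK => // i; exact: HM.
move=> [r [D [C [C0 rD HC]]]]; split.
  by move=> a f g rf rg; apply: lT; exact/rapid_rschT.
have /choice[n /choice[N /choice[K HK]]] : forall i, exists n N K, 0 <= K /\ forall f, rapid f ->
   forall M, (forall x, wt x ^+ N * jet n f x <= M) -> forall x, `|D i f x| <= K * M.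
  move=> i; have [n [N [K [K0 HK]]]] := rapid_op_bound oT pf1 (c := 1) (fun x _ => I) (rD i).
  exists n, N, K; split=> // f rf M HM x; apply: HK => // y.
  by rewrite ltxx.
pose n' := \max_i n i; pose N' := \max_i N i; pose K' := \sum_i K i.
exists n', N', (C * K'); split.
  by rewrite mulr_ge0 // sumr_ge0 // => i _; case: (HK i).
move=> f rf M HM; rewrite -mulrA.
have M0 : 0 <= M by apply: le_trans (HM 0); rewrite mulr_ge0 ?wtX_ge0 ?jet_ge0.
apply: HC; first exact/rapid_rschT.
  by rewrite mulr_ge0 // sumr_ge0 // => i _; case: (HK i).
move=> i x _; have [K0 HKi] := HK i.
apply: le_trans (HKi f rf M _ x) _.
  move=> y; apply: le_trans (HM y); apply: ler_pM; rewrite ?wtX_ge0 ?jet_ge0 //.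
    by rewrite ler_weXn2l ?wt_ge1 // (leq_bigmax i).
  by apply: jet_mono; exact: (leq_bigmax i).
rewrite ler_wpM2r // /K' (bigD1 i) //= lerDl sumr_ge0 // => j _; by case: (HK j).
Qed.

End NashExamples.

(** * Cutoffs near the zeros of a polynomial *)

Section Cutoff.
Variables (R : realType) (d : nat).
Local Notation V := 'rV[R]_d.
Local Notation op := ((V -> R) -> (V -> R)).
Implicit Types (U W : set V) (f g h : V -> R) (D E : op).
Let oT : open (setT : set V) := @open_setT R d.

Variables (p : nat -> R -> R) (q : V -> R).
Hypotheses (sp : smooth1 p) (p_lt0 : forall n t, t < 0 -> p n t = 0)
  (p_gt1 : forall t, 1 < t -> p 0%N t = 1) (p_gt1' : forall n t, 1 < t -> p n.+1 t = 0)
  (p_bd : forall n, exists B, forall t, `|p n t| <= B).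
Hypothesis pq : pf q.

(** A cutoff away from the zeros of q, which rises between q = c and q = 2 c. *)
Definition cut c x : R := p 0 (c^-1 * (q x - c)).

Lemma cut_lt c x : 0 < c -> q x < c -> cut c x = 0.
Proof. by move=> c0 qc; apply: p_lt0; rewrite pmulr_rlt0 ?invr_gt0 // subr_lt0. Qed.

Lemma cut_gt c x : 0 < c -> 2 * c < q x -> cut c x = 1.
Proof.
move=> c0 qc; apply: p_gt1; rewrite mulrC ltr_pdivlMr // mul1r.
by rewrite ltrBrDr -mulr2n -mulr_natl.
Qed.

Lemma cutE c : cut c = fun x => (fun n t => c^-1 ^+ n * p n (c^-1 * (t - c))) 0%N (q x).
Proof. by apply/funext => x; rewrite /cut expr0 mul1r. Qed.

Lemma tempered_cut c : tempered (cut c).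
Proof.
rewrite cutE; apply: (tempered_comp1 0 (smooth1_scale sp c^-1 c) (pf_tempered pq)).
move=> n; have [B HB] := p_bd n; exists (`|c^-1 ^+ n| * B) => t.
by rewrite normrM ler_wpM2l.
Qed.

Lemma open_qlt c : open [set x | q x < c].
Proof. by apply: (@open_comp _ _ q [set t | t < c]) => [y _|]; [exact: pf_cont|exact: open_lt]. Qed.

Lemma smooth_cutM U c f : open U -> 0 < c -> (forall x, c <= q x -> U x) -> smooth_on U f ->
  smooth_on setT (fun x => cut c x * f x).
Proof.
move=> oU c0 qU sf s x _; have [cq|qc] := leP c (q x).
  have sc : smooth_on U (cut c) by apply: smooth_sub (tempered_cut c).1.
  exact: (smoothM oU sc sf s (qU x cq)).
have s0 : smooth_on [set x | q x < c] (fun x => cut c x * f x).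
  have E0 : forall y, [set x | q x < c] y -> (fun=> 0 : R) y = cut c y * f y.
    by move=> y qy; rewrite cut_lt // mul0r.
  have sz : smooth_on [set x | q x < c] (fun=> 0 : R) by have o1 := @open_qlt c; apply: (smooth_cst _ o1).
  exact: (@smooth_eq_on _ _ _ _ _ (@open_qlt c) E0 sz).
exact: s0.
Qed.

Lemma cutoff_bound U c n N : open U -> semialgebraic U -> 0 < c -> (forall x, c <= q x -> U x) ->
  exists r (D : 'I_r -> op) K, [/\ 0 <= K, forall i, rdop U (D i) &
    forall f, smooth_on U f -> forall M, 0 <= M -> (forall i x, U x -> `|D i f x| <= M) ->
    forall x, wt x ^+ N * jet n (fun x => cut c x * f x) x <= K * M].
Proof.
move=> oU sU c0 qU; have [C [K [C0 HC]]] := (tempered_cut c).2 n.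
have [r [D [L [L0 rD HL]]]] := jet_ops n (N + K) oU sU.
exists r, D, (C * L); split=> //; first exact: mulr_ge0.
move=> f sf M M0 HM x; have [cq|qc] := leP c (q x); last first.
  rewrite (@jet0_near _ _ [set x | q x < c]) ?mulr0 ?mulr_ge0 //; first exact: open_qlt.
  by move=> y qy; rewrite cut_lt // mul0r.
have Ux := qU x cq.
have sc : smooth_on U (cut c) by apply: smooth_sub (tempered_cut c).1.
apply: le_trans (_ : C * (wt x ^+ (N + K) * jet n f x) <= _); last first.
  by rewrite -mulrA ler_wpM2l //; apply: HL => // i; exact: HM.
apply: le_trans (_ : wt x ^+ N * (jet n (cut c) x * jet n f x) <= _).
  by rewrite ler_wpM2l ?wtX_ge0 // (jetM n oU sc sf Ux).
rewrite exprD [X in _ <= X](_ : _ = wt x ^+ N * (C * wt x ^+ K * jet n f x)); last by ring.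
by rewrite ler_wpM2l ?wtX_ge0 // ler_wpM2r ?jet_ge0.
Qed.

Lemma cutoff_rapid U c f : open U -> semialgebraic U -> 0 < c -> (forall x, c <= q x -> U x) ->
  rsch U f -> rapid (fun x => cut c x * f x).
Proof.
move=> oU sU c0 qU [sf bf]; split; first exact: (smooth_cutM oU c0 qU sf).
move=> n N; have [r [D [K [K0 rD HK]]]] := cutoff_bound n N oU sU c0 qU.
have /choice[M HM] : forall i, exists M, forall x, U x -> `|D i f x| <= M.
  by move=> i; exact: bf.
exists (K * \sum_i `|M i|); apply: HK => // [|i x Ux]; first exact: sumr_ge0.
apply: le_trans (HM i x Ux) _; rewrite (bigD1 i) //= ler_wpDr ?ler_norm // sumr_ge0 //.
Qed.

(** Induction on the operator. It separates the derivatives of a cutoff from those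
    of the test function. *)
Lemma rdop_leibniz U D : open U -> semialgebraic U -> rdop U D ->
  exists l : seq (seq 'I_d * op), (forall e, List.In e l -> rdop U e.2) /\
   forall a h, smooth_on U a -> smooth_on U h -> forall x, U x ->
    D (fun x => a x * h x) x = \sum_(e <- l) partials e.1 a x * e.2 h x.
Proof.
move=> oU sU; elim=> {D} [g ng|k|D E rD [l [Hl El]] rE [l' [Hl' El']]|D E rD [l [Hl El]] rE [l' [Hl' El']]].
- exists [:: ([::], fun f x => g x * f x)]; split=> [e [<-|//]|a h sa sh x Ux].
    exact: rd_mult.
  by rewrite big_seq1 /= mulrCA.
- exists [:: ([:: k], id); ([::], partial k)]; split=> [e [<-|[<-|//]]|a h sa sh x Ux].
  + exact: rdop_id.
  + exact: rd_partial.
  rewrite big_cons big_seq1 /= partialM; last 2 first.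
  + exact: (@smooth_der _ _ U a x k sa Ux).
  + exact: (@smooth_der _ _ U h x k sh Ux).
  by rewrite addrC.
- exists (l ++ l'); split=> [e /List.in_app_iff[]|a h sa sh x Ux]; [exact: Hl|exact: Hl'|].
  by rewrite El // El' // big_cat.
- exists (List.flat_map (fun e' => List.map (fun e => (e.1 ++ e'.1, fun f => e.2 (e'.2 f))) l) l').
  split=> [e /List.in_flat_map[e' [He' /List.in_map_iff[e'' [<- He'']]]]|a h sa sh x Ux].
    by apply: rd_comp; [exact: Hl|exact: Hl'].
  have sE : forall l'', (forall e, List.In e l'' -> rdop U e.2) -> smooth_on U (fun y => \sum_(e <- l'') partials e.1 a y * e.2 h y) /\
     D (fun y => \sum_(e <- l'') partials e.1 a y * e.2 h y) x =
     \sum_(e <- List.flat_map (fun e' => List.map (fun e => (e.1 ++ e'.1, fun f => e.2 (e'.2 f))) l) l'')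
       partials e.1 a x * e.2 h x.
    elim=> [|e' l'' IH] H.
      rewrite [X in smooth_on U X](_ : _ = fun=> 0); last by apply/funext => y; rewrite big_nil.
      rewrite [X in D X](_ : _ = fun=> 0); last by apply/funext => y; rewrite big_nil.
      by split; [exact: (smooth_cst 0 oU)|rewrite /= big_nil (rdop0 oU rD Ux)].
    have [s1 E1] := IH (fun e He => H e (or_intror He)).
    have r' : rdop U e'.2 by apply: H; left.
    have se : smooth_on U (e'.2 h) by exact: rdop_smooth.
    have sp' : smooth_on U (partials e'.1 a).
      elim: (e'.1) => [|k s IHs]; [exact: sa|exact: (@smooth_partial _ _ U _ k IHs)].
    have sm := smoothM oU sp' se.
    have Ef : (fun y => \sum_(e <- e' :: l'') partials e.1 a y * e.2 h y) =
        fun y => 1 * (partials e'.1 a y * e'.2 h y) + \sum_(e <- l'') partials e.1 a y * e.2 h y.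
      by apply/funext => y; rewrite big_cons mul1r.
    split; rewrite Ef; first exact: (smoothD oU (smoothZ 1 oU sm) s1).
    rewrite (rdop_linear 1 oU rD sm s1 Ux) mul1r E1 El // /= big_cat /=; congr (_ + _).
    rewrite -[List.map _ _]/(map _ _) big_map; apply: eq_bigr => e _ /=.
    by rewrite /partials foldr_cat.
  have [_ <-] := sE l' Hl'.
  by apply: (rdop_local oU _ rD) => // y Uy; exact: El'.
Qed.

Hypothesis q0U : forall x, 0 <= q x.
Let U := [set x | 0 < q x].

Lemma open_qpos : open U.
Proof. by apply: (@open_comp _ _ q [set t | 0 < t]) => [y _|]; [exact: pf_cont|exact: open_gt]. Qed.

Lemma semialgebraic_qpos : semialgebraic U.
Proof. exact: pf_semialgebraic. Qed.

(** The defect of the cutoff lives where q <= 2 c. There n derivatives cost c ^- n,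
    which the Nash function q ^- n.+1 turns into a gain of c. *)
Lemma cut_defect_jet n : exists C N, 0 <= C /\ forall c x, 0 < c -> c <= 1 -> U x ->
  jet n (fun x => 1 + -1 * cut c x) x <= c * (C * ((q x)^-1 ^+ n.+1 * wt x ^+ N)).
Proof.
have /choice[B HB] := p_bd; pose B' := 1 + \sum_(i < n.+1) `|B i|.
have B0 : 0 <= B' by rewrite addr_ge0 // sumr_ge0.
have [C [N [C0 HC]]] := (pf_tempered pq).2 n.
exists (2 ^+ n.+1 * (B' * (1 + C) ^+ n)), (N * n)%N; split.
  by apply: mulr_ge0; [exact: exprn_ge0|exact: (mulr_ge0 B0 (exprn_ge0 _ (addr_ge0 ler01 C0)))].
move=> c x c0 c1 Ux; pose P m t : R := if m is 0%N then 1 + -1 * p 0 t else -1 * p m t.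
have sP : smooth1 P.
  move=> m t; have d1 := is_deriveM (is_derive_cst (-1 : R) t 1) (sp m t).
  case: m d1 => [|m] d1; rewrite /P; last first.
    by apply: is_derive_eq; rewrite -![_ *: _]/(_ * _) mulr0 addr0.
  have d2 := is_deriveD (is_derive_cst (1 : R) t 1) d1.
  by apply: is_derive_eq; rewrite -![_ *: _]/(_ * _) mulr0 addr0 add0r.
have E : (fun x => 1 + -1 * cut c x) = fun x => (fun m t => c^-1 ^+ m * P m (c^-1 * (t - c))) 0%N (q x).
  by apply/funext => y; rewrite /cut expr0 mul1r.
have sq : smooth_on setT q by exact: (pf_smooth oT pq).
have qp : 0 < q x by [].
have cV0 : 0 <= c^-1 by rewrite invr_ge0 ltW.
have cV1 : 1 <= c^-1 by rewrite invf_ge1.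
have PB m t : (m <= n)%N -> `|P m t| <= B'.
  move=> mn; have Hm : `|p m t| <= \sum_(i < n.+1) `|B i|.
    apply: le_trans (HB m t) _; rewrite (bigD1 (Ordinal (mn : (m < n.+1)%N))) //=.
    by rewrite ler_wpDr ?ler_norm // sumr_ge0.
  case: m mn Hm => [|m] mn Hm; rewrite /P mulN1r; last first.
    by rewrite normrN (le_trans Hm) // lerDr.
  by apply: le_trans (ler_normB _ _) _; rewrite normr1 lerD2l.
have [q2|q2] := ltP (2 * c) (q x).
  have -> : jet n (fun x => 1 + -1 * cut c x) x = 0.
    have : jet n (fun x => 1 + -1 * cut c x) x <= 0 * (1 + jet n q x) ^+ n.
      rewrite E; apply: (@jet_comp1 _ _ setT _ q n 0 x 0 oT (smooth1_scale sP c^-1 c) sq I) => i _.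
      have t1 : 1 < c^-1 * (q x - c).
        rewrite mulrC ltr_pdivlMr // mul1r ltrBrDr -mulr2n -mulr_natl //.
      rewrite add0n; case: i => [|i]; rewrite /P; first by rewrite p_gt1 // mulr1 subrr mulr0 normr0.
      by rewrite p_gt1' // !mulr0 normr0.
    by rewrite mul0r => H; apply/eqP; rewrite eq_le H jet_ge0.
  have C1 := mulr_ge0 (exprn_ge0 n.+1 (ler0n R 2)) (mulr_ge0 B0 (exprn_ge0 n (addr_ge0 ler01 C0))).
  have qV : 0 <= (q x)^-1 by rewrite invr_ge0 ltW.
  exact: (mulr_ge0 (ltW c0) (mulr_ge0 C1 (mulr_ge0 (exprn_ge0 n.+1 qV) (wtX_ge0 _ _)))).
have J1 : jet n (fun x => 1 + -1 * cut c x) x <= (c^-1 ^+ n * B') * (1 + jet n q x) ^+ n.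
  rewrite E; apply: (@jet_comp1 _ _ setT _ q n 0 x _ oT (smooth1_scale sP c^-1 c) sq I) => i lei.
  rewrite add0n normrM ger0_norm ?exprn_ge0 //; apply: ler_pM; rewrite ?exprn_ge0 //.
    by rewrite ler_weXn2l.
  exact: PB.
apply: le_trans J1 _.
have J2 : (1 + jet n q x) ^+ n <= (1 + C) ^+ n * wt x ^+ (N * n).
  rewrite exprM -exprMn; apply: lerXn2r.
  - by rewrite nnegrE addr_ge0 ?jet_ge0.
  - by rewrite nnegrE mulr_ge0 ?addr_ge0 // wtX_ge0.
  - by rewrite mulrDl mul1r; apply: lerD; [exact: wtX_ge1|exact: HC].
have J3 : c^-1 ^+ n <= c * (2 ^+ n.+1 * (q x)^-1 ^+ n.+1).
  rewrite -exprMn; have -> : c^-1 ^+ n = c * c^-1 ^+ n.+1.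
    by rewrite exprS mulrA mulfV ?mul1r // gt_eqF.
  have qV : 0 <= (q x)^-1 by rewrite invr_ge0 ltW.
  rewrite ler_wpM2l ?(ltW c0) //; apply: lerXn2r; rewrite ?nnegrE ?mulr_ge0 //.
  by rewrite ler_pdivlMr // mulrC ler_pdivrMr.
rewrite [X in _ <= X](_ : _ = (c * (2 ^+ n.+1 * (q x)^-1 ^+ n.+1) * B') *
    ((1 + C) ^+ n * wt x ^+ (N * n))); last by ring.
apply: ler_pM => //; rewrite ?mulr_ge0 ?exprn_ge0 ?jet_ge0 ?addr_ge0 ?jet_ge0 //; first exact: sumr_ge0.
exact: (ler_wpM2r B0 J3).
Qed.

Lemma rdop_qinv m : rdop U (fun f x => (q x)^-1 ^+ m * f x).
Proof.
have oU := open_qpos; have sU := semialgebraic_qpos.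
elim: m => [|m IH].
  have := rdop_id oU sU; congr rdop; apply/funext => f; apply/funext => x.
  by rewrite expr0 mul1r.
have := rd_comp (rd_mult (nash_inv pq)) IH; congr rdop.
by apply/funext => f; apply/funext => x; rewrite exprS mulrA.
Qed.

Lemma cut_defect_op D h : rdop U D -> rsch U h ->
  exists K, 0 <= K /\ forall c, 0 < c -> c <= 1 -> forall x, U x ->
   `|D (fun x => (1 + -1 * cut c x) * h x) x| <= c * K.
Proof.
move=> rD rh; have oU := open_qpos; have sU := semialgebraic_qpos.
have [l [Hl El]] := rdop_leibniz oU sU rD.
suff [K [K0 HK]] : exists K, 0 <= K /\ forall c, 0 < c -> c <= 1 -> forall x, U x ->
    \sum_(e <- l) `|partials e.1 (fun x => 1 + -1 * cut c x) x * e.2 h x| <= c * K.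
  exists K; split=> // c c0 c1 x Ux; rewrite El //; last exact: rh.1.
    exact: le_trans (ler_norm_sum _ _ _) (HK c c0 c1 x Ux).
  apply: (smoothD oU (smooth_cst 1 oU)); apply: (smoothZ (-1) oU).
  by apply: smooth_sub (tempered_cut c).1.
elim: l Hl {El} => [|e l IH] Hl.
  by exists 0; split=> // c c0 c1 x Ux; rewrite big_nil mulr0.
have [K [K0 HK]] := IH (fun e He => Hl e (or_intror He)).
have re : rdop U e.2 by apply: Hl; left.
have [C [N [C0 HC]]] := cut_defect_jet (size e.1).
have rop := rd_comp (rdop_qinv (size e.1).+1) (rd_comp (rdop_pf oU sU (pf_exp N (@pf_wt R d))) re).
have [M HM] := rh.2 _ rop.
exists (C * `|M| + K); split; first by rewrite addr_ge0 // mulr_ge0.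
move=> c c0 c1 x Ux; rewrite big_cons mulrDr; apply: lerD; last exact: HK.
rewrite normrM.
apply: le_trans (_ : c * (C * ((q x)^-1 ^+ (size e.1).+1 * wt x ^+ N)) * `|e.2 h x| <= _).
  by rewrite ler_wpM2r //; apply: le_trans (norm_partials _ _ _) (HC c x c0 c1 Ux).
rewrite -!mulrA ler_wpM2l ?(ltW c0) // ler_wpM2l //.
have := HM x Ux; rewrite !normrM.
rewrite (ger0_norm (wtX_ge0 _ _)) ger0_norm ?exprn_ge0 ?invr_ge0 ?q0U //.
by move=> /le_trans; apply; exact: ler_norm.
Qed.

(** For a Schwartz function h on U the products of h with the cutoffs converge to h
    as c tends to 0: as q ^- n.+1 is a Nash function, it may multiply h, which makes
    the defect O(c) in each seminorm. *)
Lemma cut_nonzero S h : rdist U S -> rsch U h -> S h != 0 ->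
  exists c, 0 < c /\ S (fun x => cut c x * h x) != 0.
Proof.
move=> dS rh Sh; have oU := open_qpos; apply: contrapT => nex.
have Z c : 0 < c -> S (fun x => cut c x * h x) = 0.
  by move=> c0; apply: contrapT => /eqP nz; apply: nex; exists c.
have [r [D [C [C0 rD HC]]]] := dS.2.
have /choice[K HK] : forall i, exists K, 0 <= K /\ forall c, 0 < c -> c <= 1 -> forall x, U x ->
   `|D i (fun x => (1 + -1 * cut c x) * h x) x| <= c * K.
  by move=> i; exact: cut_defect_op.
pose K' := \sum_i K i.
have K0 : 0 <= K' by apply: sumr_ge0 => i _; case: (HK i).
have rdef c : 0 < c -> c <= 1 -> rsch U (fun x => (1 + -1 * cut c x) * h x).
  move=> c0 c1; split.
    apply: (smoothM oU) rh.1; apply: (smoothD oU (smooth_cst 1 oU)); apply: (smoothZ (-1) oU).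
    by apply: smooth_sub (tempered_cut c).1.
  by move=> E rE; have [L [L0 HL]] := cut_defect_op rE rh; exists (c * L) => x Ux; exact: HL.
have small c : 0 < c -> c <= 1 -> `|S h| <= C * (c * K').
  move=> c0 c1; have rd := rdef c c0 c1.
  have E : S h = S (fun x => (1 + -1 * cut c x) * h x).
    apply/eqP; rewrite -subr_eq0 -(rdistB oU dS rh rd).
    rewrite (_ : (fun x => _ - _) = fun x => cut c x * h x) ?Z //.
    by apply/funext => x; ring.
  rewrite E; apply: HC => // [|i x Ux]; first by rewrite mulr_ge0 // ltW.
  have [Ki HKi] := HK i; apply: le_trans (HKi c c0 c1 x Ux) _.
  rewrite ler_wpM2l ?(ltW c0) // /K' (bigD1 i) //= lerDl sumr_ge0 // => j _; by case: (HK j).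
have Sp : 0 < `|S h| by rewrite normr_gt0.
have L1 : 0 < C * K' + 1 by rewrite ltr_wpDl // mulr_ge0.
pose c := Num.min 1 (`|S h| / (2 * (C * K' + 1))).
have c0 : 0 < c by rewrite lt_min ltr01 divr_gt0 // mulr_gt0.
have c1 : c <= 1 by rewrite ge_min lexx.
have := small c c0 c1; rewrite leNgt => /negP; apply.
have c2 : c <= `|S h| / (2 * (C * K' + 1)) by rewrite ge_min lexx orbT.
rewrite mulrCA; apply: le_lt_trans (ler_wpM2r (mulr_ge0 C0 K0) c2) _.
rewrite mulrAC ltr_pdivrMr ?mulr_gt0 // ltr_pM2l //.
move: (C * K') (mulr_ge0 C0 K0) => u u0; lra.
Qed.

End Cutoff.

(** * Extending a distribution from a block of variables *)

Section DistributionLinearity.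
Variables (R : realType) (d : nat) (U : set 'rV[R]_d) (S : ('rV[R]_d -> R) -> R).
Hypotheses (oU : open U) (dS : rdist U S).

Lemma rdist0 : S (fun=> 0) = 0.
Proof.
have r0 := rsch0 oU; have := rdistB oU dS r0 r0; by rewrite !subrr.
Qed.

Lemma rdistZ a k : rsch U k -> S (fun x => a * k x) = a * S k.
Proof.
move=> sk; have := dS.1 a _ _ sk (rsch0 oU); rewrite rdist0 addr0 => <-.
by congr S; apply/funext => x; rewrite addr0.
Qed.

End DistributionLinearity.

Section Block.
Variables (R : realType) (d D : nat) (e : 'I_d -> 'I_D).
Hypothesis e_inj : injective e.
Local Notation V := 'rV[R]_d.
Local Notation W := 'rV[R]_D.
Implicit Types (g h : V -> R) (f : W -> R) (x : V) (z : W).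

Definition block : pred 'I_D := fun j => [exists k, e k == j].
Definition bproj : W -> V := csub 0 (fun k => Some (e k)).
Definition bincl : V -> W := csub 0 (fun j => [pick k | e k == j]).

Lemma bprojE z k : bproj z 0 k = z 0 (e k).
Proof. by rewrite mxE. Qed.

Lemma binclE x k : bincl x 0 (e k) = x 0 k.
Proof. by rewrite mxE; case: pickP => [k' /eqP /e_inj -> //|/(_ k)]; rewrite eqxx. Qed.

Lemma block_e k : block (e k).
Proof. by apply/existsP; exists k. Qed.

Lemma bproj_glue x z : bproj (glue block (bincl x) z) = x.
Proof. by apply/rowP => k; rewrite bprojE glueE block_e binclE. Qed.

Lemma bproj_inj j j' k : (fun k => Some (e k)) j = Some k -> (fun k => Some (e k)) j' = Some k -> j = j'.
Proof. by move=> [<-] [/e_inj]. Qed.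

Lemma bincl_inj j j' k : (fun j => [pick k | e k == j]) j = Some k ->
  (fun j => [pick k | e k == j]) j' = Some k -> j = j'.
Proof.
have E i : [pick k | e k == i] = Some k -> e k = i by case: pickP => // a /eqP + [<-].
by move=> /E <- /E <-.
Qed.

Lemma smooth_bproj g : smooth_on setT g -> smooth_on setT (fun z => g (bproj z)).
Proof. exact: (@smooth_csub R D d 0 _ bproj_inj g). Qed.

Lemma jet_bproj n g z : jet n (fun z => g (bproj z)) z <= jet n g (bproj z).
Proof. exact: (@jet_csub R D d 0 _ bproj_inj n g z). Qed.

Lemma smooth_bincl f : smooth_on setT f -> smooth_on setT (fun x => f (bincl x)).
Proof. exact: (@smooth_csub R d D 0 _ bincl_inj f). Qed.

Lemma jet_bincl n f x : jet n (fun x => f (bincl x)) x <= jet n f (bincl x).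
Proof. exact: (@jet_csub R d D 0 _ bincl_inj n f x). Qed.

Lemma sum_block (F : 'I_D -> R) : \sum_(j | block j) F j = \sum_k F (e k).
Proof.
rewrite (eq_bigl (fun j => j \in codom e)); last first.
  by move=> j; rewrite /block; apply/existsP/codomP => [[k /eqP <-]|[k ->]]; exists k.
by rewrite (reindex_omap e (fun j => [pick k | e k == j])) /=; [apply: eq_bigl => k|
   move=> j /codomP[k ->]]; case: pickP => [k' /eqP /e_inj -> //=|/(_ k)];
   rewrite ?codom_f ?eqxx.
Qed.

Lemma wtA_proj z : wtA block z = wt (bproj z).
Proof. by rewrite /wtA /wt sum_block; congr (1 + _); apply: eq_bigr => k _; rewrite bprojE. Qed.

Lemma wtA_incl x : wtA block (bincl x) = wt x.
Proof. by rewrite /wtA /wt sum_block; congr (1 + _); apply: eq_bigr => k _; rewrite binclE. Qed.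

Lemma rapidA_proj g : rapid g -> rapidA block (fun z => g (bproj z)).
Proof.
move=> [sg bg]; split; first exact: smooth_bproj.
  move=> x y xy; congr g; apply/rowP => k; rewrite !bprojE; apply: xy; exact: block_e.
move=> n N; have [M HM] := bg n N; exists M => z; apply: le_trans (HM (bproj z)).
rewrite wtA_proj ler_wpM2l ?wtX_ge0 //; exact: jet_bproj.
Qed.

Lemma rapid_incl f : rapidA block f -> rapid (fun x => f (bincl x)).
Proof.
move=> [sf _ bf]; split; first exact: smooth_bincl.
move=> n N; have [M HM] := bf n N; exists M => x; apply: le_trans (HM (bincl x)).
rewrite wtA_incl ler_wpM2l ?wtX_ge0 //; exact: jet_bincl.
Qed.

Lemma rapidA_incl_proj f z : rapidA block f -> f (bincl (bproj z)) = f z.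
Proof.
by move=> [_ df _]; apply: df => j /existsP[k /eqP <-]; rewrite binclE bprojE.
Qed.

Lemma pf_bproj g : pf g -> pf (fun z => g (bproj z)).
Proof.
elim=> [c|k|g1 g2 _ p1 _ p2|g1 g2 _ p1 _ p2]; [exact: pf_cst| |exact: pf_add|exact: pf_mul].
by rewrite (_ : (fun z => _) = fun z => z 0 (e k)); [exact: pf_coord|apply/funext => z; rewrite bprojE].
Qed.

Lemma tdist_slice T f z0 : tdist T -> rapid f ->
  tdist (fun g => T (fun z => g (bproj z) * f (glue block z0 z))).
Proof.
move=> dT rf; split.
  move=> a g h rg rh; rewrite -dT.1; [|exact: (rapid_tensor z0 (rapidA_proj rg) rf)|exact: (rapid_tensor z0 (rapidA_proj rh) rf)].
  by congr T; apply/funext => z; rewrite mulrDl mulrA.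
have [n [N [C [C0 HC]]]] := dT.2; have [sf bf] := rf; have [M0 HM0] := bf n (N + 0)%N.
exists n, N, (C * M0); split.
  by rewrite mulr_ge0 // (le_trans _ (HM0 0)) // mulr_ge0 ?wtX_ge0 ?jet_ge0.
move=> g rg M HM; rewrite -mulrA; apply: HC; first exact: (rapid_tensor z0 (rapidA_proj rg) rf).
move=> z; have sg := (rapidA_proj rg); case: sg => sg _ _.
have := tensor_bound block n N 0 z0 z sg sf; rewrite expr0 mul1r => /le_trans; apply.
rewrite [M0 * M]mulrC; apply: ler_pM => //; rewrite ?mulr_ge0 ?wtAX_ge0 ?wtX_ge0 ?jet_ge0 //.
apply: le_trans (HM (bproj z)).
rewrite wtA_proj ler_wpM2l ?wtX_ge0 //; exact: jet_bproj.
Qed.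

(** By density of products: a distribution all of whose slices vanish is zero. *)
Lemma slice_nonzero T f : tdist T -> rapid f -> T f != 0 ->
  exists g f' z0, [/\ rapid g, rapid f' & T (fun z => g (bproj z) * f' (glue block z0 z)) != 0].
Proof.
move=> dT rf Tf; apply: contrapT => nex; move/eqP: Tf; apply.
apply: (@tensor_dense _ _ block _ dT _ _ rf) => g f' z0 rg rf'; apply: contrapT => /eqP nz; apply: nex.
exists (fun x => g (bincl x)), f', z0; split=> //; first exact: rapid_incl.
move: nz; congr (T _ != 0); apply/funext => z; by rewrite rapidA_incl_proj.
Qed.

Section Extension.
Variables (p : nat -> R -> R) (q : V -> R) (c : R).
Hypotheses (sp : smooth1 p) (p_lt0 : forall n t, t < 0 -> p n t = 0)
  (p_bd : forall n, exists B, forall t, `|p n t| <= B).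
Hypotheses (pq : pf q) (c0 : 0 < c).
Variables (U0 : set V) (U : set W).
Hypotheses (oU0 : open U0) (oU : open U) (sU : semialgebraic U).
Hypotheses (qU0 : forall x, c <= q x -> U0 x) (qU : forall z, c <= q (bproj z) -> U z).

(** On functions supported where c <= q the distribution S is as good as tempered. *)
Lemma rdist_cut_bound S : rdist U0 S -> exists n N C, 0 <= C /\ forall h, rapid h ->
  (forall x, q x < c -> h x = 0) -> forall M, (forall x, wt x ^+ N * jet n h x <= M) ->
  `|S h| <= C * M.
Proof.
move=> [_ [r [E [C [C0 rE HC]]]]].
have /choice[a Ha] : forall i, exists a : nat * nat * R, 0 <= a.2 /\ forall h, rapid h ->
   (forall x, q x < c -> h x = 0) ->
   forall M, (forall x, wt x ^+ a.1.2 * jet a.1.1 h x <= M) -> forall x, U0 x -> `|E i h x| <= a.2 * M.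
  by move=> i; have [n [N [K [K0 HK]]]] := rapid_op_bound oU0 pq qU0 (rE i); exists (n, N, K).
pose n := (\max_i (a i).1.1)%N; pose N := (\max_i (a i).1.2)%N; pose K := \sum_i (a i).2.
have K0 : 0 <= K by apply: sumr_ge0 => i _; case: (Ha i).
exists n, N, (C * K); split; first exact: mulr_ge0.
move=> h rh h0 M HM; have M0 : 0 <= M.
  by apply: le_trans (HM 0); rewrite mulr_ge0 ?wtX_ge0 ?jet_ge0.
rewrite -mulrA; apply: HC; [exact: rapid_rsch oU0 pq qU0 rh h0|exact: mulr_ge0|].
move=> i x Ux; have [ai0 Hai] := Ha i.
apply: (@le_trans _ _ ((a i).2 * M)); last first.
  rewrite ler_wpM2r // /K (bigD1 i) //= lerDl; apply: sumr_ge0 => j _; by case: (Ha j).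
apply: Hai => // y; apply: le_trans (HM y); apply: ler_pM; rewrite ?wtX_ge0 ?jet_ge0 //.
  by rewrite ler_weXn2l ?wt_ge1 // /N (bigD1 i) //= leq_maxl.
by apply: jet_mono; rewrite /n (bigD1 i) //= leq_maxl.
Qed.

Variables (T : (W -> R) -> R) (g : V -> R) (S : (V -> R) -> R).
Hypotheses (dT : tdist T) (rg : rapid g) (dS : rdist U0 S).

Definition bcut f z := cut p (fun z => q (bproj z)) c z * f z.
(** The extension of S is the composite of S with this map. It pairs the variables
    off the block with T; the factor g in the block makes the pairing possible. *)
Definition bcontract f x := contract block T (fun z => g (bproj z)) (bcut f) (bincl x).

Lemma rapid_bcut f : rsch U f -> rapid (bcut f).
Proof. by apply: cutoff_rapid; [exact: sp|exact: p_lt0|exact: p_bd|exact: pf_bproj|..]. Qed.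

Lemma bcontractE f x : bcontract f x =
  T (fun z => g (bproj z) * (cut p q c x * f (glue block (bincl x) z))).
Proof.
rewrite /bcontract /contract /bcut /cut; congr T; apply/funext => z; rewrite [bproj (glue _ _ _)]bproj_glue.
by [].
Qed.

Lemma rapid_bcontract f : rsch U f -> rapid (bcontract f) /\ (forall x, q x < c -> bcontract f x = 0).
Proof.
move=> /rapid_bcut rf; split; last first.
  move=> x qx; rewrite bcontractE (_ : (fun z => _) = fun=> 0); first exact: tdist0.
  by apply/funext => z; rewrite cut_lt // mul0r mulr0.
have rA := rapidA_proj rg; split.
  exact: (smooth_bincl (contract_smooth dT rA rf)).
move=> n N; have [n' [N' [C [C0 HC]]]] := contract_jet_bound dT rA.
have [M HM] := rf.2 (n' + n)%N (N' + N)%N; exists ((1 + D%:R) ^+ n * (C * M)) => x.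
apply: le_trans (HC n _ rf N M HM (bincl x)).
by rewrite wtA_incl ler_wpM2l ?wtX_ge0 // jet_bincl.
Qed.

Lemma rsch_bcontract f : rsch U f -> rsch U0 (bcontract f).
Proof. by move=> /rapid_bcontract[r0 z0]; exact: rapid_rsch oU0 pq qU0 r0 z0. Qed.

(** The three steps f, bcut f and bcontract f are continuous: the cutoff turns
    Schwartz functions on U into rapidly decreasing ones, the contraction keeps
    rapid decrease, and functions supported where c <= q are Schwartz on U0. *)
Lemma rdist_extension : rdist U (fun f => S (bcontract f)).
Proof.
split.
  move=> a f h sf sh; rewrite -dS.1; [|exact: rsch_bcontract|exact: rsch_bcontract].
  congr S; apply/funext => x.
  have rA := rapidA_proj rg.
  have rf := rapid_bcut sf; have rh := rapid_bcut sh.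
  rewrite /bcontract -(tdist_tensor (bincl x) dT rA).1 //; congr T; apply/funext => z.
  by rewrite /bcut mulrDr mulrCA.
have [n [N [C [C0 HC]]]] := rdist_cut_bound dS.
have [n' [N' [C' [C'0 HC']]]] := contract_jet_bound dT (rapidA_proj rg).
have [r [E [K [K0 rE HK]]]] := @cutoff_bound _ _ p _ sp p_lt0 p_bd (pf_bproj pq) U c (n' + n) (N' + N) oU sU c0 qU.
exists r, E, (C * ((1 + D%:R) ^+ n * (C' * K))); split=> //.
  by rewrite !mulr_ge0 // exprn_ge0 // addr_ge0.
move=> f sf M M0 HM; have [rf f0] := rapid_bcontract sf.
rewrite -!mulrA; apply: HC => // x.
apply: le_trans (HC' n _ (rapid_bcut sf) N (K * M) (HK f sf.1 M M0 HM) (bincl x)).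
by rewrite wtA_incl ler_wpM2l ?wtX_ge0 // jet_bincl.
Qed.

Hypothesis p_gt1 : forall t, 1 < t -> p 0%N t = 1.

(** As c2 > 2 c, the cutoff at c is 1 on the support of the cutoff at c2, so on a
    product the extension is the product of the two pairings. *)
Lemma extension_tensor c2 h f' z0 : 2 * c < c2 -> semialgebraic U0 -> rsch U0 h -> rapid f' ->
  let f := fun z => (cut p q c2 (bproj z) * h (bproj z)) * f' (glue block z0 z) in
  rsch U f /\ S (bcontract f) =
    T (fun z => g (bproj z) * f' (glue block z0 z)) * S (fun x => cut p q c2 x * h x).
Proof.
move=> cc2 sU0 sh rf' f; have c20 : 0 < c2 by apply: lt_trans cc2; rewrite mulr_gt0.
have cle : c <= c2 by apply: le_trans (ltW cc2); rewrite ler_peMl ?ltW // ltr1n.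
have rh : rapid (fun x => cut p q c2 x * h x).
  apply: (@cutoff_rapid _ _ p q sp p_lt0 p_bd pq U0 c2 h oU0 sU0 c20 _ sh).
  by move=> x qx; apply: qU0; exact: le_trans qx.
have rA := rapidA_proj rh.
have rf : rapid f by exact: (rapid_tensor z0 rA rf').
have pqp := pf_bproj pq.
split.
  apply: (rapid_rsch (q := fun z => q (bproj z)) (c := c2) oU pqp _ rf) => z qz.
    by apply: qU; exact: le_trans qz.
  by rewrite /f cut_lt // !mul0r.
have sh0 : rsch U0 (fun x => cut p q c2 x * h x).
  apply: (rapid_rsch (q := q) (c := c2) oU0 pq _ rh) => x qx; last by rewrite cut_lt // mul0r.
  by apply: qU0; exact: le_trans qx.
rewrite -(@rdistZ _ _ U0 S oU0 dS _ _ sh0); congr S; apply/funext => x; rewrite bcontractE.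
have r1 := rapid_tensor z0 (rapidA_proj rg) rf'.
rewrite [RHS]mulrC -(tdistZ _ dT r1); congr T; apply/funext => z.
rewrite /f bproj_glue; have -> : glue block z0 (glue block (bincl x) z) = glue block z0 z.
  by apply/rowP => j; rewrite !glueE; case: (block j).
have [qx|qx] := ltP (q x) c2; first by rewrite (cut_lt p_lt0 c20 qx) !(mul0r, mulr0).
rewrite (cut_gt p_gt1 c0) ?(lt_le_trans cc2) // mul1r; ring.
Qed.

End Extension.
End Block.

(** * Finiteness of bases of zero sets *)

Section FiniteBasis.

(** Dickson's lemma, by induction on the number of exponents. The weight w lets the
    induction forget the first exponent without changing the set. *)
Lemma dickson n (T : eqType) (S : set T) (w : T -> 'I_n -> nat) :
  exists s : seq T, (forall t, t \in s -> S t) /\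
    forall t, S t -> exists2 t', t' \in s & forall i, (w t' i <= w t i)%N.
Proof.
elim: n T S w => [|n IH] T S w.
  have [[t St]|nS] := pselect (exists t, S t); last by exists [::]; split=> // t St; case: nS; exists t.
  exists [:: t]; split=> [t'|t' _]; first by rewrite inE => /eqP ->.
  by exists t; rewrite ?inE // => -[].
have [s0 [s0S Hs0]] := IH T S (fun t i => w t (lift ord0 i)).
have /choice[s Hs] := fun b => IH T [set t | S t /\ w t ord0 = b] (fun t i => w t (lift ord0 i)).
pose B := (\max_(t <- s0) w t ord0)%N.
exists (s0 ++ flatten [seq s b | b <- iota 0 B]); split.
  move=> t; rewrite mem_cat => /orP[/s0S //|/flatten_mapP[b _ tb]].
  by have [H _] := Hs b; case: (H t tb).
move=> t St; have [Bt|tB] := leqP B (w t ord0).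
  have [t' t's Ht'] := Hs0 t St; exists t'; first by rewrite mem_cat t's.
  move=> i; have [j ->|->] := unliftP ord0 i; first exact: Ht'.
  by apply: leq_trans Bt; rewrite /B (big_rem t') //= leq_maxl.
have [_ H] := Hs (w t ord0); have [t' t's Ht'] := H t (conj St erefl).
exists t'; first by rewrite mem_cat; apply/orP; right; apply/flatten_mapP; exists (w t ord0); rewrite ?mem_iota.
have [Ht _] := Hs (w t ord0); have [_ E] := Ht t' t's.
by move=> i; have [j ->|->] := unliftP ord0 i; [exact: Ht'|rewrite E].
Qed.

(** Hilbert's basis theorem for zero sets. The polynomials that vanish where some
    finite subset of E vanishes form an ideal I. Dickson's lemma selects finitely
    many leading monomials, and division by them reduces every element of I to 0. *)
Lemma zeros_finite n (F : fieldType) (E : set (mpoly.mpoly n F)) :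
  exists s : seq (mpoly.mpoly n F), (forall p, p \in s -> E p) /\
    forall x, (forall p, p \in s -> mpoly.meval x p = 0) -> forall p, E p -> mpoly.meval x p = 0.
Proof.
pose I (p : mpoly.mpoly n F) := exists s : seq (mpoly.mpoly n F), (forall p, p \in s -> E p) /\
   forall x, (forall p, p \in s -> mpoly.meval x p = 0) -> mpoly.meval x p = 0.
have [b [bI Hb]] := dickson (fun p => I p /\ p != 0) (fun p (i : 'I_n) => mpoly.fun_of_multinom (mpoly.mlead p) i).
have H p : I p -> forall x, (forall q, q \in b -> mpoly.meval x q = 0) -> mpoly.meval x p = 0.
  move=> Ip x xb; move: p Ip; apply: mpoly.mleadrect => p IH Ip.
  have [->|p0] := eqVneq p 0; first by rewrite mpoly.meval0.
  have [q qb Hq] := Hb p (conj Ip p0); have [Iq q0] := bI q qb.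
  pose m := mpoly.mnm_sub (mpoly.mlead p) (mpoly.mlead q).
  have lm : mpoly.mnm_add m (mpoly.mlead q) = mpoly.mlead p by apply/mpoly.submK/mpoly.mnm_lepP.
  pose c := mpoly.mcoeff (mpoly.mlead p) p / mpoly.mcoeff (mpoly.mlead q) q.
  have lq : mpoly.mcoeff (mpoly.mlead q) q != 0 by rewrite mpoly.mleadc_eq0.
  have lp : mpoly.mcoeff (mpoly.mlead p) p != 0 by rewrite mpoly.mleadc_eq0.
  pose X := mpoly.mpolyX F m.
  pose r := p - (c *: X) * q.
  have xr : mpoly.meval x r = mpoly.meval x p.
    by rewrite mpoly.mevalB mpoly.mevalM (xb q qb) mulr0 subr0.
  rewrite -xr; have [->|r0] := eqVneq r 0; first by rewrite mpoly.meval0.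
  apply: IH.
    have lX : mpoly.mlead (c *: X) = m.
      by rewrite mpoly.mleadZ_proper ?mpoly.mleadXm // mpoly.mcoeffX eqxx mulr1 mulf_neq0 ?invr_eq0.
    have cX : mpoly.mcoeff (mpoly.mlead (c *: X)) (c *: X) = c.
      by rewrite lX mpoly.mcoeffZ mpoly.mcoeffX eqxx mulr1.
    have c0 : c != 0 by rewrite mulf_neq0 ?invr_eq0.
    have lXq : mpoly.mlead ((c *: X) * q) = mpoly.mlead p.
      by rewrite mpoly.mleadM_proper ?lX // -[in X in X != 0]lX cX mulf_neq0.
    have le : (mpoly.mlead r <= mpoly.mlead p)%O.
      by apply: (le_trans (mpoly.mleadB_le _ _)); rewrite lXq joinxx.
    rewrite lt_neqAle le andbT; apply: contra r0 => /eqP rp.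
    rewrite -mpoly.mleadc_eq0 rp mpoly.mcoeffB -{2}lm [mpoly.mnm_add _ _](_ : _ = mpoly.mnm_add (mpoly.mlead (c *: X)) (mpoly.mlead q)) ?lX //.
    by rewrite -lX mpoly.mleadcM cX divfK // subrr.
  have [[s [sE Hs]] [s' [s'E Hs']]] := (Ip, Iq).
  exists (s ++ s'); split=> [f|y Hy]; first by rewrite mem_cat => /orP[/sE|/s'E].
  rewrite mpoly.mevalB mpoly.mevalM Hs; last by move=> f fs; apply: Hy; rewrite mem_cat fs.
  by rewrite Hs' ?mulr0 ?subrr // => f fs; apply: Hy; rewrite mem_cat fs orbT.
have /choice[s Hs] : forall p, exists s : seq (mpoly.mpoly n F), p \in b -> (forall p, p \in s -> E p) /\
   forall x, (forall p, p \in s -> mpoly.meval x p = 0) -> mpoly.meval x p = 0.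
  by move=> p; have [/bI[[s Hs] _]|_] := boolP (p \in b); [exists s|exists [::]].
exists (flatten [seq s p | p <- b]); split.
  by move=> p /flatten_mapP[q qb]; have [H1 _] := Hs q qb; exact: H1.
move=> x Hx p Ep; apply: H; first by exists [:: p]; split=> [q|y Hy]; [rewrite inE => /eqP ->|apply: Hy; rewrite inE].
move=> q qb; have [_ H2] := Hs q qb; apply: H2 => f fs; apply: Hx; apply/flatten_mapP; by exists q.
Qed.

End FiniteBasis.

(** * Complex polynomials in real coordinates *)

Section ComplexCoordinates.
Variables (R : realType) (n : nat).
Local Notation C := R[i].
Local Notation V := 'rV[R]_(n + n).

Definition rvec (v : 'cV[C]_n) : V :=
  \row_k match fintype.split k with inl i => complex.Re (v i 0) | inr i => complex.Im (v i 0) end.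

Lemma rvecK : cancel rvec (@cvec R n).
Proof.
move=> v; apply/colP => i; rewrite !mxE (unsplitK (inl i)) (unsplitK (inr i)).
by case: (v i 0).
Qed.

Lemma cvecK : cancel (@cvec R n) rvec.
Proof. by move=> x; apply/rowP => k; rewrite mxE; case: split_ordP => i ->; rewrite mxE. Qed.

Definition cpf (f : V -> C) := pf (fun x => complex.Re (f x)) /\ pf (fun x => complex.Im (f x)).

Lemma cpf_cst c : cpf (fun=> c).
Proof. by split; exact: pf_cst. Qed.

Lemma cpfD f g : cpf f -> cpf g -> cpf (fun x => f x + g x).
Proof.
move=> [f1 f2] [g1 g2]; split.
  by rewrite (_ : (fun x => _) = fun x => complex.Re (f x) + complex.Re (g x)); [exact: pf_add|apply/funext => x; case: (f x) (g x) => a b [c d]].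
by rewrite (_ : (fun x => _) = fun x => complex.Im (f x) + complex.Im (g x)); [exact: pf_add|apply/funext => x; case: (f x) (g x) => a b [c d]].
Qed.

Lemma cpfM f g : cpf f -> cpf g -> cpf (fun x => f x * g x).
Proof.
move=> [f1 f2] [g1 g2]; split.
  rewrite (_ : (fun x => _) = fun x => complex.Re (f x) * complex.Re (g x) + (-1) * (complex.Im (f x) * complex.Im (g x))).
    by apply: pf_add; [exact: pf_mul|apply: pf_mul; [exact: pf_cst|exact: pf_mul]].
  by apply/funext => x; case: (f x) (g x) => a b [c d] /=; rewrite mulN1r.
rewrite (_ : (fun x => _) = fun x => complex.Re (f x) * complex.Im (g x) + complex.Im (f x) * complex.Re (g x)).
  by apply: pf_add; exact: pf_mul.
by apply/funext => x; case: (f x) (g x) => a b [c d].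
Qed.

Lemma cpf_sum (I : Type) (s : seq I) (F : I -> V -> C) : (forall i, cpf (F i)) -> cpf (fun x => \sum_(i <- s) F i x).
Proof.
move=> HF; elim: s => [|i s IH].
  by rewrite (_ : (fun x => _) = fun=> 0); [exact: cpf_cst|apply/funext => x; rewrite big_nil].
by rewrite (_ : (fun x => _) = fun x => F i x + \sum_(i <- s) F i x); [exact: cpfD|apply/funext => x; rewrite big_cons].
Qed.

Lemma cpf_prod (I : Type) (s : seq I) (F : I -> V -> C) : (forall i, cpf (F i)) -> cpf (fun x => \prod_(i <- s) F i x).
Proof.
move=> HF; elim: s => [|i s IH].
  by rewrite (_ : (fun x => _) = fun=> 1); [exact: cpf_cst|apply/funext => x; rewrite big_nil].
by rewrite (_ : (fun x => _) = fun x => F i x * \prod_(i <- s) F i x); [exact: cpfM|apply/funext => x; rewrite big_cons].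
Qed.

Lemma cpf_peval p : cpf (fun x => peval p (@cvec R n x)).
Proof.
have cc i : cpf (fun x : V => @cvec R n x i 0).
  have E1 : (fun x : V => complex.Re (@cvec R n x i 0)) = fun x : V => x 0 (lshift n i).
    by apply/funext => x; rewrite mxE.
  have E2 : (fun x : V => complex.Im (@cvec R n x i 0)) = fun x : V => x 0 (rshift n i).
    by apply/funext => x; rewrite mxE.
  by split; rewrite ?E1 ?E2; exact: pf_coord.
rewrite /peval; have -> : (fun x : V => mpoly.meval (fun k => @cvec R n x k 0) p) =
   fun x => \sum_(m <- mpoly.msupp p) mpoly.mcoeff m p * \prod_i (@cvec R n x i 0) ^+ mpoly.fun_of_multinom m i.
  by apply/funext => x; rewrite mpoly.mevalE.
apply: cpf_sum => m; apply: cpfM; first exact: cpf_cst.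
apply: cpf_prod => i; elim: (mpoly.fun_of_multinom m i) => [|k IH].
  by rewrite (_ : (fun x => _) = fun=> 1); [exact: cpf_cst|apply/funext => x; rewrite expr0].
rewrite (_ : (fun x => _) = fun x => @cvec R n x i 0 * (@cvec R n x i 0) ^+ k); first exact: cpfM.
by apply/funext => x; rewrite exprS.
Qed.

Lemma cnormsq_gt0 (c : C) : (0 < complex.Re c ^+ 2 + complex.Im c ^+ 2) = (c != 0).
Proof.
case: c => a b; rewrite eq_complex /= negb_and lt_neqAle addr_ge0 ?sqr_ge0 // andbT eq_sym.
by rewrite paddr_eq0 ?sqr_ge0 // !sqrf_eq0 negb_and.
Qed.

(** The sum of the squared norms of finitely many members of E is a polynomial in the
    real coordinates whose zeros are the common zeros of E. *)
Lemma nonzero_pf (E : set (mpoly.mpoly n C)) : exists s : seq (mpoly.mpoly n C),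
  (forall p, p \in s -> E p) /\
  let q := fun x : V => \sum_(p <- s) (complex.Re (peval p (cvec x)) ^+ 2 + complex.Im (peval p (cvec x)) ^+ 2) in
  [/\ pf q, forall x, 0 <= q x & forall x, 0 < q x <-> exists2 p, E p & peval p (cvec x) != 0].
Proof.
have [s [sE Hs]] := zeros_finite E; exists s; split=> // q.
have q0 x : 0 <= q x by apply: sumr_ge0 => p _; rewrite addr_ge0 ?sqr_ge0.
split=> //.
  by apply: pf_sum => p; have [p1 p2] := cpf_peval p; apply: pf_add; exact: pf_exp.
move=> x; split=> [qx|[p Ep px]].
  apply: contrapT => nex; move: qx; rewrite /q big_seq big1 ?ltxx // => p ps.
  have -> : peval p (cvec x) = 0 by apply: contrapT => /eqP px; apply: nex; exists p => //; exact: sE.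
  by rewrite /= expr0n addr0.
rewrite lt_neqAle q0 andbT eq_sym; apply: contra px; rewrite psumr_eq0 => [/allP Hq|p' _]; last by rewrite addr_ge0 ?sqr_ge0.
apply/eqP/Hs => // p' p's; apply/eqP; have := Hq p' p's; rewrite /= => /eqP z.
by apply: contraT => /negbTE nz; have := cnormsq_gt0 (peval p' (cvec x)); rewrite z ltxx => /esym/negbFE; rewrite nz.
Qed.

End ComplexCoordinates.

(** * The group J and its characters *)

Section MatrixGroups.
Variable F : fieldType.

Lemma invmx_mul n (g h : 'M[F]_n) : g \in unitmx -> h \in unitmx ->
  invmx (g *m h) = invmx h *m invmx g.
Proof.
move=> ug uh; have ugh : g *m h \in unitmx by rewrite unitmx_mul ug.
have E : (g *m h) *m (invmx h *m invmx g) = 1%:M by rewrite -mulmxA mulKVmx // mulmxV.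
by rewrite -[RHS](mulKmx ugh) E mulmx1.
Qed.

(** A commutator in a group as a product of squares and conjugates of squares. *)
Lemma comm_square_word n (j k a b : 'M[F]_n) :
  (forall x : 'M[F]_n, k *m (b *m x) = x) -> (forall x : 'M[F]_n, b *m (k *m x) = x) ->
  (forall x : 'M[F]_n, j *m (a *m x) = x) -> a *m j = 1%:M ->
  j *m k = j *m k *m (j *m k) *m (b *m (a *m a) *m k *m (b *m b)) *m (k *m j).
Proof. by move=> kb bk ja aj; rewrite -!mulmxA !kb ja bk aj mulmx1. Qed.

Lemma meval_linear_form K (a v : 'I_K -> F) :
  let f : mpoly.mpoly K F := \sum_k a k *: mpoly.mpolyX F (mpoly.mnm1 k) in
  mpoly.meval v f = \sum_k a k * v k /\ forall t, mpoly.meval v (mpoly.mderiv t f) = a t.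
Proof.
move=> f; split=> [|t].
  rewrite /f (big_morph _ (mpoly.mevalD v) (mpoly.meval0 v)); apply: eq_bigr => k _.
  by rewrite mpoly.mevalZ mpoly.mevalXU.
rewrite /f (big_morph _ (mpoly.mderivD t) (mpoly.mderiv0 F t)) (big_morph _ (mpoly.mevalD v) (mpoly.meval0 v)).
rewrite (bigD1 t) //= big1 ?addr0 => [|k kt].
  rewrite mpoly.mderivZ mpoly.mevalZ mpoly.mderivX mpoly.mnm1E eqxx scale1r mpoly.mevalX big1 ?mulr1 // => i _.
  by rewrite mpoly.mnmBE subnn.
by rewrite mpoly.mderivZ mpoly.mevalZ mpoly.mderivX mpoly.mnm1E (negbTE kt) scale0r mpoly.meval0 mulr0.
Qed.

(** An entry of c g - g c, where w lists the entries of g and of its inverse. *)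
Definition commutator_entry N (c : 'M[F]_N) i j (w : 'rV[F]_(N * N + N * N)) :=
  (c *m vec_mx (lsubmx w)) i j - (vec_mx (lsubmx w) *m c) i j.

Lemma commutator_entry_linear N (c : 'M[F]_N) i j (w : 'rV[F]_(N * N + N * N)) :
  \sum_k commutator_entry c i j (delta_mx 0 k) * w 0 k = commutator_entry c i j w.
Proof.
have lin a u v : commutator_entry c i j (a *: u + v) = a * commutator_entry c i j u + commutator_entry c i j v.
  by rewrite /commutator_entry !linearP /= mulmxDl -scalemxAl !mxE; ring.
have c0 : commutator_entry c i j 0 = 0 by have := lin (-1) 0 0; rewrite scaler0 addr0 mulN1r addNr.
have cD u v : commutator_entry c i j (u + v) = commutator_entry c i j u + commutator_entry c i j v.
  by have := lin 1 u v; rewrite scale1r mul1r.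
rewrite [in RHS](row_sum_delta w) (big_morph _ cD c0); apply: eq_bigr => k _.
by rewrite -[_ *: _]addr0 lin c0 addr0 mulrC.
Qed.

End MatrixGroups.

Section ElementaryQuotient.
Variables (R : realType) (n : nat).
Local Notation M := 'M[R[i]]_n.

(** J / L is an elementary abelian 2-group; that L is normal in J and that J is
    closed under inverses follow from this. *)
Definition square_in (L J : set M) := [/\ mxgroup L, L `<=` J,
  forall j k, J j -> J k -> J (j *m k) & forall j, J j -> L (j *m j)].

Variables (L J : set M).
Hypothesis LJ : square_in L J.

Lemma grp1 : L 1%:M. Proof. by case: LJ => -[]. Qed.
Lemma grpM g h : L g -> L h -> L (g *m h). Proof. by case: LJ => -[_ _ H _] _ _ _; exact: H. Qed.
Lemma grpV g : L g -> L (invmx g). Proof. by case: LJ => -[_ _ _ H] _ _ _; exact: H. Qed.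
Lemma grp_sub g : L g -> J g. Proof. by case: LJ => _ H _ _; exact: H. Qed.
Lemma grpJM g h : J g -> J h -> J (g *m h). Proof. by case: LJ => _ _ H _; exact: H. Qed.
Lemma grp_sqr g : J g -> L (g *m g). Proof. by case: LJ => _ _ _ H; exact: H. Qed.

Lemma grp_unit j : J j -> j \in unitmx.
Proof. by move=> /grp_sqr; case: LJ => -[H _ _ _] _ _ _ /H /=; rewrite unitmx_mul andbb. Qed.

Lemma grpJV j : J j -> J (invmx j).
Proof.
move=> Jj; have uj := grp_unit Jj; rewrite -[invmx j]mul1mx -(mulmxV uj) -mulmxA -invmx_mul //.
by apply: grpJM => //; apply/grp_sub/grpV/grp_sqr.
Qed.

(** j l j^-1 = (j l)^2 l^-1 j^-2. *)
Lemma grp_normal j l : J j -> L l -> L (j *m l *m invmx j).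
Proof.
move=> Jj Ll; have uj := grp_unit Jj; have ul := grp_unit (grp_sub Ll).
have -> : j *m l *m invmx j = (j *m l) *m (j *m l) *m (invmx l *m invmx (j *m j)).
  rewrite invmx_mul // -!mulmxA; do 2![congr (_ *m _)].
  by rewrite [l *m (invmx l *m _)]mulmxA mulmxV // mul1mx mulmxA mulmxV // mul1mx.
by apply: grpM; [apply: grp_sqr; apply: grpJM => //; exact: grp_sub|apply: grpM; apply: grpV => //; exact: grp_sqr].
Qed.

(** A group in which all squares are trivial is commutative. *)
Lemma grp_comm j k : J j -> J k -> exists2 l, L l & j *m k = l *m (k *m j).
Proof.
move=> Jj Jk; have uj := grp_unit Jj; have uk := grp_unit Jk.
exists ((j *m k) *m (j *m k) *m ((invmx k *m invmx (j *m j) *m k) *m invmx (k *m k))).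
  apply: grpM; first exact/grp_sqr/grpJM.
  apply: grpM; last exact/grpV/grp_sqr.
  have := grp_normal (grpJV Jk) (grpV (grp_sqr Jj)).
  by rewrite invmxK.
rewrite !invmx_mul //; apply: comm_square_word.
- exact: mulKVmx.
- exact: mulKmx.
- exact: mulKVmx.
- exact: mulVmx.
Qed.

Let A := [set mxcoset L g | g in J].

Lemma coset1 : mxcoset L 1%:M = L.
Proof. by apply/seteqP; split=> [x [l Ll <-]|x Lx]; rewrite ?mul1mx //; exists x; rewrite ?mul1mx. Qed.

Lemma cosets_grp : A L.
Proof. by exists 1%:M; [exact/grp_sub/grp1|exact: coset1]. Qed.

Lemma cosets_J K j : A K -> K j -> J j.
Proof. by move=> [g Jg <-] [l Ll <-]; apply: grpJM => //; exact: grp_sub. Qed.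

Lemma mulset_grp_l K : A K -> mulset L K = K.
Proof.
move=> [g Jg <-]; apply/seteqP; split=> [_ [l Ll [_ [l' Ll' <-] <-]]|_ [l Ll <-]].
  exists (invmx g *m l *m g *m l').
    by apply: grpM => //; have := grp_normal (grpJV Jg) Ll; rewrite invmxK.
  by rewrite -!mulmxA mulKVmx // grp_unit.
exists 1%:M; first exact: grp1.
by exists (g *m l); [exists l|rewrite mul1mx].
Qed.

Lemma mulset_grp_r K : A K -> mulset K L = K.
Proof.
move=> [g Jg <-]; apply/seteqP; split=> [_ [_ [l Ll <-] [l' Ll' <-]]|_ [l Ll <-]].
  by exists (l *m l'); [exact: grpM|rewrite mulmxA].
by exists (g *m l); [exists l|exists 1%:M; [exact: grp1|rewrite mulmx1]].
Qed.

Lemma mulset_sqr K : A K -> mulset K K = L.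
Proof.
move=> [g Jg <-]; apply/seteqP; split=> [_ [_ [l Ll <-] [_ [l' Ll' <-] <-]]|l Ll].
  rewrite -mulmxA [l *m _]mulmxA mulmxA; apply: grpM => //; rewrite mulmxA.
  have -> : g *m l *m g = (g *m l *m invmx g) *m (g *m g) by rewrite -!mulmxA mulKmx // grp_unit.
  by apply: grpM; [exact: grp_normal|exact: grp_sqr].
exists g; first by exists 1%:M; [exact: grp1|rewrite mulmx1].
exists (invmx g *m l); last by rewrite mulKVmx // grp_unit.
exists (invmx (g *m g) *m l); first by apply: grpM => //; exact/grpV/grp_sqr.
by rewrite invmx_mul ?grp_unit // -!mulmxA mulKVmx // grp_unit.
Qed.

End ElementaryQuotient.

Section SquareTrivialCharacters.
Variables (R : realType) (n : nat) (L : set 'M[R[i]]_n) (A : set (set 'M[R[i]]_n)).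
Hypotheses (AL : A L) (A_sqr : forall K, A K -> mulset K K = L).

Lemma character_grp lam : is_character A lam -> lam L = 1.
Proof.
move=> [nz lM]; have := lM _ _ AL AL; rewrite (A_sqr AL) => E.
by apply: (mulfI (nz _ AL)); rewrite mulr1 -E.
Qed.

(** A character with lam K ^+ 2 = lam (K K) = lam L = 1 takes the values 1 and -1. *)
Lemma character_sign lam : is_character A lam ->
  exists r : set 'M[R[i]]_n -> R, forall K, A K -> lam K = ((r K)%:C)%C.
Proof.
move=> cl; have [nz lM] := cl.
have /choice[r Hr] : forall K, exists r : R, A K -> lam K = (r%:C)%C; last by exists r.
move=> K; have [AK|nAK] := pselect (A K); last by exists 0.
have := lM _ _ AK AK; rewrite A_sqr // (character_grp cl) -expr2 => /esym/eqP.
rewrite sqrf_eq1 => /orP[/eqP ->|/eqP ->]; first by exists 1.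
by exists (-1); rewrite rmorphN.
Qed.

End SquareTrivialCharacters.

Section FiniteComponents.
Variable R : realType.
Local Notation C := R[i].

(** This form of the adjoint action is free of inverses. *)
Lemma AdE N (g X Y : 'M[C]_N) : g \in unitmx -> Ad g X = Y <-> g *m X = Y *m g.
Proof. by move=> ug; split=> [<-|E]; rewrite /Ad; [rewrite mulmxKV|rewrite E mulmxK]. Qed.

(** The entries of c g - g c are regular functions that vanish on G, and their
    differentials at the identity are the entries of c X - X c. *)
Lemma central_Lie N (G : set 'M[C]_N) c X : mxcenter G c -> Lie G X -> c *m X = X *m c.
Proof.
move=> [_ cG] LX; apply/matrixP => i j; apply/eqP; rewrite -subr_eq0; apply/eqP.
pose a k := commutator_entry c i j (delta_mx 0 k).
pose f : regfun R N := \sum_k a k *: mpoly.mpolyX C (mpoly.mnm1 k).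
have f0 g : G g -> reg_eval f g = 0.
  move=> Gg; rewrite /reg_eval (meval_linear_form a _).1.
  by rewrite commutator_entry_linear /commutator_entry row_mxKl mxvecK cG // subrr.
have := LX f f0; rewrite /reg_diff1.
under eq_bigr => k _ do rewrite /reg_eval (meval_linear_form a _).2.
by rewrite commutator_entry_linear /commutator_entry row_mxKl mxvecK !mxE.
Qed.

Lemma pair_inv1 (P : involutive_pair R) : regmap_eval (pair_inv P) 1%:M = 1%:M.
Proof.
have [[GU G1 _ _] _] := pair_grp_alg P; have [hG hM] := pair_inv_hom P.
have := hM _ _ G1 G1; rewrite mulmx1 => E.
have u : regmap_eval (pair_inv P) 1%:M \in unitmx by apply: GU; exact: hG.
move: (regmap_eval _ _) E u => x E u.
by rewrite -[LHS](mulKmx u) -E mulVmx.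
Qed.

Lemma Ad_image_mul N n (io : {linear 'cV[C]_n -> 'M[C]_N}) (S : set 'M[C]_N) :
  S `<=` [set g | g \in unitmx] -> (forall g h, S g -> S h -> S (g *m h)) ->
  forall j k, Ad_image io S j -> Ad_image io S k -> Ad_image io S (j *m k).
Proof.
move=> SU SM j k [g Sg Hg] [h Sh Hh]; exists (g *m h); first exact: SM.
move=> v; apply/esym; have ug := SU g Sg; have uh := SU h Sh.
apply/AdE; first by rewrite unitmx_mul ug.
rewrite -mulmxA; have /(AdE _ _ uh) -> := esym (Hh v).
by rewrite !mulmxA; have /(AdE _ _ ug) -> := esym (Hg (k *m v)); rewrite mulmxA.
Qed.

Lemma Ad_image_group N n (io : {linear 'cV[C]_n -> 'M[C]_N}) (S : set 'M[C]_N) :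
  injective io -> mxgroup S -> mxgroup (Ad_image io S).
Proof.
move=> io_inj [SU S1 SM SV]; have unit j : Ad_image io S j -> j \in unitmx.
  move=> [g Sg Hg]; have ug := SU g Sg; rewrite unitmxE unitfE -det_tr; apply/negP => /det0P[v v0 vj].
  move/negP: v0; apply; apply/eqP/trmx_inj; rewrite trmx0; apply: io_inj; rewrite linear0.
  have := Hg v^T; rewrite -[j]trmxK -trmx_mul vj trmx0 linear0 => /esym /(AdE _ _ ug).
  by rewrite mul0mx => E; rewrite -[LHS]mul1mx -(mulVmx ug) -mulmxA E mulmx0.
split=> //.
- by exists 1%:M => // v; apply/esym/AdE; rewrite ?unitmx1 // !mul1mx mulmx1.
- exact: Ad_image_mul.
- move=> j Hj; have uj := unit j Hj; have [g Sg Hg] := Hj; exists (invmx g); first exact: SV.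
  have ug := SU g Sg; move=> v; apply/esym/AdE; first by rewrite unitmx_inv.
  have := Hg (invmx j *m v); rewrite mulKVmx // => /esym /(AdE _ _ ug) E.
  by rewrite -[io (invmx j *m v)](mulKmx ug) E -!mulmxA mulmxV // mulmx1.
Qed.

Section Pair.
Variable P : involutive_pair R.
Local Notation G := (pair_grp P).
Local Notation th := (regmap_eval (pair_inv P)).

Lemma pair_unit g : G g -> g \in unitmx.
Proof. by have [[GU _ _ _] _] := pair_grp_alg P; exact: GU. Qed.

Lemma pair_mul g h : G g -> G h -> G (g *m h).
Proof. by have [[_ _ GM _] _] := pair_grp_alg P; exact: GM. Qed.

Lemma pair_invM g h : G g -> G h -> th (g *m h) = th g *m th h.
Proof. by case: (pair_inv_hom P) => _; exact. Qed.

Lemma pair_fix_group : mxgroup (@pair_fix R P).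
Proof.
have [[GU G1 GM GV] _] := pair_grp_alg P; split.
- by move=> g [Gg _]; exact: GU.
- by split=> //; exact: pair_inv1.
- by move=> g h [Gg tg] [Gh thh]; split; [exact: GM|rewrite pair_invM // tg thh].
- move=> g [Gg tg]; have Gg' := GV g Gg; split=> //; have ug := GU g Gg.
  have : th (invmx g) *m th g = 1%:M by rewrite -pair_invM // mulVmx // pair_inv1.
  rewrite tg; move: (th _) => x xg.
  by rewrite -[RHS]mul1mx -xg mulmxK.
Qed.

(** With theta g = g c the cocycle condition becomes multiplicative in g. *)
Lemma pair_AP g : @pair_A R P g <-> G g /\ exists2 c, mxcenter G c & th g = g *m c.
Proof.
split=> [[Gg cg]|[Gg [c cc E]]]; split=> //.
  by exists (invmx g *m th g) => //; rewrite mulKVmx // pair_unit.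
by rewrite E mulKmx // pair_unit.
Qed.

Lemma pair_A_mul g h : @pair_A R P g -> @pair_A R P h -> @pair_A R P (g *m h).
Proof.
move=> /pair_AP[Gg [c [Gc cc] Eg]] /pair_AP[Gh [c' [Gc' cc'] Eh]]; apply/pair_AP; split; first exact: pair_mul.
exists (c *m c').
  split; first exact: pair_mul.
  by move=> x Gx; rewrite -mulmxA cc' // mulmxA cc // mulmxA.
rewrite pair_invM // Eg Eh; move: (cc h Gh) => E.
by rewrite -!mulmxA; congr (_ *m _); rewrite !mulmxA E.
Qed.

(** If theta g = g c with c central, then theta (g theta g) = (theta g) g = g c g =
    g theta g: the element g theta g = g^2 c is fixed. As c acts trivially on the
    Lie algebra, it acts on V as the square of g. *)
Lemma pair_A_sqr g : @pair_A R P g -> exists c, [/\ mxcenter G c, @pair_fix R P (g *m g *m c) & G g].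
Proof.
move=> /pair_AP[Gg [c cc E]]; have [Gc cG] := cc; exists c; split=> //.
have Et : g *m g *m c = g *m th g by rewrite E mulmxA.
have Gt : G (th g) by case: (pair_inv_hom P) => + _; exact.
rewrite Et; split; first exact: pair_mul.
rewrite (pair_invM Gg Gt) (pair_inv_invol Gg); move: (th g) E => t -> {Et Gt t}.
by rewrite -mulmxA (cG g Gg).
Qed.

Lemma pair_fix_A : @pair_fix R P `<=` @pair_A R P.
Proof.
move=> g [Gg tg]; apply/pair_AP; split=> //; exists 1%:M; last by rewrite mulmx1.
by split=> [|x _]; [have [[_ G1 _ _] _] := pair_grp_alg P|rewrite mul1mx mulmx1].
Qed.

End Pair.

(** J is Ad of the group A of the pair. By pair_A_sqr the square of an element of
    J is the action of a fixed element, hence lies in L. *)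
Lemma finite_component_cosets (D : fc_datum R) : is_finite_component D ->
  exists J, [/\ square_in (fc_L D) J, fc_A D = [set mxcoset (fc_L D) g | g in J]
    & fc_B D = [set mxcoset (fc_L D) g | g in fc_L D]].
Proof.
move=> [P [io [[io_inj io_minus _ _ _] -> -> ->]]]; exists (Ad_image io (@pair_A R P)); split=> //.
have AU : @pair_A R P `<=` [set g | g \in unitmx] by move=> g [Gg _]; exact: pair_unit Gg.
split.
- by apply: Ad_image_group => //; exact: pair_fix_group.
- by move=> j [g fg Hg]; exists g => //; exact: pair_fix_A.
- exact: (Ad_image_mul AU (@pair_A_mul P)).
- move=> j Aj; have [g Ag Hg] := Aj; have [c [cc fc Gg]] := pair_A_sqr Ag.
  exists (g *m g *m c) => // v; have ug := AU g Ag; have Gc := cc.1.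
  have ugg : g *m g *m c \in unitmx by apply: pair_unit; have [] := fc.
  have [g' Ag' Hg'] : Ad_image io [set g *m g] (j *m j).
    have HS : Ad_image io [set g] j by exists g.
    exists (g *m g) => // w; apply/esym/AdE; first by rewrite unitmx_mul ug.
    rewrite -mulmxA; have /(AdE _ _ ug) -> := esym (Hg w).
    by rewrite !mulmxA; have /(AdE _ _ ug) -> := esym (Hg (j *m w)); rewrite mulmxA.
  apply/esym/AdE => //; have := Hg' v; rewrite Ag' => /esym /AdE E.
  have LX : Lie (pair_grp P) (io v) by have [] := io_minus v.
  by rewrite -mulmxA (central_Lie cc LX) mulmxA E ?mulmxA // unitmx_mul ug.
Qed.

End FiniteComponents.

(** * Eigenfunctions among the invariants *)

Section SeparableFunctions.
Variables (F : fieldType) (X Y : Type).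

(** Functions of finite rank on X * Y. *)
Definition separable (H : X -> Y -> F) := exists s : seq ((X -> F) * (Y -> F)),
  forall x y, H x y = \sum_(t <- s) t.1 x * t.2 y.

Lemma separable1 (a : X -> F) (b : Y -> F) : separable (fun x y => a x * b y).
Proof. by exists [:: (a, b)] => x y; rewrite big_seq1. Qed.

Lemma separableM H K : separable H -> separable K -> separable (fun x y => H x y * K x y).
Proof.
move=> [s Hs] [t Ht]; exists [seq ((fun x => a.1 x * b.1 x), (fun y => a.2 y * b.2 y)) | a <- s, b <- t] => x y.
rewrite big_allpairs_dep /= Hs Ht mulr_suml; apply: eq_bigr => a _; rewrite mulr_sumr.
by apply: eq_bigr => b _ /=; rewrite mulrACA.
Qed.

Lemma separable_sum (I : Type) (r : seq I) (H : I -> X -> Y -> F) :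
  (forall i, separable (H i)) -> separable (fun x y => \sum_(i <- r) H i x y).
Proof.
move=> HH; elim: r => [|i r [s Hs]]; first by exists [::] => x y; rewrite !big_nil.
by have [t Ht] := HH i; exists (t ++ s) => x y; rewrite big_cons big_cat Hs Ht.
Qed.

Lemma separable_prod (I : Type) (r : seq I) (H : I -> X -> Y -> F) :
  (forall i, separable (H i)) -> separable (fun x y => \prod_(i <- r) H i x y).
Proof.
move=> HH; elim: r => [|i r IH].
  by exists [:: (fun=> 1, fun=> 1)] => x y; rewrite big_nil big_seq1 mulr1.
by have [t Ht] := separableM (HH i) IH; exists t => x y; rewrite big_cons -Ht.
Qed.

Lemma separableX H k : separable H -> separable (fun x y => H x y ^+ k).
Proof.
move=> sH; elim: k => [|k IH]; first by exists [:: (fun=> 1, fun=> 1)] => x y; rewrite big_seq1 mulr1.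
by have [t Ht] := separableM sH IH; exists t => x y; rewrite exprS -Ht.
Qed.

(** A dimension count: as long as the span misses an element of S, adding it raises
    the dimension. *)
Lemma finite_span k (S : set 'rV[F]_k) : exists s : seq 'rV[F]_k, (forall x, x \in s -> S x) /\
  forall x, S x -> x \in (span s).
Proof.
suff H r : forall s : seq 'rV[F]_k, (forall x, x \in s -> S x) -> (\dim (fullv : {vspace 'rV[F]_k}) - \dim (span s) <= r)%N ->
    exists s : seq 'rV[F]_k, (forall x, x \in s -> S x) /\ forall x, S x -> x \in (span s).
  by apply: (H _ [::]).
elim: r => [|r IH] s sS ds.
  have full : (span s) = fullv by apply/eqP; rewrite eqEdim subvf; move: ds; rewrite leqn0 subn_eq0.
  by exists s; split=> // x _; rewrite full memvf.
have [[x [Sx xs]]|nex] := pselect (exists x, S x /\ x \notin (span s)); last first.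
  by exists s; split=> // x Sx; apply: contrapT => /negP xs; apply: nex; exists x.
apply: (IH (x :: s)); first by move=> y; rewrite inE => /orP[/eqP ->|/sS].
have lt : (\dim (span s) < \dim (span (x :: s)))%N.
  rewrite ltn_neqAle dimvS ?andbT; last by rewrite span_cons addvSr.
  apply: contra xs => /eqP E; have -> : (span s) = (span (x :: s)).
    by apply/eqP; rewrite eqEdim span_cons addvSr -span_cons E leqnn.
  by rewrite memv_span ?mem_head.
by have := dimvS (subvf (span (x :: s))); move: lt ds; lia.
Qed.

(** The rows a x of the coefficients live in a finite-dimensional space, so finitely
    many points x of S span all of them. *)
Lemma separable_span (H : X -> Y -> F) (S : set X) : separable H ->
  exists s : seq X, (forall i, (i < size s)%N -> forall x0, S (nth x0 s i)) /\
    forall x, S x -> exists c : nat -> F, forall y x0, H x y = \sum_(i < size s) c i * H (nth x0 s i) y.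
Proof.
move=> [s Hs]; have [[x1 Sx1]|nS] := pselect (exists x, S x); last first.
  by exists [::]; split=> // x Sx; case: nS; exists x.
pose d : (X -> F) * (Y -> F) := (fun=> 0, fun=> 0).
pose a x : 'rV[F]_(size s) := \row_t (nth d s t).1 x.
have [u [uS Hu]] := finite_span [set a x | x in S].
have /choice[w Hw] : forall y, exists x, y \in u -> S x /\ a x = y.
  by move=> y; have [/uS[x Sx <-]|_] := boolP (y \in u); [exists x|exists x1].
exists [seq w y | y <- u]; split.
  move=> i; rewrite size_map => iu x0; rewrite (nth_map 0) //.
  by have [] := Hw (nth 0 u i) (mem_nth 0 iu).
move=> x Sx; have xu := Hu (a x) (imageP a Sx).
exists (fun i => if insub i is Some j then coord (in_tuple u) j (a x) else 0) => y x0.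
have HE z : H z y = \sum_t (a z) 0 t * (nth d s t).2 y.
  by rewrite Hs (big_nth d) big_mkord; apply: eq_bigr => t _; rewrite mxE.
rewrite HE {1}(coord_span (X := in_tuple u) xu) size_map.
under eq_bigr => t _ do rewrite summxE mulr_suml.
rewrite exchange_big; apply: eq_bigr => i _.
rewrite (_ : insub (i : nat) = Some i); last by rewrite insubT ?ltn_ord // => lt; congr Some; apply: val_inj.
rewrite HE mulr_sumr; apply: eq_bigr => t _; rewrite mxE -mulrA; congr (_ * (_ * _)).
have iu : (i < size u)%N by [].
rewrite (nth_map 0) //; have [_ ->] := Hw (nth 0 u i) (mem_nth 0 iu).
by [].
Qed.

End SeparableFunctions.

Section EigenInvariants.
Variables (R : realType) (n : nat).
Local Notation C := R[i].
Variables L J : set 'M[C]_n.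
Hypothesis LJ : square_in L J.
Implicit Types (f : 'cV[C]_n -> C) (v : 'cV[C]_n).

Lemma peval_separable p : separable (fun (j : 'M[C]_n) (v : 'cV[C]_n) => peval p (j *m v)).
Proof.
have -> : (fun j v => peval p (j *m v)) = fun (j : 'M[C]_n) (v : 'cV[C]_n) =>
   \sum_(m <- mpoly.msupp p) (mpoly.mcoeff m p * 1) * \prod_i (\sum_k j i k * v k 0) ^+ mpoly.fun_of_multinom m i.
  apply/funext => j; apply/funext => v; rewrite /peval mpoly.mevalE; apply: eq_bigr => m _.
  by rewrite mulr1; congr (_ * _); apply: eq_bigr => i _; rewrite mxE.
apply: separable_sum => m; apply: separableM; first exact: (separable1 (fun=> mpoly.mcoeff m p) (fun=> 1)).
apply: separable_prod => i; apply: separableX; apply: separable_sum => k.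
exact: (separable1 (fun j : 'M[C]_n => j i k) (fun v : 'cV[C]_n => v k 0)).
Qed.

Lemma peval_comp p (j : 'M[C]_n) : exists q, forall v, peval q v = peval p (j *m v).
Proof.
pose lq := [tuple \sum_k j i k *: mpoly.mpolyX C (mpoly.mnm1 k) | i < n].
exists (mpoly.comp_mpoly lq p) => v; rewrite /peval mpoly.comp_mpoly_meval; apply: mpoly.meval_eq => i.
rewrite tnth_mktuple mxE (big_morph _ (mpoly.mevalD _) (mpoly.meval0 _)); apply: eq_bigr => k _.
by rewrite mpoly.mevalZ mpoly.mevalXU.
Qed.

Definition linv f := (exists p, f = peval p) /\ forall l v, L l -> f (l *m v) = f v.

Lemma linv_comm f j k v : linv f -> J j -> J k -> f (j *m (k *m v)) = f (k *m (j *m v)).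
Proof. by move=> [_ fL] Jj Jk; rewrite mulmxA; have [l Ll ->] := grp_comm LJ Jj Jk; rewrite -mulmxA fL // mulmxA. Qed.

Lemma linv_sqr f j v : linv f -> J j -> f (j *m (j *m v)) = f v.
Proof. by move=> [_ fL] Jj; rewrite mulmxA fL //; exact: grp_sqr LJ _ Jj. Qed.

(** The projection of f to an eigenspace of the involution that j induces on the
    invariants. *)
Definition half_sum (e : bool) f j v := (f v + (-1) ^+ e * f (j *m v)) / 2.

Lemma half_sum_linv e f j : J j -> linv f -> linv (half_sum e f j).
Proof.
move=> Jj lf; have [[p ->] pL] := lf; split.
  have [q Hq] := peval_comp p j.
  exists ((2^-1) *: (p + (-1) ^+ e *: q)); apply/funext => v.
  by rewrite /half_sum -Hq /peval mpoly.mevalZ mpoly.mevalD mpoly.mevalZ mulrC.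
move=> l v Ll; rewrite /half_sum (pL l v Ll) [j *m (l *m v)]mulmxA.
have uj := grp_unit LJ Jj.
have -> : j *m l = (j *m l *m invmx j) *m j by rewrite mulmxKV.
by rewrite -mulmxA pL //; exact: grp_normal LJ _ _ Jj Ll.
Qed.

Lemma half_sum_eigen e f j v : linv f -> J j -> half_sum e f j (j *m v) = (-1) ^+ e * half_sum e f j v.
Proof. by move=> lf Jj; rewrite /half_sum linv_sqr //; case: e; rewrite ?expr0 ?expr1; ring. Qed.

Lemma half_sum_commute e f j k mu : linv f -> J j -> J k -> (forall v, f (k *m v) = mu * f v) ->
  forall v, half_sum e f j (k *m v) = mu * half_sum e f j v.
Proof. by move=> lf Jj Jk E v; rewrite /half_sum linv_comm // !E; ring. Qed.

Lemma half_sum_nonzero f j v : f v != 0 -> exists e, half_sum e f j v != 0.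
Proof.
move=> fv; have [e0|] := eqVneq (half_sum false f j v) 0; last by exists false.
exists true; apply: contra fv => /eqP e1; apply/eqP.
have -> : f v = half_sum false f j v + half_sum true f j v by rewrite /half_sum expr0 expr1; field.
by rewrite e0 e1 addr0.
Qed.

Definition eigen f := forall j, J j -> (forall v, f (j *m v) = f v) \/ forall v, f (j *m v) = - f v.

(** The translates of p under J are spanned by those under finitely many elements s_i
    of J. The s_i act by commuting involutions, so p is a sum of simultaneous
    eigenfunctions; one of them does not vanish at v0. An eigenfunction for all s_i
    is one for all of J, and its eigenvalues are signs. *)
Lemma eigen_invariant p v0 : invariant_poly L p -> peval p v0 != peval p 0 ->
  exists q, [/\ invariant_poly L q, peval q 0 = 0, eigen (peval q) & peval q v0 != 0].
Proof.
move=> pL pv; pose f v := peval p v - peval p 0.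
have lf : linv f.
  split; last by move=> l v Ll; rewrite /f pL.
  exists (p - mpoly.mpolyC n (peval p 0)); apply/funext => v.
  by rewrite /f /peval mpoly.mevalB mpoly.mevalC.
have f0 : f 0 = 0 by rewrite /f subrr.
have fv : f v0 != 0 by rewrite subr_eq0.
have [p' Ep'] := lf.1; have := separable_span J (peval_separable p').
rewrite -[p' in X in X -> _]/p' => -[s [sJ Hs]].
have {}Hs j : J j -> exists c : nat -> C, forall v, f (j *m v) = \sum_(i < size s) c i * f (nth 0 s i *m v).
  by move=> /Hs[c Hc]; exists c => v; rewrite Ep'; exact: Hc.
have step m : (m <= size s)%N -> exists g, [/\ linv g, g 0 = 0, g v0 != 0,
   forall j, J j -> exists c : nat -> C, forall v, g (j *m v) = \sum_(i < size s) c i * g (nth 0 s i *m v) &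
   forall i, (i < m)%N -> exists mu, forall v, g (nth 0 s i *m v) = mu * g v].
  elim: m => [|m IH] ms; first by exists f.
  have [g [lg g0 gv Hg Eg]] := IH (ltnW ms); have Jm := sJ m ms 0.
  have [e He] := half_sum_nonzero (nth 0 s m) gv.
  exists (half_sum e g (nth 0 s m)); split=> //; first exact: half_sum_linv.
  - by rewrite /half_sum mulmx0 g0 mulr0 addr0 mul0r.
  - move=> j Jj; have [c Hc] := Hg j Jj; exists c => v.
    rewrite /half_sum linv_comm // !Hc mulr_sumr -big_split mulr_suml; apply: eq_bigr => i _ /=.
    by rewrite [in RHS]linv_comm //; [ring|exact: sJ].
  - move=> i; rewrite ltnS leq_eqVlt => /orP[/eqP ->|im].
      by exists ((-1) ^+ e) => v; exact: half_sum_eigen.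
    have [mu Hmu] := Eg i im; exists mu; apply: half_sum_commute => //.
    by apply: sJ; exact: ltn_trans ms.
have [g [[[q Eq] gL] g0 gv Hg Eg]] := step _ (leqnn _).
have lg : linv g by split=> //; exists q.
exists q; rewrite -Eq; split=> //; first by move=> l v Ll; rewrite -Eq; exact: gL.
move=> j Jj; have [c Hc] := Hg j Jj.
have /choice[mu Hmu] : forall i : 'I_(size s), exists mu, forall v, g (nth 0 s i *m v) = mu * g v by move=> i; exact: Eg.
pose la := \sum_(i < size s) c i * mu i.
have E v : g (j *m v) = la * g v.
  by rewrite Hc /la mulr_suml; apply: eq_bigr => i _; rewrite Hmu mulrA.
have : la ^+ 2 = 1.
  have := linv_sqr v0 lg Jj; rewrite !E mulrA -expr2 => H.
  by apply: (mulIf gv); rewrite H mul1r.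
by move/eqP; rewrite sqrf_eq1 => /orP[] /eqP H; [left|right] => v; rewrite E H ?mul1r ?mulN1r.
Qed.

End EigenInvariants.

(** * Real functionals and complex distributions *)

Section RealDistributions.
Variables (R : realType) (n : nat).
Local Notation C := R[i].
Local Notation V := 'rV[R]_(n + n).
Implicit Types (X : set 'cV[C]_n) (f : 'cV[C]_n -> C) (a b : V -> R).

Let U X : set V := @cvec R n @^-1` X.
Let ReV f : V -> R := fun x => complex.Re (f (cvec x)).
Let ImV f : V -> R := fun x => complex.Im (f (cvec x)).

(** Nash operators have real coefficients: they act on the real and imaginary parts
    separately. *)
Lemma nash_diffop_rdop W (N : (V -> C) -> (V -> C)) : nash_diffop W N ->
  exists2 E, rdop W E & forall (f : V -> C) x, N f x =
    (E (fun y => complex.Re (f y)) x +i* E (fun y => complex.Im (f y)) x)%C.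
Proof.
elim=> [g ng|k|N1 N2 _ [E1 r1 H1] _ [E2 r2 H2]|N1 N2 _ [E1 r1 H1] _ [E2 r2 H2]].
- exists (fun (f : V -> R) x => g x * f x); first exact: rd_mult.
  by move=> f x; case: (f x) => p q; apply/eqP; rewrite eq_complex /= !mul0r subr0 addr0 !eqxx.
- by exists (partial k); first exact: rd_partial.
- by exists (fun (f : V -> R) x => E1 f x + E2 f x); [exact: rd_add|move=> f x; rewrite H1 H2].
- exists (fun f : V -> R => E1 (E2 f)); first exact: rd_comp.
  move=> f x; rewrite H1.
  rewrite (_ : (fun y => complex.Re (N2 f y)) = E2 (fun y => complex.Re (f y))); last by apply/funext => y; rewrite H2.
  by rewrite (_ : (fun y => complex.Im (N2 f y)) = E2 (fun y => complex.Im (f y))) //; apply/funext => y; rewrite H2.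
Qed.

Lemma rdop_nash_diffop W E : rdop W E -> exists2 N, nash_diffop W N & forall (f : V -> C) x, N f x =
    (E (fun y => complex.Re (f y)) x +i* E (fun y => complex.Im (f y)) x)%C.
Proof.
elim=> [g ng|k|N1 N2 _ [E1 r1 H1] _ [E2 r2 H2]|N1 N2 _ [E1 r1 H1] _ [E2 r2 H2]].
- exists (fun (f : V -> C) x => (g x)%:C%C * f x); first exact: nash_mult.
  by move=> f x; case: (f x) => p q; apply/eqP; rewrite eq_complex /= !mul0r subr0 addr0 !eqxx.
- by exists (cpartial k); first exact: nash_partial.
- by exists (fun (f : V -> C) x => E1 f x + E2 f x); [exact: nash_add|move=> f x; rewrite H1 H2].
- exists (fun f : V -> C => E1 (E2 f)); first exact: nash_comp.
  move=> f x; rewrite H1.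
  rewrite (_ : (fun y => complex.Re (E2 f y)) = N2 (fun y => complex.Re (f y))); last by apply/funext => y; rewrite H2.
  by rewrite (_ : (fun y => complex.Im (E2 f y)) = N2 (fun y => complex.Im (f y))) //; apply/funext => y; rewrite H2.
Qed.

Lemma cnorm_re_im (p q M : R) : `|p +i* q|%C <= (M%:C)%C -> `|p| <= M /\ `|q| <= M.
Proof.
rewrite normc_def lecR => H.
have H1 : forall s t : R, `|s| <= Num.sqrt (s ^+ 2 + t ^+ 2).
  by move=> s t; rewrite -sqrtr_sqr ler_wsqrtr // lerDl sqr_ge0.
by split; [exact: le_trans (H1 p q) H|apply: le_trans (H1 q p) _; rewrite addrC].
Qed.

Lemma cnorm_le (p q : R) : `|p +i* q|%C <= ((`|p| + `|q|)%:C)%C.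
Proof.
rewrite normc_def lecR /= -[X in _ <= X]ger0_norm ?addr_ge0 // -sqrtr_sqr ler_wsqrtr //.
rewrite sqrrD (real_normK (num_real p)) (real_normK (num_real q)) addrAC lerDl mulrn_wge0 // mulr_ge0.
Qed.

Lemma schwartz_rsch X f : schwartz X f <-> rsch (U X) (ReV f) /\ rsch (U X) (ImV f).
Proof.
split=> [[[s1 s2] H]|[[s1 H1] [s2 H2]]].
  split; split; [exact: s1| |exact: s2|] => E /rdop_nash_diffop[N nN HN]; have [M HM] := H N nN;
    by exists M => x Ux; have := HM x Ux; rewrite HN => /cnorm_re_im[].
split; [split; [exact: s1|exact: s2]|] => N /nash_diffop_rdop[E rE HE]; have [M1 HM1] := H1 E rE; have [M2 HM2] := H2 E rE.
exists (M1 + M2) => x Ux; rewrite HE; apply: le_trans (cnorm_le _ _) _.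
by rewrite lecR; apply: lerD; [exact: HM1|exact: HM2].
Qed.

Definition cplx a : 'cV[C]_n -> C := fun v => (a (rvec v))%:C%C.

Lemma schwartz_cplx X a : open (U X) -> schwartz X (cplx a) <-> rsch (U X) a.
Proof.
move=> oU; rewrite schwartz_rsch; have -> : ReV (cplx a) = a by apply/funext => x; rewrite /ReV /cplx /= cvecK.
have -> : ImV (cplx a) = fun=> 0 by apply/funext => x.
by split=> [[]//|ra]; split=> //; exact: rsch0.
Qed.

(** Complex test functions are combinations of real ones, so a nonzero distribution
    is nonzero on a real test function. *)
Lemma cplx_re_im f : f = fun v => 'i%C * cplx (ImV f) v + cplx (ReV f) v.
Proof.
apply/funext => v; rewrite /cplx /ReV /ImV rvecK; case: (f v) => p q /=.
by apply/eqP; rewrite eq_complex /= !mul0r !mulr0 !mul1r subr0 ?addr0 ?add0r !eqxx.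
Qed.

Section ToReal.
Variables (X : set 'cV[C]_n) (T : ('cV[C]_n -> C) -> C).
Hypotheses (oU : open (U X)) (dT : schwartz_distribution X T).

Lemma schwartz0 : T (fun=> 0) = 0.
Proof.
have s0 : schwartz X (fun=> 0 : C) by apply/schwartz_rsch; split; exact: rsch0.
have := dT.1 (-1) _ _ s0 s0; by rewrite !mulN1r !addNr.
Qed.

Lemma schwartzZ (c : C) f : schwartz X f -> T (fun v => c * f v) = c * T f.
Proof.
move=> sf; have s0 : schwartz X (fun=> 0 : C) by apply/schwartz_rsch; split; exact: rsch0.
have := dT.1 c _ _ sf s0; rewrite schwartz0 addr0 => <-.
by congr T; apply/funext => v; rewrite addr0.
Qed.

(** P is the real or the imaginary part. The bound in rdist comes from continuity at
    0 by scaling the test function so that its seminorms are just below delta. *)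
Lemma rdist_part (P : C -> R) : (forall (r : R) z w, P ((r%:C)%C * z + w) = r * P z + P w) ->
  (forall z (e : R), `|z| < (e%:C)%C -> `|P z| <= e) -> rdist (U X) (fun a => P (T (cplx a))).
Proof.
move=> PL PB; split.
  move=> r a b ra rb; rewrite -PL -dT.1; [|exact/schwartz_cplx|exact/schwartz_cplx].
  congr P; congr T; apply/funext => v; by rewrite /cplx rmorphD rmorphM.
have [r [N [de [de0 nN HN]]]] := dT.2 1 ltr01.
have /choice[E HE] : forall i, exists E, rdop (U X) E /\ forall (f : V -> C) x, N i f x =
    (E (fun y => complex.Re (f y)) x +i* E (fun y => complex.Im (f y)) x)%C.
  by move=> i; have [E rE H] := nash_diffop_rdop (nN i); exists E.
exists r, E, (2 / de); split; first by rewrite divr_ge0 // ltW.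
  by move=> i; case: (HE i).
move=> a ra M M0 HM; have P0 : P 0 = 0.
  by have := PL (-1) 0 0; rewrite mulr0 addr0 mulN1r addNr.
have key t : 0 < t -> t * M < de -> `|P (T (cplx a))| <= t^-1.
  move=> t0 tM; have sa : schwartz X (cplx a) by apply/schwartz_cplx.
  have st : schwartz X (fun v => (t%:C)%C * cplx a v).
    rewrite (_ : (fun v => _) = cplx (fun x => t * a x)); last first.
      by apply/funext => v; rewrite /cplx rmorphM.
    apply/schwartz_cplx => //; have := rschL t oU ra (rsch0 oU); congr rsch; apply/funext => x; by rewrite addr0.
  have := HN _ st; rewrite (schwartzZ _ sa) => H.
  have {}H : `|(t%:C)%C * T (cplx a)| < ((1 : R)%:C)%C.
    apply: H => i x Ux; have [rE HEi] := HE i; rewrite HEi.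
    have E1 : (fun y => complex.Re (((fun v => (t%:C)%C * cplx a v) \o @cvec R n) y)) = fun y => t * a y + 0.
      by apply/funext => y; rewrite /= /cplx cvecK /= mul0r subr0 addr0.
    have E2 : (fun y => complex.Im (((fun v => (t%:C)%C * cplx a v) \o @cvec R n) y)) = fun=> 0.
      by apply/funext => y; rewrite /= /cplx /= mul0r mulr0 addr0.
    rewrite E1 E2 (rdop0 oU rE Ux) (rdop_linear t oU rE ra.1 (rsch0 oU).1 Ux) (rdop0 oU rE Ux) addr0.
    apply: le_lt_trans (cnorm_le _ _) _; rewrite ltcR normr0 addr0 normrM gtr0_norm //.
    exact: le_lt_trans (ler_wpM2l (ltW t0) (HM i x Ux)) tM.
  have := PB _ _ H; have -> : P ((t%:C)%C * T (cplx a)) = t * P (T (cplx a)) by have := PL t (T (cplx a)) 0; rewrite P0 !addr0.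
  by rewrite normrM gtr0_norm // => H'; rewrite -[_^-1]mul1r ler_pdivlMr // mulrC.
have [M1|M1] := leP M 0.
  have M_0 : M = 0 by apply/eqP; rewrite eq_le M1.
  rewrite M_0 mulr0; apply/ler_addgt0Pr => e e0; rewrite add0r.
  by have := key e^-1; rewrite invrK M_0 mulr0 invr_gt0; apply.
have M2 : 0 < 2 * M by rewrite mulr_gt0.
have tM : de / (2 * M) * M < de.
  by rewrite mulrAC ltr_pdivrMr // ltr_pM2l // ltr_pMl // ltr1n.
by have := key _ (divr_gt0 de0 M2) tM; rewrite invf_div mulrAC.
Qed.

End ToReal.

Lemma rdist_schwartz X (S : (V -> R) -> R) : open (U X) -> rdist (U X) S ->
  schwartz_distribution X (fun f => (S (ReV f) +i* S (ImV f))%C).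
Proof.
move=> oU dS; split.
  move=> [p q] f g /schwartz_rsch[f1 f2] /schwartz_rsch[g1 g2].
  have E1 : ReV (fun v => (p +i* q)%C * f v + g v) = fun x => p * ReV f x + ((- q) * ImV f x + ReV g x).
    by apply/funext => x; rewrite /ReV /ImV; case: (f _) (g _) => a b [c d] /=; ring.
  have E2 : ImV (fun v => (p +i* q)%C * f v + g v) = fun x => p * ImV f x + (q * ReV f x + ImV g x).
    by apply/funext => x; rewrite /ReV /ImV; case: (f _) (g _) => a b [c d] /=; ring.
  have r1 := rschL (- q) oU f2 g1; have r2 := rschL q oU f1 g2.
  rewrite E1 E2 !dS.1 //; apply/eqP; rewrite eq_complex /=; apply/andP; split; apply/eqP; ring.
move=> e e0; have [r [E [K [K0 rE HK]]]] := dS.2.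
have /choice[N HN] : forall i, exists N, nash_diffop (U X) N /\ forall (f : V -> C) x, N f x =
    (E i (fun y => complex.Re (f y)) x +i* E i (fun y => complex.Im (f y)) x)%C.
  by move=> i; have [N nN H] := rdop_nash_diffop (rE i); exists N.
pose de := e / (3 * (K + 1)).
have K1 : 0 < 3 * (K + 1) by rewrite mulr_gt0 // ltr_wpDl.
exists r, N, de; split; first by rewrite divr_gt0.
  by move=> i; case: (HN i).
move=> f /schwartz_rsch[f1 f2] Hf.
have B i x : U X x -> `|E i (ReV f) x| <= de /\ `|E i (ImV f) x| <= de.
  by move=> Ux; have := ltW (Hf i x Ux); have [_ ->] := HN i => /cnorm_re_im.
apply: le_lt_trans (cnorm_le _ _) _; rewrite ltcR.
have de0 : 0 <= de by rewrite divr_ge0 ?ltW.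
have b1 := HK _ f1 de de0 (fun i x Ux => (B i x Ux).1).
have b2 := HK _ f2 de de0 (fun i x Ux => (B i x Ux).2).
apply: le_lt_trans (lerD b1 b2) _; rewrite /de !mulrA -mulrDl ltr_pdivrMr //.
move: K K0 {K1 de de0 b1 b2 B Hf HK} => K K0; nra.
Qed.

End RealDistributions.

Section RealEquivariance.
Variables (R : realType).
Local Notation C := R[i].

(** The action of a complex matrix in real coordinates. *)
Definition real_act n (j : 'M[C]_n) (x : 'rV[R]_(n + n)) : 'rV[R]_(n + n) := rvec (j *m cvec x).

(** Equivariance of a real functional; r is the real form of a character with values
    1 and -1. *)
Definition real_eqv n (A : set (set 'M[C]_n)) (r : set 'M[C]_n -> R) (W : set 'rV[R]_(n + n))
    (S : ('rV[R]_(n + n) -> R) -> R) := rdist W S /\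
  forall K j a, A K -> K j -> rsch W a -> S (fun x => a (real_act j x)) = r K * S a.

Variables (D : fc_datum R) (lam : set 'M[C]_(fc_dim D) -> C) (r : set 'M[C]_(fc_dim D) -> R).
Hypothesis lamE : forall K, fc_A D K -> lam K = ((r K)%:C)%C.
Variable X : set 'cV[C]_(fc_dim D).
Local Notation V := 'rV[R]_(fc_dim D + fc_dim D).
Local Notation U := (@cvec R (fc_dim D) @^-1` X : set V).
Hypothesis oU : open U.

Lemma real_eqv_of T f : eqv_distribution lam X T -> schwartz X f -> T f != 0 ->
  exists S a, [/\ real_eqv (fc_A D) r U S, rsch U a & S a != 0].
Proof.
move=> [dT _ eT] sf Tf.
have [f1 f2] := (schwartz_rsch X f).1 sf.
have [a ra Ta] : exists2 a, rsch U a & T (cplx a) != 0.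
  apply: contrapT => nex; have Z a : rsch U a -> T (cplx a) = 0.
    by move=> ra; apply: contrapT => /eqP nz; apply: nex; exists a.
  move: Tf; rewrite (cplx_re_im f) dT.1; [|exact/schwartz_cplx|exact/schwartz_cplx].
  by rewrite !Z // mulr0 addr0 eqxx.
have main (P : C -> R) : (forall (s : R) z w, P ((s%:C)%C * z + w) = s * P z + P w) ->
   (forall z (e : R), `|z| < (e%:C)%C -> `|P z| <= e) -> P (T (cplx a)) != 0 ->
   exists S a, [/\ real_eqv (fc_A D) r U S, rsch U a & S a != 0].
  move=> PL PB nz; exists (fun b => P (T (cplx b))), a; split=> //; split; first exact: (rdist_part oU dT PL PB).
  have P0 : P 0 = 0 by have := PL (-1) 0 0; rewrite mulr0 addr0 mulN1r addNr.
  move=> K j b AK Kj rb; have := eT K j (cplx b) AK Kj ((schwartz_cplx b oU).2 rb).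
  rewrite /Defs.pushforward lamE // => E.
  rewrite (_ : cplx (fun x => b (real_act j x)) = fun v => cplx b (j *m v)); last first.
    by apply/funext => v; rewrite /cplx /real_act rvecK.
  by rewrite E; have := PL (r K) (T (cplx b)) 0; rewrite P0 !addr0.
have [Re0|Rn0] := eqVneq (complex.Re (T (cplx a))) 0; last first.
  apply: (main (@complex.Re R)) Rn0 => [s [z1 z2] [w1 w2]|[p q] e lt] /=.
    by rewrite mul0r subr0.
  by have [] := cnorm_re_im (ltW lt).
have In0 : complex.Im (T (cplx a)) != 0.
  by apply: contra Ta => /eqP Im0; rewrite eq_complex Re0 Im0 eqxx.
apply: (main (@complex.Im R)) In0 => [s [z1 z2] [w1 w2]|[p q] e lt] /=.
  by rewrite mul0r addr0.
by have [] := cnorm_re_im (ltW lt).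
Qed.

Hypotheses (AL : fc_A D (fc_L D)) (lamL : lam (fc_L D) = 1).

Lemma real_eqv_refutes S a : real_eqv (fc_A D) r U S -> rsch U a -> S a != 0 ->
  ~ no_eqv_distribution lam X.
Proof.
move=> [dS eS] ra Sa no.
pose T f := (S (fun x : V => complex.Re (f (cvec x))) +i* S (fun x : V => complex.Im (f (cvec x))))%C.
have eT K j f : fc_A D K -> K j -> schwartz X f -> Defs.pushforward j T f = lam K * T f.
  move=> AK Kj /schwartz_rsch[f1 f2]; rewrite lamE // /Defs.pushforward /T.
  have := eS K j _ AK Kj f1; have := eS K j _ AK Kj f2.
  rewrite /real_act.
  rewrite (_ : (fun x => complex.Im (f (cvec (rvec (j *m cvec x))))) = fun x : V => complex.Im (f (j *m cvec x))); last first.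
    by apply/funext => x; rewrite rvecK.
  rewrite (_ : (fun x => complex.Re (f (cvec (rvec (j *m cvec x))))) = fun x : V => complex.Re (f (j *m cvec x))); last first.
    by apply/funext => x; rewrite rvecK.
  by move=> -> ->; apply/eqP; rewrite eq_complex /= !mul0r subr0 addr0 !eqxx.
have /no : eqv_distribution lam X T.
  split=> //; first exact: rdist_schwartz.
  by move=> l f Ll sf; rewrite (eT _ _ _ AL Ll sf) lamL mul1r.
move/(_ _ ((schwartz_cplx a oU).2 ra)) => /(congr1 (@complex.Re R)) /=.
rewrite (_ : (fun x : V => a (rvec (cvec x))) = a); last by apply/funext => x; rewrite cvecK.
by move/eqP; apply/negP.
Qed.

End RealEquivariance.

(** * Vectors and matrices in blocks *)

Section BlockVectors.
Variables (R : realType) (m : nat) (n : 'I_m -> nat).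
Local Notation C := R[i].
Local Notation N := (\sum_i n i)%N.
Local Notation W := 'rV[R]_(N + N).
Implicit Types (g h : forall i, 'M[C]_(n i)) (y z : W).

(** Both sides agree on the block columns of the identity. *)
Lemma mxdiagM g h : (\mxdiag_i g i) *m (\mxdiag_i h i) = \mxdiag_i (g i *m h i).
Proof.
have E k : \mxdiag_i k i = \mxcol_i (k i *m submxcol (1%:M : 'M[C]_N) i).
  by rewrite -mul_mxdiag_mxcol submxcolK mulmx1.
rewrite [X in _ *m X]E mul_mxdiag_mxcol [RHS]E; apply: eq_mxcol => i; exact: mulmxA.
Qed.

Definition block_comp (i : 'I_m) z : 'cV[C]_(n i) := submxcol (cvec z) i.

Lemma block_comp_inj y z : (forall i, block_comp i y = block_comp i z) -> y = z.
Proof.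
move=> H; apply: (can_inj (@cvecK R N)); rewrite -[LHS]submxcolK -[RHS]submxcolK.
by apply: eq_mxcol => i; exact: H.
Qed.

Lemma block_comp_act i g z : block_comp i (real_act (\mxdiag_i g i) z) = g i *m block_comp i z.
Proof.
rewrite /block_comp /real_act rvecK -[in LHS](submxcolK (cvec z)) mul_mxdiag_mxcol; exact: mxcolK.
Qed.

Section OneBlock.
Variable i0 : 'I_m.

Definition block_index (k : 'I_(n i0 + n i0)) : 'I_(N + N) :=
  match fintype.split k with inl a => lshift N (tagnat.Rank i0 a) | inr a => rshift N (tagnat.Rank i0 a) end.

Lemma Rank_inj i (a b : 'I_(n i)) : tagnat.Rank i a = tagnat.Rank i b -> a = b.
Proof.
by move=> E; apply: val_inj; apply/eqP; have := tagnat.eq_Rank a b; rewrite E !eqxx => /esym.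
Qed.

Lemma block_index_inj : injective block_index.
Proof.
move=> k k'; rewrite /block_index; case: (split_ordP k) => a ->; case: (split_ordP k') => b -> /eqP.
- by rewrite eq_lshift => /eqP/Rank_inj ->.
- by rewrite eq_lrshift.
- by rewrite eq_rlshift.
- by rewrite eq_rshift => /eqP/Rank_inj ->.
Qed.

Local Notation e := block_index.

Lemma cvec_bproj z : cvec (bproj e z) = block_comp i0 z.
Proof.
apply/colP => k; rewrite !mxE /block_index.
by rewrite (unsplitK (inl k)) (unsplitK (inr k)).
Qed.

Lemma block_comp_incl x : block_comp i0 (bincl e x) = cvec x.
Proof.
rewrite -cvec_bproj; congr cvec; apply/rowP => k; rewrite bprojE binclE //; exact: block_index_inj.
Qed.

Lemma block_comp_glue y z : block_comp i0 (glue (block e) y z) = block_comp i0 y.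
Proof. by rewrite -!cvec_bproj; congr cvec; apply/rowP => k; rewrite !bprojE glueE block_e. Qed.

Lemma block_comp_glue_out i y z : i != i0 -> block_comp i (glue (block e) y z) = block_comp i z.
Proof.
move=> ii0; have nb a : ~~ block e (lshift N (tagnat.Rank i a)) && ~~ block e (rshift N (tagnat.Rank i a)).
  have nR (b : 'I_(n i0)) : tagnat.Rank i0 b != tagnat.Rank i a.
    by rewrite -val_eqE /= tagnat.eq_Rank eq_sym (negbTE ii0).
  apply/andP; split; apply/existsP => -[k]; rewrite /block_index; case: (split_ordP k) => b _.
  - by rewrite eq_lshift (negbTE (nR b)).
  - by rewrite eq_rlshift.
  - by rewrite eq_lrshift.
  - by rewrite eq_rshift (negbTE (nR b)).
apply/colP => a; rewrite !mxE; have /andP[/negbTE n1 /negbTE n2] := nb a.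
by rewrite n1 n2.
Qed.

Lemma act_glue g y z : real_act (\mxdiag_i g i) (glue (block e) y z) =
  glue (block e) (real_act (\mxdiag_i g i) y) (real_act (\mxdiag_i g i) z).
Proof.
apply: block_comp_inj => i; rewrite block_comp_act; have [->|ii] := eqVneq i i0; first by rewrite !block_comp_glue block_comp_act.
by rewrite !block_comp_glue_out // block_comp_act.
Qed.

Lemma act_incl g x : block_comp i0 (real_act (\mxdiag_i g i) (bincl e x)) = block_comp i0 (bincl e (real_act (g i0) x)).
Proof. by rewrite block_comp_act !block_comp_incl /real_act rvecK. Qed.

Lemma bproj_act g z : bproj e (real_act (\mxdiag_i g i) z) = real_act (g i0) (bproj e z).
Proof. by apply: (can_inj (@cvecK R _)); rewrite cvec_bproj block_comp_act /real_act rvecK cvec_bproj. Qed.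

Lemma glue_comp y y' z z' : block_comp i0 y = block_comp i0 y' -> (forall i, i != i0 -> block_comp i z = block_comp i z') ->
  glue (block e) y z = glue (block e) y' z'.
Proof.
move=> Ey Ez; apply: block_comp_inj => i; have [->|ii] := eqVneq i i0; first by rewrite !block_comp_glue.
by rewrite !block_comp_glue_out // Ez.
Qed.

(** Invariants of a factor are invariants of the product. *)
Lemma peval_block p : exists q, forall v : 'cV[C]_N, peval q v = peval p (submxcol v i0).
Proof.
pose lq := [tuple mpoly.mpolyX C (mpoly.mnm1 (tagnat.Rank i0 k)) | k < n i0].
exists (mpoly.comp_mpoly lq p) => v; rewrite /peval mpoly.comp_mpoly_meval; apply: mpoly.meval_eq => k.
by rewrite tnth_mktuple mpoly.mevalXU mxE.
Qed.

End OneBlock.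

Lemma mxset_prod_eq (S S' : forall i, set 'M[C]_(n i)) : (forall i, S i = S' i) -> mxset_prod S = mxset_prod S'.
Proof. by move=> E; have -> : S = S' by apply: functional_extensionality_dep. Qed.

Lemma mulset_prod (S S' : forall i, set 'M[C]_(n i)) :
  mulset (mxset_prod S) (mxset_prod S') = mxset_prod (fun i => mulset (S i) (S' i)).
Proof.
apply/seteqP; split=> [_ [_ [g Sg <-] [_ [h Sh <-] <-]]|_ [k Sk <-]].
  by rewrite mxdiagM; exists (fun i => g i *m h i) => // i; exists (g i) => //; exists (h i).
have H i : exists gh : 'M[C]_(n i) * 'M[C]_(n i), [/\ S i gh.1, S' i gh.2 & gh.1 *m gh.2 = k i].
  by have [g Sg [h Sh E]] := Sk i; exists (g, h).
pose gh i := projT1 (cid (H i)).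
exists (\mxdiag_i (gh i).1); first by exists (fun i => (gh i).1) => // i; rewrite /gh; case: (cid _) => ? [].
exists (\mxdiag_i (gh i).2); first by exists (fun i => (gh i).2) => // i; rewrite /gh; case: (cid _) => ? [].
by rewrite mxdiagM; apply: eq_mxdiag => i; rewrite /gh; case: (cid _) => ? [].
Qed.

End BlockVectors.

(** * Characters of the product datum *)

Section ProductDatum.
Variables (R : realType) (m : nat) (D : 'I_m -> fc_datum R).
Hypothesis hD : forall i, is_finite_component (D i).
Local Notation C := R[i].
Local Notation n := (fun i => fc_dim (D i)).
Local Notation L := (fun i => fc_L (D i)).
Local Notation P := (prod_fc D).
Local Notation family := (forall i, set 'M[C]_(n i)).

Lemma factor_group i : exists J, [/\ square_in (L i) J, fc_A (D i) = [set mxcoset (L i) g | g in J]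
    & fc_B (D i) = [set mxcoset (L i) g | g in L i]].
Proof. exact: finite_component_cosets. Qed.

Lemma L_one i : L i 1%:M.
Proof. by have [J [LJ _ _]] := factor_group i; exact: grp1 LJ. Qed.

Lemma A_L i : fc_A (D i) (L i).
Proof. by have [J [LJ -> _]] := factor_group i; exact: cosets_grp LJ. Qed.

Lemma B_L i : fc_B (D i) (L i).
Proof.
have [J [LJ _ ->]] := factor_group i; exists 1%:M; first exact: L_one.
exact: coset1.
Qed.

Lemma coset_mulL i K : fc_A (D i) K -> mulset (L i) K = K.
Proof. by have [J [LJ -> _]] := factor_group i; exact: mulset_grp_l LJ _. Qed.

Lemma coset_mulR i K : fc_A (D i) K -> mulset K (L i) = K.
Proof. by have [J [LJ -> _]] := factor_group i; exact: mulset_grp_r LJ _. Qed.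

Lemma coset_sqr i K : fc_A (D i) K -> mulset K K = L i.
Proof. by have [J [LJ -> _]] := factor_group i; exact: mulset_sqr LJ _. Qed.

Lemma mem_A (K : family) : (forall i, fc_A (D i) (K i)) -> fc_A P (mxset_prod K).
Proof. by move=> AK; exists K. Qed.

Lemma prod_A_L : fc_A P (fc_L P).
Proof. by apply: mem_A => i; exact: A_L. Qed.

Lemma prod_A_sqr K' : fc_A P K' -> mulset K' K' = fc_L P.
Proof. by move=> [K AK <-]; rewrite mulset_prod; apply: mxset_prod_eq => i; exact: coset_sqr. Qed.

(** The inclusion of A_i as a factor of A. *)
Definition factor i (K : set 'M[C]_(n i)) : set 'M[C]_(\sum_i n i) := mxset_prod (eqtype.dfwith L K).

Lemma dfwith_A (K : family) i K' : (forall i, fc_A (D i) (K i)) -> fc_A (D i) K' ->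
  forall j, fc_A (D j) (eqtype.dfwith K K' j).
Proof.
move=> AK AK' j; have [<-|ij] := eqVneq i j; first by rewrite eqtype.dfwith_in.
by rewrite eqtype.dfwith_out.
Qed.

Lemma factor_A i K : fc_A (D i) K -> fc_A P (factor K).
Proof. by move=> AK; apply: mem_A; apply: dfwith_A => // j; exact: A_L. Qed.

Lemma factor_mul i K K' : fc_A (D i) K -> fc_A (D i) K' ->
  mulset (factor K) (factor K') = factor (mulset K K').
Proof.
move=> AK AK'; rewrite mulset_prod; apply: mxset_prod_eq => j.
have [<-|ij] := eqVneq i j; first by rewrite !eqtype.dfwith_in.
by rewrite !eqtype.dfwith_out // coset_sqr //; exact: A_L.
Qed.

(** An element of A is the product of its component in A_i and its component in the
    other factors. *)
Lemma factor_split i (K : family) : (forall i, fc_A (D i) (K i)) ->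
  mulset (mxset_prod (eqtype.dfwith K (L i))) (factor (K i)) = mxset_prod K.
Proof.
move=> AK; rewrite mulset_prod; apply: mxset_prod_eq => j.
have [<-|ij] := eqVneq i j; first by rewrite !eqtype.dfwith_in coset_mulL.
by rewrite !eqtype.dfwith_out // coset_mulR.
Qed.

Variable lam : set 'M[C]_(\sum_i n i) -> C.
Hypothesis lam_char : is_character (fc_A P) lam.

Lemma factor_character i : is_character (fc_A (D i)) (fun K => lam (factor K)).
Proof.
have [nz lM] := lam_char; split=> [K AK|K K' AK AK']; first by apply: nz; exact: factor_A.
by rewrite -factor_mul // lM //; exact: factor_A.
Qed.

(** A character that is trivial on every factor is trivial: change the components
    from L_i to K_i one at a time. *)
Lemma factor_nontrivial : (exists2 K, fc_A P K & lam K != 1) ->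
  exists i, exists2 K, fc_A (D i) K & lam (factor K) != 1.
Proof.
move=> [_ [K AK <-] lK]; apply: contrapT => nex.
have Z i K' : fc_A (D i) K' -> lam (factor K') = 1.
  by move=> AK'; apply: contrapT => /eqP nz; apply: nex; exists i, K'.
pose F (t : nat) (i : 'I_m) := if (i < t)%N then K i else L i.
have AF t i : fc_A (D i) (F t i) by rewrite /F; case: ifP => // _; exact: A_L.
have main t : (t <= m)%N -> lam (mxset_prod (F t)) = 1.
  elim: t => [|t IH] tm.
    rewrite (@mxset_prod_eq _ _ _ (F 0%N) L) //.
    exact: (character_grp prod_A_L prod_A_sqr lam_char).
  pose i : 'I_m := Ordinal tm.
  have <- : mulset (mxset_prod (F t)) (factor (K i)) = mxset_prod (F t.+1).
    rewrite mulset_prod; apply: mxset_prod_eq => j; rewrite /F [(j < t.+1)%N]ltnS [(j <= t)%N]leq_eqVlt.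
    have [<-|ij] := eqVneq i j; first by rewrite eqtype.dfwith_in ltnn eqxx coset_mulL.
    rewrite eqtype.dfwith_out // coset_mulR; last by case: ifP => // _; exact: A_L.
    suff -> : (j == t :> nat) = false by [].
    by apply/negbTE; apply: contra ij => /eqP jt; apply/eqP/val_inj.
  have [_ lM] := lam_char; rewrite lM ?IH ?(ltnW tm) ?mul1r //; [exact: Z|exact: mem_A|exact: factor_A].
move/eqP: lK; apply; rewrite -(main m (leqnn m)); congr lam; apply: mxset_prod_eq => i.
by rewrite /F ltn_ord.
Qed.

End ProductDatum.

(** * The complement of the zero fiber *)

Section RegularPart.
Variables (R : realType) (n : nat).
Local Notation C := R[i].
Local Notation V := 'rV[R]_(n + n).

Lemma R_part_pf (L : set 'M[C]_n) : exists q : V -> R, [/\ pf q, forall x, 0 <= q x &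
  @cvec R n @^-1` R_part L = [set x | 0 < q x]].
Proof.
have [s [_ [pq q0 qE]]] := nonzero_pf [set p - mpoly.mpolyC n (peval p 0) | p in invariant_poly L].
eexists; split; [exact: pq|exact: q0|].
have pB p v : peval (p - mpoly.mpolyC n (peval p 0)) v = peval p v - peval p 0.
  by rewrite {1}/peval mpoly.mevalB mpoly.mevalC.
apply/seteqP; split=> x; rewrite /= -/(cvec x).
  move=> Rx; apply/qE; apply: contrapT => nex; apply: Rx => p Lp.
  apply: contrapT => /eqP pv; apply: nex.
  by exists (p - mpoly.mpolyC n (peval p 0)); [exists p|rewrite pB subr_eq0].
by move=> /qE[_ [p Lp <-]]; rewrite pB subr_eq0 => /eqP pv zf; apply: pv; exact: zf.
Qed.

(** By the eigenfunctions, the zero fiber of L is the common zero set of invariants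
    that J multiplies by signs. The sum of their squared norms is J-invariant. *)
Lemma R_part_invariant (L J : set 'M[C]_n) : square_in L J -> exists q : V -> R,
  [/\ pf q, forall x, 0 <= q x, @cvec R n @^-1` R_part L = [set x | 0 < q x] &
      forall j x, J j -> q (real_act j x) = q x].
Proof.
move=> LJ; have [s [sE [pq q0 qE]]] := nonzero_pf [set p | [/\ invariant_poly L p, peval p 0 = 0 & eigen J (peval p)]].
eexists; split; [exact: pq|exact: q0| |].
  apply/seteqP; split=> x /=.
    move=> Rx; apply/qE; apply: contrapT => nex; apply: Rx => p Lp.
    apply: contrapT => /eqP pv; apply: nex.
    by have [p' [? ? ? ?]] := eigen_invariant LJ Lp pv; exists p'.
  by move=> /qE[p [Lp p0 _] pv] zf; move: pv; rewrite (zf p Lp) p0 eqxx.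
move=> j x Jj; rewrite /real_act rvecK !big_seq; apply: eq_bigr => p ps.
have [_ _ ep] := sE p ps; have [->|->] := ep j Jj => //.
by case: (peval p (cvec x)) => a b /=; rewrite !sqrrN.
Qed.

Lemma R_part_open (L : set 'M[C]_n) : open (@cvec R n @^-1` R_part L : set V) /\
  semialgebraic (@cvec R n @^-1` R_part L : set V).
Proof.
by have [q [pq _ ->]] := R_part_pf L; split; [exact: (open_qpos pq)|exact: (semialgebraic_qpos pq)].
Qed.

End RegularPart.

(** * From a factor to the product *)

Section MainArgument.
Variables (R : realType) (m : nat) (D : 'I_m -> fc_datum R).
Hypothesis hD : forall i, is_finite_component (D i).
Local Notation C := R[i].
Local Notation n := (fun i => fc_dim (D i)).
Local Notation N := (\sum_i fc_dim (D i))%N.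
Local Notation L := (fun i => fc_L (D i)).
Local Notation P := (prod_fc D).
Local Notation W := 'rV[R]_(N + N).
Variables (lam : set 'M[C]_N -> C) (r : set 'M[C]_N -> R).
Hypotheses (lam_char : is_character (fc_A P) lam) (lamE : forall K, fc_A P K -> lam K = ((r K)%:C)%C).
Variable i0 : 'I_m.
Local Notation e := (@block_index m n i0).
Local Notation V := 'rV[R]_(fc_dim (D i0) + fc_dim (D i0)).
Local Notation B := (block e).
Let e_inj : injective e := @block_index_inj m n i0.
Local Notation U0 := (@cvec R (n i0) @^-1` R_part (L i0) : set V).
Local Notation U := (@cvec R N @^-1` R_part (fc_L P) : set W).

Variable T : (W -> R) -> R.
Hypothesis eT : real_eqv (fc_A P) r setT T.

Let dT : tdist T.
Proof. by apply/tdist_rdist; case: eT. Qed.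

Lemma real_eqv_act K j a : fc_A P K -> K j -> rapid a -> T (fun z => a (real_act j z)) = r K * T a.
Proof. by move=> AK Kj ra; case: eT => _; apply=> //; apply/rapid_rschT. Qed.

(** Let a matrix act on the block i0 only: it moves g and fixes f'. *)
Lemma slice_eqv f' z0 : rapid f' -> real_eqv (fc_A (D i0)) (fun K => r (factor K)) setT
  (fun g => T (fun z => g (bproj e z) * f' (glue B z0 z))).
Proof.
move=> rf'; split; first by apply/tdist_rdist; exact: (tdist_slice e_inj z0 dT rf').
move=> K j a AK Kj /rapid_rschT ra.
pose g : forall i, 'M[C]_(n i) := eqtype.dfwith (fun i => 1%:M : 'M[C]_(n i)) j.
have Kg : factor K (\mxdiag_i g i).
  exists g => // i; rewrite /g; have [<-|ii] := eqVneq i0 i; first by rewrite !eqtype.dfwith_in.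
  by rewrite !eqtype.dfwith_out //; exact: L_one.
rewrite -(real_eqv_act (factor_A hD AK) Kg (rapid_tensor z0 (rapidA_proj e_inj ra) rf')); congr T.
apply/funext => z; rewrite bproj_act /g eqtype.dfwith_in; congr (_ * f' _).
apply: glue_comp => // i ii; rewrite block_comp_act eqtype.dfwith_out ?mul1mx //; by rewrite eq_sym.
Qed.

Variables (p : nat -> R -> R) (q : V -> R) (c : R).
Hypotheses (sp : smooth1 p) (p_lt0 : forall n t, t < 0 -> p n t = 0)
  (p_bd : forall n, exists B, forall t, `|p n t| <= B).
Hypotheses (pq : pf q) (c0 : 0 < c) (qE : U0 = [set x | 0 < q x]).
Hypothesis q_inv : forall K j x, fc_A (D i0) K -> K j -> q (real_act j x) = q x.

Lemma open_U0 : open U0. Proof. by case: (R_part_open (L i0)). Qed.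
Lemma open_U : open U. Proof. by case: (R_part_open (fc_L P)). Qed.
Lemma semialgebraic_U : semialgebraic U. Proof. by case: (R_part_open (fc_L P)). Qed.

Lemma q_ge_U0 x : c <= q x -> U0 x.
Proof. by rewrite qE => qx; exact: lt_le_trans qx. Qed.

(** The invariants of one factor detect the points of R_L. *)
Lemma q_ge_U z : c <= q (bproj e z) -> U z.
Proof.
move=> /q_ge_U0; rewrite /= cvec_bproj => R0 zf; apply: R0 => f fL.
have [f' Ef] := @peval_block R m n i0 f; have fL' : invariant_poly (fc_L P) f'.
  move=> _ v [g Lg <-]; rewrite !Ef -{1}(submxcolK v) mul_mxdiag_mxcol mxcolK; exact: fL.
by have := zf f' fL'; rewrite !Ef submxcol0.
Qed.

Variables (g0 : V -> R) (S : (V -> R) -> R).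
Hypotheses (rg : rapid g0) (eS : real_eqv (fc_A (D i0)) (fun K => r (factor K)) U0 S).

Local Notation Tnew := (fun f => S (bcontract e p q c T g0 f)).

Lemma r_split K : (forall i, fc_A (D i) (K i)) ->
  r (mxset_prod K) = r (mxset_prod (eqtype.dfwith K (L i0))) * r (factor (K i0)).
Proof.
move=> AK; have A1 : fc_A P (mxset_prod (eqtype.dfwith K (L i0))).
  by apply: mem_A; apply: dfwith_A => //; exact: A_L.
have A2 : fc_A P (factor (K i0)) by exact: factor_A.
have [_ lM] := lam_char; have := lM _ _ A1 A2; rewrite factor_split // !lamE //; last exact: mem_A.
by rewrite -rmorphM => /(congr1 (@complex.Re R)).
Qed.

(** Split the action into its part on the block, which moves the variable x of the
    contraction, and its part off the block, which T turns into a sign. Neither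
    part moves the argument of g, and the cutoff is invariant because q is. *)
Lemma bcontract_act K g f x : (forall i, fc_A (D i) (K i)) -> (forall i, K i (g i)) -> rsch U f ->
  bcontract e p q c T g0 (fun z => f (real_act (\mxdiag_i g i) z)) x =
  r (mxset_prod (eqtype.dfwith K (L i0))) * bcontract e p q c T g0 f (real_act (g i0) x).
Proof.
move=> AK Kg sf; rewrite [LHS]bcontractE // /bcontract /contract.
pose h : forall i, 'M[C]_(n i) := eqtype.dfwith g (1%:M : 'M[C]_(n i0)).
have A1 : fc_A P (mxset_prod (eqtype.dfwith K (L i0))).
  by apply: mem_A; apply: dfwith_A => //; exact: A_L.
have Kh : mxset_prod (eqtype.dfwith K (L i0)) (\mxdiag_i h i).
  exists h => // i; rewrite /h; have [<-|ii] := eqVneq i0 i; first by rewrite !eqtype.dfwith_in; exact: L_one.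
  by rewrite !eqtype.dfwith_out.
have rb := rapid_bcut sp p_lt0 p_bd pq c0 open_U semialgebraic_U q_ge_U sf.
have rt := rapid_tensor (bincl e (real_act (g i0) x)) (rapidA_proj e_inj rg) rb.
rewrite -(real_eqv_act A1 Kh rt); congr T; apply/funext => z.
have -> : bproj e (real_act (\mxdiag_i h i) z) = bproj e z.
  by rewrite bproj_act /h eqtype.dfwith_in /real_act mul1mx cvecK.
have -> : glue B (bincl e (real_act (g i0) x)) (real_act (\mxdiag_i h i) z) =
    real_act (\mxdiag_i g i) (glue B (bincl e x) z).
  rewrite act_glue; apply: glue_comp => [|i ii]; first by rewrite act_incl.
  by rewrite !block_comp_act /h eqtype.dfwith_out // eq_sym.
by rewrite /bcut /cut bproj_act bproj_glue // (q_inv _ (AK i0) (Kg i0)).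
Qed.

(** The signs of S and of T multiply to that of the product. *)
Lemma extension_eqv : real_eqv (fc_A P) r U Tnew.
Proof.
have [dS aS] := eS; split.
  exact: (rdist_extension e_inj sp p_lt0 p_bd pq c0 open_U0 open_U semialgebraic_U q_ge_U0 q_ge_U dT rg dS).
move=> _ _ f [K AK <-] [g Kg <-] sf.
have sb : rsch U0 (bcontract e p q c T g0 f).
  exact: (rsch_bcontract e_inj sp p_lt0 p_bd pq c0 open_U0 open_U semialgebraic_U q_ge_U0 q_ge_U dT rg sf).
rewrite (_ : bcontract _ _ _ _ _ _ _ = fun x => r (mxset_prod (eqtype.dfwith K (L i0))) * bcontract e p q c T g0 f (real_act (g i0) x)); last first.
  by apply/funext => x; exact: bcontract_act.
have sZ : rsch U0 (fun x => r (mxset_prod (eqtype.dfwith K (L i0))) * bcontract e p q c T g0 f x).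
  have := rschL (r (mxset_prod (eqtype.dfwith K (L i0)))) open_U0 sb (rsch0 open_U0).
  by congr rsch; apply/funext => x; rewrite addr0.
rewrite (aS _ _ _ (AK i0) (Kg i0) sZ) (@rdistZ _ _ U0 S open_U0 dS _ _ sb) r_split //.
by rewrite mulrA [r _ * r _]mulrC.
Qed.

End MainArgument.

Theorem proposition3p9 (R : realType) (m : nat) (hm : (0 < m)%N)
    (D : 'I_m -> fc_datum R)
    (hD : forall i : 'I_m, is_finite_component (D i))
    (hreg : forall i : 'I_m, componentwise_regular (D i)) :
  componentwise_regular (prod_fc D).
Proof.
move=> lam lam_char lam_nt lam_B no_R T0 eT0 f0 sf0; apply: contrapT => /eqP Tf0.
have [r lamE] := character_sign (prod_A_L hD) (prod_A_sqr hD) lam_char.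
have [i0 [K1 AK1 lamK1]] := factor_nontrivial hD lam_char lam_nt.
pose lam0 K := lam (factor (D := D) (i := i0) K).
have lam0_char : is_character (fc_A (D i0)) lam0 by exact: factor_character.
have lam0E K : fc_A (D i0) K -> lam0 K = ((r (factor (D := D) (i := i0) K))%:C)%C.
  by move=> AK; apply: lamE; exact: factor_A.
have lam0_B K : fc_B (D i0) K -> lam0 K = 1.
  move=> BK; apply: lam_B; exists (eqtype.dfwith (fun i => fc_L (D i)) K) => // i.
  have [<-|ii] := eqVneq i0 i; first by rewrite eqtype.dfwith_in.
  by rewrite eqtype.dfwith_out //; exact: B_L.
have lam0_L : lam0 (fc_L (D i0)) = 1 by apply: lam0_B; exact: B_L.
have lam_L : lam (fc_L (prod_fc D)) = 1 by apply: character_grp lam_char; [exact: prod_A_L|exact: prod_A_sqr].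
have oT k : open (@cvec R k @^-1` setT) by rewrite preimage_setT; exact: open_setT.
have [T [a [eT ra Ta]]] := real_eqv_of lamE (oT _) eT0 sf0 Tf0.
rewrite preimage_setT in eT ra.
have dT : tdist T by apply/tdist_rdist; case: eT.
have [g [f' [z0 [rg rf' Tgf]]]] := slice_nonzero (@block_index_inj m _ i0) dT (proj2 (rapid_rschT a) ra) Ta.
have nT : ~ no_eqv_distribution lam0 setT.
  have eS := slice_eqv hD i0 eT z0 rf'.
  apply: (real_eqv_refutes lam0E (oT _) (A_L hD i0) lam0_L (S := fun g => T (fun z => g (bproj _ z) * f' (glue _ z0 z))) _ (a := g)).
  - by rewrite preimage_setT; exact: eS.
  - by rewrite preimage_setT; apply/rapid_rschT.
  - exact: Tgf.
have [T' [eT' [h' [sh' T'h']]]] : exists T', eqv_distribution lam0 (R_part (fc_L (D i0))) T' /\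
    exists h, schwartz (R_part (fc_L (D i0))) h /\ T' h != 0.
  apply: contrapT => nex; apply: nT; have nt0 : exists2 K, fc_A (D i0) K & lam0 K != 1 by exists K1.
  apply: (hreg i0 lam0 lam0_char nt0 lam0_B).
  move=> T' eT' h sh; apply: contrapT => /eqP nz; apply: nex; exists T'; split=> //; by exists h.
have [J [LJ AJ _]] := finite_component_cosets (hD i0).
have [q [pq q0 qE qJ]] := R_part_invariant LJ.
have oU0 := @open_U0 R m D i0.
have [S [h [eS sh Sh]]] := real_eqv_of lam0E oU0 eT' sh' T'h'.
have [p [sp p0 p1 p1' pb]] := smooth_step R.
have [dS _] := eS.
have [c2 [c20 Sc2]] : exists c, 0 < c /\ S (fun x => cut p q c x * h x) != 0.
  by move: dS sh; rewrite qE => dS sh; exact: (cut_nonzero sp p1 p1' pb pq q0 dS sh Sh).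
(* any c with 2 c < c2 makes the cutoff at c equal to 1 where the one at c2 lives *)
pose c := c2 / 3.
have c0 : 0 < c by rewrite divr_gt0.
have cc2 : 2 * c < c2 by rewrite /c; lra.
have q_inv K j x : fc_A (D i0) K -> K j -> q (real_act j x) = q x.
  by rewrite AJ => AK Kj; apply: qJ; exact: cosets_J LJ _ _ AK Kj.
have eN := extension_eqv hD lam_char lamE eT sp p0 pb pq c0 qE q_inv rg eS.
have sU0 := proj2 (R_part_open (fc_L (D i0))); have oU := @open_U R m D.
have [sf Ef] := extension_tensor (@block_index_inj m _ i0) sp p0 pb pq c0 oU0 oU
  (q_ge_U0 c0 qE) (q_ge_U (D := D) c0 qE) dT rg dS p1 z0 cc2 sU0 sh rf'.
apply: (real_eqv_refutes lamE oU (prod_A_L hD) lam_L eN sf _ no_R).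
by rewrite Ef mulf_neq0.
Qed.
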